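(* Let $X=(X_n)_{n\in\mathbb Z}$ be a stationary process with values in a finite set $A$ which satisfies the priming condition: for every $a\in A$, $p(a|X^{\lhd}_{-1})>0$ almost surely. If $\sum_{n=0}^{\infty}\eta_n<+\infty$, then the natural filtration $\mathcal F^X$ is standard.
   Context: All $\sigma$-fields are complete. For a process $\xi$, $\xi^{\lhd}_n=(\xi_k)_{k\le n}$, $\mathcal F^\xi_n=\sigma(\xi^{\lhd}_n)$, $\mathcal F^\xi=(\mathcal F^\xi_n)_{n\in\mathbb Z}$, and $\xi_{i:j}=(\xi_n)_{i\le n\le j}$. $A^\lhd$ is the set of $A$-valued sequences $(x_n)_{n\le-1}$; $(\xi_n)_{n\le i}$ is identified with an element of $A^\lhd$ by shifting indices. For $x\in A^\lhd$, $z=(z_1,\dots,z_n)\in A^n$, $xz=(\dots,x_{-1},z_1,\dots,z_n)\in A^\lhd$. For $z\in A^n$ ($n\ge0$) and $a\in A$, $p(a|z)=\mathbb P(X_0=a\mid X_{-n:-1}=z)$, with the convention $p(a|z)=\mathbb P(X_0=a)$ if $\mathbb P(X_{-n:-1}=z)=0$. $p(\cdot|x)$, $x\in A^\lhd$, is a fixed regular version of the conditional law of $X_0$ given $X^\lhd_{-1}=x$. $\|\mu-\nu\|=\frac12\sum_a|\mu(a)-\nu(a)|$. For $n\ge0$, $$\eta_n=\sum_{z\in A^n}\mathbb E\big[\|p(\cdot|z)-p(\cdot|X^{\lhd}_{-n-1}z)\|\big]\,\mathbb P[X_{-n:-1}=z].$$ A filtration $\mathcal F^X$ is standard if, possibly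 after enlarging the probability space, it is immersed in the natural filtration of some i.i.d. process ($\mathcal F^X$ immersed in $\mathcal G$: $\mathcal F^X_n\subset\mathcal G_n$ for all $n$ and $\mathcal F^X_{n+1}$, $\mathcal G_n$ are conditionally independent given $\mathcal F^X_n$ for all $n$). *)

(* Defs.v *)
From HB Require Import structures.
From mathcomp Require Import all_boot all_order all_algebra.
From mathcomp Require Import all_classical all_reals all_analysis.
Set Implicit Arguments. Unset Strict Implicit. Unset Printing Implicit Defensive.
Import Order.TTheory GRing.Theory Num.Theory.
Import numFieldNormedType.Exports.
Local Open Scope classical_set_scope.
Local Open Scope ring_scope.

Section Defs.
Context {R : realType} {d : measure_display} {T : measurableType d}
  (P : probability T R).

Definition completion (S : set (set T)) : set (set T) :=
  [set B | measurable B /\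
     exists C, S C /\ P ((C `\` B) `|` (B `\` C)) = 0%E].

Definition is_cond_prob (H : set (set T)) (Ev : set T) (h : T -> R) :=
  (forall B : set R, measurable B -> H (h @^-1` B)) /\
  P.-integrable setT (EFin \o h) /\
  (forall C, H C -> (\int[P]_(w in C) (h w)%:E = P (Ev `&` C))%E).

Definition cond_indep (F1 F2 H : set (set T)) :=
  forall E1 E2 h1 h2 h12, F1 E1 -> F2 E2 ->
    is_cond_prob H E1 h1 -> is_cond_prob H E2 h2 ->
    is_cond_prob H (E1 `&` E2) h12 ->
    {ae P, forall w, h12 w = h1 w * h2 w}.

Definition immersed (F G : int -> set (set T)) :=
  (forall n, F n `<=` G n) /\ (forall n, cond_indep (F (n + 1)) (G n) (F n)).

Definition nat_filtration {dV} {V : measurableType dV} (U : int -> T -> V)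
  : int -> set (set T) :=
  fun n => completion
    (<<s [set E | exists k B, (k <= n)%R /\ measurable B /\ E = U k @^-1` B] >>).

Definition iid {dV} {V : measurableType dV} (U : int -> T -> V) :=
  (forall n, measurable_fun setT (U n)) /\
  (forall (s : seq int) (B : int -> set V), uniq s ->
     (forall i, measurable (B i)) ->
     P (\big[setI/setT]_(i <- s) (U i @^-1` B i)) =
     (\prod_(i <- s) P (U i @^-1` B i))%E) /\
  (forall n (B : set V), measurable B -> P (U n @^-1` B) = P (U 0 @^-1` B)).

Variable A : finType.

Definition nat_filtrationA (X : int -> T -> A) : int -> set (set T) :=
  fun n => completion
    (<<s [set E | exists k a, (k <= n)%R /\ E = X k @^-1` [set a]] >>).

Definition stationary (X : int -> T -> A) :=
  forall (m : int) (k : nat) (z : k.-tuple A),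
    P [set w | forall i : 'I_k, X (m + (i : nat)%:Z) w = tnth z i] =
    P [set w | forall i : 'I_k, X (i : nat)%:Z w = tnth z i].

(** A^<| is represented by nat -> A : x k stands for x_{-1-k} *)
Definition past (X : int -> T -> A) (i : int) (w : T) : nat -> A :=
  fun k => X (i - k%:Z) w.

(** x z = (..., x_{-1}, z_1, ..., z_n) *)
Definition cat_past (x : nat -> A) (n : nat) (z : n.-tuple A) : nat -> A :=
  fun k => if (k < n)%N then nth (x 0%N) z (n - k.+1) else x (k - n)%N.

Definition cyl_sigma : set (set (nat -> A)) :=
  <<s [set C | exists k a, C = [set x : nat -> A | x k = a]] >>.

Definition regular_version (X : int -> T -> A) (p : (nat -> A) -> A -> R) :=
  (forall x a, 0 <= p x a) /\ (forall x, \sum_(a : A) p x a = 1) /\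
  (forall a (B : set R), measurable B -> cyl_sigma ((p^~ a) @^-1` B)) /\
  (forall a C, cyl_sigma C ->
     P (X 0 @^-1` [set a] `&` past X (-1) @^-1` C) =
     (\int[P]_(w in past X (-1) @^-1` C) (p (past X (-1) w) a)%:E)%E).

Definition block_event (X : int -> T -> A) (n : nat) (z : n.-tuple A) : set T :=
  [set w | forall i : 'I_n, X ((i : nat)%:Z - n%:Z) w = tnth z i].

Definition pfin (X : int -> T -> A) (n : nat) (z : n.-tuple A) (a : A) : R :=
  if P (block_event X z) == 0%E then fine (P (X 0 @^-1` [set a]))
  else fine (P (X 0 @^-1` [set a] `&` block_event X z)) / fine (P (block_event X z)).

Definition tv (mu nu : A -> R) : R := 2^-1 * \sum_(a : A) `|mu a - nu a|.

Definition eta_n (X : int -> T -> A) (p : (nat -> A) -> A -> R) (n : nat) : \bar R :=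
  (\sum_(z : n.-tuple A)
     (\int[P]_w (tv (pfin X z) (p (cat_past (past X (- (n%:Z + 1)) w) z)))%:E)
     * P (block_event X z))%E.

End Defs.

Definition standard {R : realType} {d : measure_display} {T : measurableType d}
  (P : probability T R) {A : finType} (X : int -> T -> A) :=
  exists (d' : measure_display) (T' : measurableType d') (P' : probability T' R)
         (pi : T' -> T),
    measurable_fun setT pi /\
    (forall B, measurable B -> P' (pi @^-1` B) = P B) /\
    exists (dV : measure_display) (V : measurableType dV) (U : int -> T' -> V),
      iid P' U /\
      immersed P' (nat_filtrationA P' (fun n => X n \o pi)) (nat_filtration P' U).

(* Main.v *)
(* Enlarge the space by i.i.d. uniform variables [aux k]. Given the past [x],
   the letter [X k] can be written [coupling (p x) (U k)], where [U k] is
   obtained from [X k] and [aux k] by inverse sampling ([resample]); the [U k]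
   are then i.i.d. uniform, and [U k] is independent of everything up to time
   [k - 1].

   Two pasts fed with the same [U] form a Markov chain on pairs. The coupling
   is chosen so that two letters differ with probability at most a constant
   times the total variation distance, while every pair of positive
   distributions has a positive chance to agree on each letter. Comparing both
   chains with a third one started afresh from a common word, summability of
   [eta] makes two pasts that end with the same long word agree forever with
   probability close to one, uniformly outside a small set; priming gives a
   chance, bounded below on such a set, to produce this common word. Since
   each disagreement offers a new chance, the chain on pairs coalesces.

   Hence the chain started at time [k - n] from a fixed past and driven by [U]
   has the letter [X k] at time [k] up to a small probability, so that [X k]
   belongs to the completed past of [U]. Immersion holds because the law of
   [X (n + 1)] given the past of [U] is a function of the past of [X]. *)

Require Import Defs.
From HB Require Import structures.
From mathcomp Require Import all_boot all_order all_algebra.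
From mathcomp Require Import all_classical all_reals all_analysis.
From mathcomp Require Import measurable_realfun ring lra.
Set Implicit Arguments. Unset Strict Implicit. Unset Printing Implicit Defensive.
Import Order.TTheory GRing.Theory Num.Theory.
Import numFieldNormedType.Exports.
Local Open Scope classical_set_scope.
Local Open Scope ring_scope.

(** The observed letters and those of a chain started elsewhere must be read from the same [U k], so
    the coupling has to be a function of one law and one uniform variable; a maximal coupling, built
    for a given pair of laws, is excluded. A quantile coupling has the required form, at the price
    of a constant factor on the total variation distance, but under a fixed order of the letters a
    middle letter may have disjoint intervals under two positive laws. Every letter matters, since
    the common word is found by averaging over words and depends on the two pasts; hence the slices
    of [cell_lo], one for each first letter.

    [eta_n] integrates the past independently of the word and involves one past only: the third
    chain splits the comparison into two terms, each in a single past.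

    The lower bound on the chance to agree for [n] steps must not depend on [n], although the
    exceptional set may. Then each failure raises by a fixed amount the probability of agreeing
    later, which is bounded by 1: no infinite horizon is considered. This is done for two
    independent pasts, and Fubini provides the fixed past afterwards. *)

(* [pushforward m f] is a measure only through the unification of a
   measurability proof; carrying that proof as a parameter makes the
   canonical instances resolve. *)
Definition image_measure d d' (T1 : measurableType d) (T2 : measurableType d')
  (R : realType) (m : set T1 -> \bar R) (f : T1 -> T2)
  (mf : measurable_fun setT f) := fun A => m (f @^-1` A).

Section ImageMeasure.
Context d d' (T1 : measurableType d) (T2 : measurableType d') (R : realType).
Variables (f : T1 -> T2) (mf : measurable_fun setT f).

Lemma measurable_preimage A : measurable A -> measurable (f @^-1` A).
Proof. by move=> mA; rewrite -[X in measurable X]setTI; exact: mf. Qed.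

Section Measure.
Variable m : {measure set T1 -> \bar R}.
Local Notation im := (image_measure m mf).

Let im0 : im set0 = 0%E.
Proof. by rewrite /image_measure preimage_set0 measure0. Qed.

Let im_ge0 A : (0 <= im A)%E.
Proof. exact: measure_ge0. Qed.

Let im_sigma_additive : semi_sigma_additive im.
Proof.
move=> F mF tF mUF; rewrite /image_measure preimage_bigcup.
apply: measure_semi_sigma_additive.
- by move=> n; exact: measurable_preimage.
- apply/trivIsetP => /= i j _ _ ij; rewrite -preimage_setI.
  by move/trivIsetP : tF => /(_ _ _ _ _ ij) ->//; rewrite preimage_set0.
- by rewrite -preimage_bigcup; exact: measurable_preimage.
Qed.

HB.instance Definition _ := isMeasure.Build _ _ _ im im0 im_ge0 im_sigma_additive.

Lemma ge0_integral_image (g : T2 -> \bar R) :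
  measurable_fun setT g -> (forall y, 0 <= g y)%E ->
  (\int[im]_y g y = \int[m]_x g (f x))%E.
Proof.
move=> mg g0; have := @ge0_integral_pushforward _ _ _ _ R f mf m setT g.
by rewrite preimage_setT => <-.
Qed.
End Measure.

Section Finite.
Variable m : {finite_measure set T1 -> \bar R}.
Let im_fin : fin_num_fun (image_measure m mf).
Proof. by move=> A mA; apply: fin_num_measure; exact: measurable_preimage. Qed.
HB.instance Definition _ := @Measure_isFinite.Build _ _ _ (image_measure m mf) im_fin.
End Finite.

Section Proba.
Variable m : probability T1 R.
Let im1 : image_measure m mf setT = 1%E.
Proof. by rewrite /image_measure preimage_setT probability_setT. Qed.
HB.instance Definition _ := @Measure_isProbability.Build _ _ _ (image_measure m mf) im1.
End Proba.
End ImageMeasure.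

(** * Uniqueness of measures and affine changes of variable on the real line *)

Section RealMeasures.
Context {R : realType}.
Local Notation leb := (@lebesgue_measure R).

(** Half-open intervals are differences of half-lines; they are stable under intersection and
    generate the Borel sets. *)
Lemma measure_eq_halflines (m1 m2 : {finite_measure set R -> \bar R}) :
  (forall s, m1 `]-oo, s]%classic = m2 `]-oo, s]%classic) ->
  forall A, measurable A -> m1 A = m2 A.
Proof.
move=> H A mA.
have E a b : a <= b -> `]a, b]%classic = `]-oo, b]%classic `\` `]-oo, a]%classic :> set R.
  move=> ab; apply/seteqP; split=> x /=; rewrite !in_itv /=.
    by move=> /andP[ax xb]; split => //; apply/negP; rewrite -ltNge.
  by move=> [-> /negP]; rewrite -ltNge => ->.
apply: (measure_unique (@ocitv R) (fun n => `](- n%:R), n%:R]%classic)) => //.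
- exact: ocitvI.
- by move=> i; exact: is_ocitv.
- rewrite -subTset => x _; have : `|(x : R)| < (Num.Def.archi_bound `|x : R|)%:R by apply: archi_boundP; exact: normr_ge0.
  by rewrite ltr_norml => /andP[h1 h2]; exists (Num.Def.archi_bound `|x : R|) => //=; rewrite in_itv/= h1 ltW.
- move=> _ [[a b] _ <-] /=; have [ab|ba] := leP a b; last first.
    by rewrite set_itv_ge ?measure0// bnd_simp -leNgt ltW.
  have sub : `]-oo, a]%classic `<=` `]-oo, b]%classic by apply: subset_itvl.
  rewrite E// !measureD//.
  + by rewrite !setIidr//; congr (_ - _)%E; exact: H.
  + by rewrite ltey_eq fin_num_measure.
  + by rewrite ltey_eq fin_num_measure.
- by move=> k; rewrite ltey_eq fin_num_measure.
Qed.

(** As a function of [B] the left side is a measure that gives half-open intervals their length, so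
    it is the Lebesgue measure. *)
Lemma lebesgue_measure_affine (c e : R) (B : set R) : 0 < c -> measurable B ->
  (c%:E * leb [set w | B (c * w + e)%R] = leb B)%E.
Proof.
move=> c0 mB.
have mf : measurable_fun setT (fun w : R => c * w + e : measurableTypeR R).
  by apply: measurable_funD => //; apply: measurable_funM.
pose cc : {nonneg R} := NngNum (ltW c0).
rewrite -[LHS]/(mscale cc (image_measure leb mf) B).
apply/esym; apply: (@lebesgue_measure_unique _
  (mscale cc (image_measure leb mf))) => //= _ [[a b] _ <-].
rewrite /mscale/= /image_measure.
have -> : (fun w : R => c * w + e) @^-1` `]a, b] = `](a - e) / c, (b - e) / c]%classic.
  apply/seteqP; split=> x /=; rewrite !in_itv /= ltr_pdivrMr// ler_pdivlMr// ltrBlDr lerBrDr mulrC//.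
rewrite !lebesgue_measure_itv /= !lte_fin ltr_pM2r ?invr_gt0// ltrD2r.
case: ifPn => _; last by rewrite mule0.
by rewrite -EFinD -EFinM; congr EFin; field; rewrite gt_eqF.
Qed.
End RealMeasures.

Lemma le_measure_sub d (T : measurableType d) (R : realType)
    (mu : {measure set T -> \bar R}) (A B : set T) :
  measurable A -> measurable B -> A `<=` B -> (mu A <= mu B)%E.
Proof. by move=> mA mB AB; apply: le_measure; rewrite ?inE. Qed.

(** * Independent uniform variables on the unit interval *)

Section UniformMeasure.
Context {R : realType}.

(** The carrier stays [R] and the mass sits on [[0, 1[]; by [eq_unif] events need only be compared
    there. The interval is half-open like the cells of the coupling, which tile it exactly. *)
Definition unif (B : set R) : \bar R :=
  lebesgue_measure (B `&` `[0%R, 1%R[%classic).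

Let mI : @measurable _ (measurableTypeR R) `[0%R, 1%R[%classic.
Proof. exact: measurable_itv. Qed.

Let unif0 : unif set0 = 0%E.
Proof. exact: (measure0 (mrestr (@lebesgue_measure R) mI)). Qed.

Let unif_ge0 B : (0 <= unif B)%E.
Proof. exact: (measure_ge0 (mrestr (@lebesgue_measure R) mI)). Qed.

Let unif_sigma_additive : semi_sigma_additive unif.
Proof. exact: (@measure_semi_sigma_additive _ _ _ (mrestr (@lebesgue_measure R) mI)). Qed.

HB.instance Definition _ := isMeasure.Build _ _ _ unif
  unif0 unif_ge0 unif_sigma_additive.

Let unif1 : unif setT = 1%E.
Proof. by rewrite /unif setTI lebesgue_measure_itv /= lte_fin ltr01 -EFinB subr0. Qed.

HB.instance Definition _ := Measure_isProbability.Build _ _ _ unif unif1.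

Lemma unif_halfline (s : R) :
  unif `]-oo, s]%classic = (Num.min 1 (Num.max 0 s))%:E.
Proof.
rewrite /unif.
have [s0|s0] := ltP s 0.
  rewrite min_r// [X in lebesgue_measure X](_ : _ = set0) ?measure0//.
  apply/seteqP; split=> x //= []; rewrite !in_itv /= => xs /andP[x0 _].
  by have := le_lt_trans (le_trans x0 xs) s0; rewrite ltxx.
have [s1|s1] := ltP s 1.
  rewrite [X in lebesgue_measure X](_ : _ = `[0, s]%classic).
    by rewrite lebesgue_measure_itv /= lte_fin; case: ltP => [_|s0']; rewrite ?oppr0 ?adde0//; congr EFin; apply/eqP; rewrite eq_le s0 s0'.
  apply/seteqP; split=> x /=; rewrite !in_itv /=; first by move=> [-> /andP[-> _]].
  by move=> /andP[-> xs]; rewrite xs (le_lt_trans xs s1).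
rewrite [X in lebesgue_measure X](_ : _ = `[0, 1[%classic).
  by rewrite lebesgue_measure_itv /= lte_fin ltr01 oppr0 adde0.
apply/seteqP; split=> x /=; rewrite !in_itv /=; first by case.
by move=> /andP[-> x1]; rewrite x1 (le_trans (ltW x1) s1).
Qed.

Lemma unif_null (B : set R) : B `&` `[0, 1[ = set0 -> unif B = 0%E.
Proof. by rewrite /unif => ->; rewrite measure0. Qed.

Lemma eq_unif (B C : set R) :
  (forall w, 0 <= w < 1 -> B w <-> C w) -> unif B = unif C.
Proof.
move=> BC; rewrite /unif; congr (lebesgue_measure _).
by apply/seteqP; split=> w /= [h1 h2]; split => //; apply/BC => //; move: h2; rewrite in_itv.
Qed.

Lemma unif_le_itv (B : set R) (a b : R) : measurable B -> a <= b ->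
  B `<=` `[a, b[ -> (unif B <= (b - a)%:E)%E.
Proof.
move=> mB ab Bab; rewrite /unif.
apply: le_trans (_ : lebesgue_measure `[a, b[%classic <= _)%E.
  by apply: le_measure; rewrite ?inE//; [exact: measurableI|move=> x [/Bab]].
rewrite lebesgue_measure_itv /= lte_fin; case: ifPn => _; first by rewrite EFinB.
by rewrite lee_fin subr_ge0.
Qed.

Lemma unif_itv (a b : R) : 0 <= a -> a <= b -> b <= 1 ->
  unif `[a, b[%classic = (b - a)%:E.
Proof.
move=> a0 ab b1; rewrite /unif setIidl; last first.
  move=> x /=; rewrite !in_itv /= => /andP[ax xb].
  by rewrite (le_trans a0 ax) (lt_le_trans xb b1).
rewrite lebesgue_measure_itv /= lte_fin; case: ltP => [_|ba]; first by rewrite EFinB.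
by congr EFin; apply/esym/eqP; rewrite subr_eq0 eq_le ba ab.
Qed.

End UniformMeasure.

Arguments unif : clear implicits.

(* The even and the odd binary digits of a uniform variable are two
   independent uniform variables. *)
Section Splitting.
Context {R : realType}.
Implicit Types (w s t : R) (n : nat) (B : set R).
Local Notation half := (2^-1 : R).

Definition digit w : bool := half <= w.
Definition doubling w : R := if half <= w then 2 * w - 1 else 2 * w.

Lemma measurable_digit : measurable_fun setT digit.
Proof. exact: measurable_fun_ler. Qed.

Lemma measurable_doubling : measurable_fun setT doubling.
Proof.
apply: measurable_fun_ifT; first exact: measurable_digit.
- by apply: measurable_funB => //; exact: measurable_funM.
- exact: measurable_funM.
Qed.

(** [doubling] is affine of slope 2 on each half of the unit interval. The first binary digit is
    thus a fair coin, independent of the remaining digits, which form a uniform variable again. *)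
Lemma unif_digit (e : bool) B : measurable B ->
  unif R [set w | digit w = e /\ B (doubling w)] = (half%:E * unif R B)%E.
Proof.
move=> mB; rewrite /unif.
have mBI : measurable (B `&` `[0, 1[) by exact: measurableI.
rewrite -(lebesgue_measure_affine (if e then -1 else 0) (ltr0n R 2) mBI) muleA -EFinM mulVf ?mul1e//.
congr (lebesgue_measure _); apply/seteqP; split=> w /=; rewrite !in_itv /= /digit /doubling.
- case: e; case: (leP half w) => // h [[] // _ Bw /andP[w0 w1]] /=.
  + by split => //; apply/andP; split; lra.
  + by rewrite addr0; split => //; apply/andP; split; lra.
- case: e; rewrite /= ?addr0 => -[Bw /andP[w0 w1]].
  + have -> : half <= w by lra.
    by split => //; apply/andP; split; lra.
  + have -> : half <= w = false by apply/negbTE; rewrite -ltNge; lra.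
    by split => //; apply/andP; split; lra.
Qed.

(** Truncated binary expansion made of every second digit of [w], beginning with the first. The
    other digits are obtained by composing with [doubling]. *)
Fixpoint even_digits n w : R :=
  if n is n'.+1 then half * ((digit w)%:R + even_digits n' (doubling (doubling w)))
  else 0.

Lemma measurable_even_digits n : measurable_fun setT (even_digits n).
Proof.
elim: n => [|n IH] /=; first exact: measurable_cst.
apply: measurable_funM => //; apply: measurable_funD.
  rewrite (_ : (fun w => _) = \1_[set w | digit w]); last first.
    by apply/funext => w; rewrite indicE; congr (_%:R); case: (boolP (digit w)) => h; [rewrite mem_set|rewrite memNset//; apply/negP].
  apply: measurable_indic; rewrite -[X in measurable X]setTI.
  by apply: measurable_digit => //; exact: (@discrete_measurable_bool [set true]).
apply: measurableT_comp => //; apply: (measurableT_comp measurable_doubling).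
exact: measurable_doubling.
Qed.
End Splitting.

Section SplittingLaw.
Context {R : realType}.
Implicit Types (w s t : R) (n : nat) (B : set R).
Local Notation half := (2^-1 : R).
Local Notation digit := (@digit R).
Local Notation doubling := (@doubling R).
Local Notation even_digits := (@even_digits R).

Lemma unif_doubling (Q : bool -> set R) : (forall e, measurable (Q e)) ->
  unif R [set w | Q (digit w) (doubling w)] =
  (half%:E * (unif R (Q true) + unif R (Q false)))%E.
Proof.
move=> mQ.
have mdig e : measurable [set w | digit w = e].
  exact: (measurable_preimage measurable_digit (I : measurable [set e])).
have mQd e : measurable (doubling @^-1` Q e).
  by exact: (measurable_preimage measurable_doubling (mQ e)).
have mQQ e : measurable [set w | digit w = e /\ Q e (doubling w)].
  exact: measurableI (mdig e) (mQd e).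
rewrite [X in unif R X](_ : _ = [set w | digit w = true /\ Q true (doubling w)]
   `|` [set w | digit w = false /\ Q false (doubling w)]); last first.
  apply/seteqP; split=> w /=; last by case=> -[->].
  by case: (digit w) => ?; [left|right].
rewrite measureU; [|exact: mQQ|exact: mQQ|by apply/seteqP; split=> w //= -[[-> _] []]].
by rewrite ge0_muleDr//; congr (_ + _)%E; exact: unif_digit.
Qed.

(** The distribution function of [unif], by [unif_halfline]. *)
Definition clamp s : R := Num.min 1 (Num.max 0 s).

Variant clamp_spec s : R -> Prop :=
| ClampLow of s <= 0 : clamp_spec s 0
| ClampMid of 0 <= s & s <= 1 : clamp_spec s s
| ClampHigh of 1 <= s : clamp_spec s 1.

Lemma clampP s : clamp_spec s (clamp s).
Proof.
rewrite /clamp; have [s0|s0] := leP s 0; first by rewrite min_r//; constructor.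
by have [s1|s1] := leP 1 s; constructor => //; exact: ltW.
Qed.

(** The distribution function conditioned on the first binary digit; this self-similarity drives the
    induction in [unif_two_digits]. *)
Lemma clamp_half s : clamp s = half * (clamp (2 * s) + clamp (2 * s - 1)).
Proof. by case: (clampP s); case: (clampP (2 * s)); case: (clampP (2 * s - 1)) => *; lra. Qed.

Lemma clamp_ge0 s : 0 <= clamp s.
Proof. by rewrite /clamp le_min ler01 le_max lexx. Qed.

Lemma clamp_le1 s : clamp s <= 1.
Proof. by rewrite /clamp ge_min lexx. Qed.

Lemma clamp_lipschitz s h : 0 <= h -> clamp (s + h) <= clamp s + h.
Proof. by move=> h0; case: (clampP s); case: (clampP (s + h)) => *; lra. Qed.

Lemma even_digits_bound n w : 0 <= even_digits n w <= 1.
Proof.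
elim: n w => [|n IH] w /=; first by rewrite lexx ler01.
have /andP[h1 h2] := IH (doubling (doubling w)).
by case: digit => /=; apply/andP; split; lra.
Qed.

Lemma even_digits_nd n w : even_digits n w <= even_digits n.+1 w.
Proof.
elim: n w => [|n IH] w; first by have /andP[] := even_digits_bound 1 w.
rewrite [leLHS]/= [leRHS]/=; have := IH (doubling (doubling w)).
by rewrite /=; case: digit => /= *; lra.
Qed.

Definition two_digits n s t : set R :=
  [set w | even_digits n w <= s /\ even_digits n (doubling w) <= t].

Lemma measurable_two_digits n s t : measurable (two_digits n s t).
Proof.
have m s' : measurable [set w | even_digits n w <= s'].
  have -> : [set w | even_digits n w <= s'] = even_digits n @^-1` `]-oo, s']%classic.
    by apply/seteqP; split=> w /=; rewrite in_itv.
  exact: (measurable_preimage (@measurable_even_digits R n)).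
exact: measurableI (m s) (measurable_preimage measurable_doubling (m t)).
Qed.

(** A truncation to [n] digits lies below the full value by at most [2 ^- n], whence the shift in
    the upper bound. Each induction step consumes two digits of [w], one for each coordinate, and
    applies [clamp_half] to both factors. *)
Lemma unif_two_digits n s t :
  ((clamp s * clamp t)%:E <= unif R (two_digits n s t))%E /\
  (unif R (two_digits n s t) <=
     (clamp (s + 2 ^- n) * clamp (t + 2 ^- n))%:E)%E.
Proof.
elim: n s t => [|n IH] s t.
  rewrite expr0 invr1; have [s0|s0] := leP 0 s; last first.
    have -> : clamp s = 0 by rewrite /clamp max_l ?ltW// min_r.
    rewrite mul0r measure_ge0; split => //.
    rewrite [X in unif R X](_ : _ = set0) ?measure0 ?lee_fin ?mulr_ge0 ?clamp_ge0//.
    by apply/seteqP; split=> w //= -[/=]; rewrite leNgt s0.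
  have [t0|t0] := leP 0 t; last first.
    have -> : clamp t = 0 by rewrite /clamp max_l ?ltW// min_r.
    rewrite mulr0 measure_ge0; split => //.
    rewrite [X in unif R X](_ : _ = set0) ?measure0 ?lee_fin ?mulr_ge0 ?clamp_ge0//.
    by apply/seteqP; split=> w //= -[_ /=]; rewrite leNgt t0.
  have -> : two_digits 0 s t = setT by apply/seteqP; split=> // w _; split.
  have c1 x : 0 <= x -> clamp (x + 1) = 1.
    by move=> x0; rewrite /clamp max_r ?addr_ge0// min_l// lerDr.
  rewrite probability_setT !c1// mulr1; split => //.
  by rewrite lee_fin -[leRHS]mulr1 ler_pM ?clamp_ge0 ?clamp_le1.
(* Once the first two digits [e] and [e'] are read, the thresholds [s] and [t] become [2 * s - e]
   and [2 * t - e']. *)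
pose Q2 (e e' : bool) := two_digits n (2 * s - e%:R) (2 * t - e'%:R).
pose Q (e : bool) : set R := [set w | Q2 e (digit w) (doubling w)].
have EQ : two_digits n.+1 s t = [set w | Q (digit w) (doubling w)].
  apply/seteqP; split=> w /=; rewrite /two_digits /Q /Q2 /=.
    by move=> [h1 h2]; split; lra.
  by move=> [h1 h2]; split; lra.
have mQ2 e e' : measurable (Q2 e e') by exact: measurable_two_digits.
have mQ e : measurable (Q e).
  have -> : Q e = ([set w | digit w = true] `&` (doubling @^-1` Q2 e true)) `|`
                  ([set w | digit w = false] `&` (doubling @^-1` Q2 e false)).
    apply/seteqP; split=> w; rewrite /Q /=; last by case=> -[->].
    by case: (digit w) => ?; [left|right].
  apply: measurableU; apply: measurableI; try by apply: (measurable_preimage measurable_doubling).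
    exact: (measurable_preimage measurable_digit (I : measurable [set true])).
  exact: (measurable_preimage measurable_digit (I : measurable [set false])).
rewrite EQ unif_doubling// !unif_doubling//.
have [f fE] : exists f : bool -> bool -> R, forall e e', unif R (Q2 e e') = (f e e')%:E.
  by exists (fun e e' => fine (unif R (Q2 e e'))) => e e'; rewrite fineK//; exact: (fin_num_measure (unif R) _ (mQ2 e e')).
have H (e e' : bool) : clamp (2 * s - e%:R) * clamp (2 * t - e'%:R) <= f e e' /\
   f e e' <= clamp (2 * (s + 2 ^- n.+1) - e%:R) * clamp (2 * (t + 2 ^- n.+1) - e'%:R).
  have [h1 h2] := IH (2 * s - e%:R) (2 * t - e'%:R).
  rewrite -!lee_fin -fE; split => //.
  have E2 : 2 * 2 ^- n.+1 = 2 ^- n :> R by rewrite (exprS 2 n) invfM mulrA divff// mul1r.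
  have E (x : R) (b : bool) : 2 * (x + 2 ^- n.+1) - b%:R = 2 * x - b%:R + 2 ^- n.
    by rewrite mulrDr E2 addrAC.
  by rewrite !E.
rewrite !fE.
pose g := half * (half * (f true true + f true false) + half * (f false true + f false false)).
change ((clamp s * clamp t)%:E <= g%:E /\
  g%:E <= (clamp (s + 2 ^- n.+1) * clamp (t + 2 ^- n.+1))%:E)%E.
rewrite !lee_fin /g {g}.
rewrite !(clamp_half (s + _)) !(clamp_half (t + _)) (clamp_half s) (clamp_half t).
move: (H true true) (H true false) (H false true) (H false false).
rewrite /= !subr0; move: (f _ _) (f _ _) (f _ _) (f _ _) => f1 f2 f3 f4.
move: (clamp _) (clamp _) (clamp _) (clamp _) (clamp _) (clamp _) (clamp _) (clamp _).
move=> x1 x2 x3 x4 x5 x6 x7 x8 [a1 a2] [b1 b2] [c1 c2] [d1 d2].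
by split; lra.
Qed.
End SplittingLaw.

Section IidUniform.
Context {R : realType}.
Implicit Types (w s t : R) (n : nat) (B : set R).
Local Notation even_digits := (@even_digits R).
Local Notation doubling := (@doubling R).

Definition split1 w : R := sup (range (even_digits ^~ w)).

Lemma even_digits_ub w : has_ubound (range (even_digits ^~ w)).
Proof. by exists 1 => _ [n _ <-]; have /andP[] := even_digits_bound n w. Qed.

Lemma split1_le w s : split1 w <= s <-> forall n, even_digits n w <= s.
Proof.
split=> [ws n|H].
  by apply: le_trans ws; apply: ub_le_sup; [exact: even_digits_ub|exists n].
by apply: ge_sup; [exists (even_digits 0 w), 0%N|move=> _ [n _ <-]].
Qed.

Lemma measurable_split1 : measurable_fun setT split1.
Proof.
apply: (measurable_fun_cvg (h := even_digits)) => [n|w _].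
  exact: measurable_even_digits.
apply: nondecreasing_cvgn; last exact: even_digits_ub.
by apply/nondecreasing_seqP => n; exact: even_digits_nd.
Qed.

Definition split2 w : R := split1 (doubling w).

Lemma measurable_split2 : measurable_fun setT split2.
Proof. exact: measurableT_comp measurable_split1 (@measurable_doubling R). Qed.

(** The event is the decreasing intersection of the events [two_digits n s t], whose measures are
    squeezed onto the product because [clamp] is 1-Lipschitz. *)
Lemma unif_split_halflines s t :
  unif R [set w | split1 w <= s /\ split2 w <= t] = (clamp s * clamp t)%:E.
Proof.
have E : [set w | split1 w <= s /\ split2 w <= t] = \bigcap_n two_digits n s t.
  apply/seteqP; split=> w /=.
    by move=> [/split1_le h1 /split1_le h2] n _; split.
  by move=> h; split; apply/split1_le => n; have [] := h n I.
have mT n : measurable (two_digits n s t) by exact: measurable_two_digits.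
have mI : measurable (\bigcap_n two_digits n s t) by exact: bigcapT_measurable.
rewrite E; apply/eqP; rewrite eq_le; apply/andP; split; last first.
  have := nonincreasing_cvg_mu (mu := unif R) _ mT mI _.
  have oo : (unif R (two_digits 0 s t) < +oo)%E.
    by rewrite ltey_eq (fin_num_measure (unif R) _ (mT 0%N)).
  have ni : nonincreasing_seq (fun n => two_digits n s t).
    apply/nonincreasing_seqP => n; apply/subsetPset => w /= [h1 h2].
    by split; [apply: le_trans h1|apply: le_trans h2]; exact: even_digits_nd.
  move=> /(_ oo ni) c; rewrite -(cvg_lim _ c)//; apply: lime_ge.
    by apply/cvg_ex; eexists; exact: c.
  by apply: nearW => n; have [] := unif_two_digits n s t.
apply/lee_addgt0Pr => e e0.
(* With [h = 2 ^- n <= 1], shifting both factors, which are at most 1, by [h] raises the product by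
   at most [2 * h + h ^+ 2 <= 3 * h]. *)
have [n ne] : exists n, 3 * 2 ^- n <= e.
  have e3 : 0 < e / 3 by rewrite divr_gt0.
  have [k _ /(_ k (leqnn k)) hk] := near_infty_natSinv_expn_lt (PosNum e3).
  by exists k; move: hk; rewrite div1r /= => hk; lra.
have [_ h] := unif_two_digits n s t.
apply: le_trans (_ : unif R (two_digits n s t) <= _)%E.
  by apply: le_measure_sub => // w; apply.
apply: (le_trans h); rewrite -EFinD lee_fin.
have h0 : 0 <= 2 ^- n :> R by rewrite invr_ge0 exprn_ge0.
have h1 : 2 ^- n <= 1 :> R by rewrite invf_le1 ?exprn_gt0// exprn_ege1// ler1n.
have := clamp_lipschitz s h0; have := clamp_lipschitz t h0.
move: (clamp_ge0 s) (clamp_le1 s) (clamp_ge0 t) (clamp_le1 t).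
move: (clamp_ge0 (s + 2 ^- n)) (clamp_ge0 (t + 2 ^- n)).
move: (clamp _) (clamp _) (clamp s) (clamp t) h0 h1 ne.
move: (2 ^- n) => h' a b c d *.
apply: le_trans (_ : (c + h') * (d + h') <= _); first by rewrite ler_pM.
nra.
Qed.

(** Passes from half-lines to Borel sets one coordinate at a time: with the event on the other
    coordinate frozen, both sides are finite measures on the line. *)
Lemma unif_split B C : measurable B -> measurable C ->
  unif R [set w | B (split1 w) /\ C (split2 w)] = (unif R B * unif R C)%E.
Proof.
have mP1 D : measurable D -> measurable (split1 @^-1` D).
  exact: (measurable_preimage measurable_split1).
have mP2 D : measurable D -> measurable (split2 @^-1` D).
  exact: (measurable_preimage measurable_split2).
have mfin D : measurable D -> unif R D \is a fin_num.
  by move=> mD; exact: (fin_num_measure (unif R) D mD).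
have H t B' : measurable B' ->
    unif R [set w | B' (split1 w) /\ split2 w <= t] = (unif R B' * (clamp t)%:E)%E.
  move=> mB'; have mt : measurable [set w | split2 w <= t].
    by have := mP2 _ (measurable_itv `]-oo, t]); rewrite (_ : _ @^-1` _ = [set w | split2 w <= t])//;
      apply/seteqP; split=> w /=; rewrite in_itv.
  pose ct : {nonneg R} := NngNum (clamp_ge0 t).
  pose m1 : {finite_measure set R -> \bar R} :=
    image_measure (mrestr (unif R) mt) measurable_split1.
  pose m2 : {finite_measure set R -> \bar R} := mscale ct (unif R).
  have -> : (unif R B' * (clamp t)%:E)%E = m2 B' by rewrite muleC.
  rewrite -[LHS]/(m1 B'); apply: measure_eq_halflines => // s.
  rewrite -[RHS]/((clamp t)%:E * unif R `]-oo, s]%classic)%E.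
  rewrite unif_halfline -EFinM mulrC -unif_split_halflines.
  congr (unif R _); apply/seteqP; split=> w /=; rewrite in_itv /= => -[h1 h2]//.
move=> mB mC.
pose uB : {nonneg R} := NngNum (fine_ge0 (measure_ge0 (unif R) B)).
have uBE : (uB%:num)%:E = unif R B by rewrite /= fineK// mfin.
pose m1 : {finite_measure set R -> \bar R} :=
  image_measure (mrestr (unif R) (mP1 B mB)) measurable_split2.
pose m2 : {finite_measure set R -> \bar R} := mscale uB (unif R).
rewrite (_ : [set w | _] = (split2 @^-1` C) `&` (split1 @^-1` B)); last by rewrite setIC.
rewrite -uBE -[RHS]/(m2 C) -[LHS]/(m1 C).
apply: measure_eq_halflines => // t.
rewrite -[RHS]/((uB%:num)%:E * unif R `]-oo, t]%classic)%E uBE unif_halfline -H//.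
by congr (unif R _); apply/seteqP; split=> w /=; rewrite in_itv /= => -[].
Qed.

(** [split1] is kept and [split2] is split again, so that a single real coordinate carries a whole
    sequence of independent uniform variables. *)
Fixpoint uniforms n w : R :=
  if n is n'.+1 then uniforms n' (split2 w) else split1 w.

Lemma measurable_uniforms n : measurable_fun setT (uniforms n).
Proof.
elim: n => [|n IH]; first exact: measurable_split1.
exact: measurableT_comp IH measurable_split2.
Qed.

(** Induction on a bound [N] for the indices: index 0 reads [split1], all the others read [split2],
    where each index drops by one. *)
Lemma unif_uniforms (s : seq nat) (B : nat -> set R) :
  uniq s -> (forall i, measurable (B i)) ->
  unif R (\big[setI/setT]_(i <- s) (uniforms i @^-1` B i)) =
  (\prod_(i <- s) unif R (B i))%E.
Proof.
have [N] : exists N, all (fun i => (i < N)%N) s.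
  exists (\max_(i <- s) i.+1)%N; apply/allP => i si.
  by rewrite (leq_trans (leqnn i.+1))// (big_rem i)//= leq_maxl.
elim: N s B => [|N IH] s B.
  by case: s => [|//] _ _ _; rewrite !big_nil probability_setT.
pose E (t : seq nat) : set R := \big[setI/setT]_(i <- t) (uniforms i @^-1` B i.+1).
have mE (t : seq nat) : (forall i, measurable (B i)) -> measurable (E t).
  move=> mB; apply: bigsetI_measurable => i _.
  exact: (measurable_preimage (@measurable_uniforms i)).
have EE (t : seq nat) : \big[setI/setT]_(i <- map S t) (uniforms i @^-1` B i) = split2 @^-1` E t.
  by rewrite big_map /E (big_morph _ (preimage_setI split2) (preimage_setT split2)).
have tE (t : seq nat) : all (fun i => (i < N.+1)%N) t -> 0%N \notin t ->
    exists2 t', t = map S t' & all (fun i => (i < N)%N) t'.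
  elim: t => [|[|i] t IHt] /=; [by exists [::]|by []|].
  by move=> /andP[iN /IHt]; rewrite inE /= => /[apply] -[t' -> aN]; exists (i :: t') => //=; apply/andP.
move=> aN us mB.
have [s0|s0] := boolP (0%N \in s); last first.
  have [t est aNt] := tE _ aN s0.
  have ut : uniq t by move: us; rewrite est (map_inj_uniq succn_inj).
  rewrite {1}est EE; have := unif_split (@measurableT _ R) (mE t mB).
  rewrite probability_setT mul1e.
  rewrite (_ : [set w | _] = split2 @^-1` E t); last by apply/seteqP; split=> w //= [].
  move=> ->; rewrite est big_map; exact: (IH t (fun i => B i.+1) aNt ut).
have ps := perm_to_rem s0.
have u0 : uniq (0%N :: rem 0%N s) by rewrite -(perm_uniq ps).
have [t est aNt] : exists2 t', rem 0%N s = map S t' & all (fun i => (i < N)%N) t'.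
  apply: tE; last by case/andP: u0.
  by apply/allP => i /mem_rem; exact: (allP aN).
have ut : uniq t by move: u0; rewrite cons_uniq est (map_inj_uniq succn_inj) => /andP[].
rewrite !(perm_big _ ps) /= !big_cons est EE unif_split//; last exact: mE.
by rewrite big_map; congr (_ * _)%E; exact: (IH t (fun i => B i.+1) aNt ut).
Qed.
End IidUniform.

(** * Finite partitions and covers *)

Section FiniteUnions.
Context d (T : measurableType d) (R : realType).
Variable mu : {measure set T -> \bar R}.

Lemma measure_finite_partition (J : finType) (C : J -> set T) (B : set T) :
  measurable B -> (forall j, measurable (C j)) ->
  (forall t j k, C j t -> C k t -> j = k) ->
  (forall t, B t -> exists j, C j t) ->
  mu B = (\sum_(j : J) mu (B `&` C j))%E.
Proof.
move=> mB mC Cinj Bcov.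
have mF j : measurable (B `&` C j) by exact: measurableI.
suff H (r : seq J) : uniq r -> mu (\big[setU/set0]_(j <- r) (B `&` C j)) =
    (\sum_(j <- r) mu (B `&` C j))%E.
  rewrite -big_enum -H ?enum_uniq//; congr (mu _); rewrite -bigcup_seq.
  apply/seteqP; split=> t /=; last by move=> [j _ []].
  by move=> Bt; have [j Cj] := Bcov t Bt; exists j => //=; rewrite mem_enum.
elim: r => [|j r IH] /=; first by rewrite !big_nil measure0.
move=> /andP[jr ur]; rewrite !big_cons measureU; [by congr (_ + _)%E; exact: IH|exact: mF|exact: bigsetU_measurable|].
rewrite -bigcup_seq; apply/seteqP; split=> t //= [[Bt Cj] [k /= kr [_ Ck]]].
by move: jr; rewrite (Cinj _ _ _ Cj Ck) kr.
Qed.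

Lemma measure_le_cover (J : finType) (D : J -> set T) (B : set T) :
  measurable B -> (forall j, measurable (D j)) ->
  (forall t, B t -> exists j, D j t) ->
  (mu B <= \sum_(j : J) mu (D j))%E.
Proof.
move=> mB mD Bcov.
suff H (r : seq J) : (mu (\big[setU/set0]_(j <- r) D j) <= \sum_(j <- r) mu (D j))%E.
  rewrite -big_enum; apply: le_trans (H _); apply: le_measure_sub => //.
      exact: bigsetU_measurable.
  move=> t Bt; have [j Dj] := Bcov t Bt.
  by rewrite -bigcup_seq; exists j => //=; rewrite mem_enum.
elim: r => [|j r IH] /=; first by rewrite !big_nil measure0.
rewrite !big_cons; apply: (le_trans (measureU2 _ _ _)) => //.
  exact: bigsetU_measurable.
exact: leeD2l.
Qed.
End FiniteUnions.

(** * A quantile coupling with common cells *)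

Section Coupling.
Context {R : realType} {A : finType}.
Implicit Types (q : A -> R) (a b c i : A) (u w : R).

Definition prob_vec q := (forall a, 0 <= q a) /\ \sum_a q a = 1.

Definition letters i : seq A := i :: rem i (enum A).

Lemma perm_letters i : perm_eq (letters i) (enum A).
Proof. by rewrite perm_sym; apply: perm_to_rem; rewrite mem_enum. Qed.

Lemma letters_uniq i : uniq (letters i).
Proof. by rewrite (perm_uniq (perm_letters i)) enum_uniq. Qed.

Lemma mem_letters i b : b \in letters i.
Proof. by rewrite (perm_mem (perm_letters i)) mem_enum. Qed.

Lemma sum_letters i q : \sum_(c <- letters i) q c = \sum_c q c.
Proof. by rewrite (perm_big _ (perm_letters i)) /= big_enum. Qed.

Definition cdf_before q i b : R :=
  \sum_(c <- take (index b (letters i)) (letters i)) q c.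

Lemma cdf_beforeD q i b :
  cdf_before q i b + q b = \sum_(c <- take (index b (letters i)).+1 (letters i)) q c.
Proof.
have bi : (index b (letters i) < size (letters i))%N by rewrite index_mem mem_letters.
by rewrite (take_nth b bi) nth_index ?mem_letters// big_rcons/=.
Qed.

Lemma sum_take_le q (s : seq A) m n : (forall a, 0 <= q a) -> (m <= n)%N ->
  \sum_(c <- take m s) q c <= \sum_(c <- take n s) q c.
Proof.
move=> q0 mn; rewrite -(cat_take_drop m (take n s)) take_takel// big_cat/=.
by rewrite lerDl sumr_ge0.
Qed.

Lemma cdf_before_ge0 q i b : prob_vec q -> 0 <= cdf_before q i b.
Proof. by move=> [q0 _]; rewrite sumr_ge0. Qed.

Lemma cdf_before_le1 q i b : prob_vec q -> cdf_before q i b + q b <= 1.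
Proof.
move=> [q0 q1]; rewrite cdf_beforeD -q1 -(sum_letters i) -{3}(take_size (letters i)).
by apply: sum_take_le => //; rewrite index_mem mem_letters.
Qed.

Lemma cdf_before_self q i : cdf_before q i i = 0.
Proof. by rewrite /cdf_before /letters /= eqxx take0 big_nil. Qed.

Lemma cdf_before_disjoint q i b c u : prob_vec q ->
  cdf_before q i b <= u < cdf_before q i b + q b ->
  cdf_before q i c <= u < cdf_before q i c + q c -> b = c.
Proof.
move=> [q0 q1]; rewrite !cdf_beforeD.
wlog bc : b c / (index b (letters i) <= index c (letters i))%N.
  by move=> W Hb Hc; have [/W|/ltnW/W] := leqP (index b (letters i)) (index c (letters i)); [exact|move=> ->].
move=> /andP[_ ub] /andP[cu _]; move: bc; rewrite leq_eqVlt => /orP[/eqP e|bc].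
  by rewrite -(nth_index b (mem_letters i b)) e nth_index// mem_letters.
have := le_lt_trans (le_trans (sum_take_le (letters i) q0 bc) cu) ub.
by rewrite ltxx.
Qed.

Lemma cdf_before_cover q i u : prob_vec q -> 0 <= u < 1 ->
  exists b, cdf_before q i b <= u < cdf_before q i b + q b.
Proof.
move=> [q0 q1]; rewrite -q1 -(sum_letters i) /cdf_before.
elim: (letters i) (letters_uniq i) u => [|c s IH] /= us u.
  by rewrite big_nil => /andP[h1 h2]; have := le_lt_trans h1 h2; rewrite ltxx.
move: us => /andP[cs us]; rewrite big_cons => /andP[u0 u1].
have [uc|cu] := ltP u (q c).
  by exists c; rewrite eqxx take0 big_nil add0r u0.
have /(IH us)[b /andP[h1 h2]] : 0 <= u - q c < \sum_(j <- s) q j.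
  by rewrite subr_ge0 cu ltrBlDl.
have bs : b \in s.
  rewrite -index_mem ltnNge; apply/negP => sb.
  have : \sum_(c0 <- take (index b s) s) q c0 <= u - q c := h1.
  by rewrite take_oversize// leNgt ltrBlDl u1.
have cb : c != b by apply: contraNneq cs => ->.
exists b; rewrite (negbTE cb)/= big_cons -lerBrDl h1/=.
by rewrite -addrA -ltrBlDl.
Qed.

Local Notation N := (#|A|%:R : R).
Definition rank i : R := (enum_rank i : nat)%:R.
(** The unit interval is cut into [N] slices of length [1 / N], one for each letter [i]. Slice [i]
    is divided into intervals of lengths [q b / N], laid out in the order [letters i]. *)
Definition cell_lo q i b : R := (rank i + cdf_before q i b) / N.
Definition cell_hi q i b : R := (rank i + cdf_before q i b + q b) / N.

Definition in_cell q i b u : bool := cell_lo q i b <= u < cell_hi q i b.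

Lemma cardA_gt0 (a : A) : 0 < N.
Proof. by rewrite ltr0n; apply/card_gt0P; exists a. Qed.

Lemma in_cellE q i b u : in_cell q i b u =
  (cdf_before q i b <= u * N - rank i < cdf_before q i b + q b).
Proof.
have N0 := cardA_gt0 i.
by rewrite /in_cell /cell_lo /cell_hi ler_pdivrMr// ltr_pdivlMr// lerBrDl ltrBlDl addrA.
Qed.

Lemma rank_inj i j u : rank i <= u < rank i + 1 -> rank j <= u < rank j + 1 -> i = j.
Proof.
move=> /andP[i1 i2] /andP[j1 j2]; apply: enum_rank_inj; apply: val_inj => /=.
have : rank i < rank j + 1 by apply: le_lt_trans j2.
have : rank j < rank i + 1 by apply: le_lt_trans i2.
rewrite /rank !natr1 !ltr_nat !ltnS => h1 h2; apply/eqP.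
by rewrite eqn_leq h1 h2.
Qed.

Lemma in_cell_inj q i b j c u : prob_vec q ->
  in_cell q i b u -> in_cell q j c u -> i = j /\ b = c.
Proof.
move=> pq; rewrite !in_cellE => Hb Hc.
have bnd k e : cdf_before q k e <= u * N - rank k < cdf_before q k e + q e ->
    rank k <= u * N < rank k + 1.
  move=> /andP[h1 h2]; have := cdf_before_ge0 k e pq; have := cdf_before_le1 k e pq.
  by move=> h3 h4; apply/andP; split; lra.
have ij := rank_inj (bnd _ _ Hb) (bnd _ _ Hc).
by split => //; move: Hc; rewrite -ij; exact: cdf_before_disjoint.
Qed.

Lemma rank_cover (a0 : A) u : 0 <= u < 1 -> exists i, rank i <= u * N < rank i + 1.
Proof.
move=> /andP[u0 u1]; have N0 := cardA_gt0 a0.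
have uN0 : 0 <= u * N by rewrite mulr_ge0// ltW.
have := truncn_itv uN0; set k := Num.truncn _ => /andP[k1 k2].
have kN : (k < #|A|)%N.
  by rewrite -(ltr_nat R); apply: le_lt_trans k1 _; rewrite -[ltRHS]mul1r ltr_pM2r.
exists (enum_val (Ordinal kN)); rewrite /rank enum_valK /= k1/= natr1; exact: k2.
Qed.

Lemma in_cell_cover (a0 : A) q u : prob_vec q -> 0 <= u < 1 ->
  exists i b, in_cell q i b u.
Proof.
move=> pq u01; have [i /andP[i1 i2]] := rank_cover a0 u01.
have [b Hb] := @cdf_before_cover q i (u * N - rank i) pq ltac:(apply/andP; split; lra).
by exists i, b; rewrite in_cellE.
Qed.

(* [coupling a0 q u] has law [q] when [u] is uniform on [[0, 1[]; in the cell
   of index [i], the letter [i] comes first, so that each letter keeps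
   a fixed left endpoint in one of the cells. *)
Definition coupling (a0 : A) q u : A :=
  odflt a0 [pick b | [exists i, in_cell q i b u]].

Lemma couplingE a0 q i b u : prob_vec q -> in_cell q i b u -> coupling a0 q u = b.
Proof.
move=> pq Hb; rewrite /coupling; case: pickP => [c /existsP[j Hc]|H] /=.
  by have [_ ->] := in_cell_inj pq Hb Hc.
by have /existsP := H b; case; exists i.
Qed.

Lemma coupling_cell a0 q u : prob_vec q -> 0 <= u < 1 ->
  exists i, in_cell q i (coupling a0 q u) u.
Proof.
move=> pq u01; have [i [b Hb]] := in_cell_cover a0 pq u01.
by exists i; rewrite (couplingE a0 pq Hb).
Qed.
End Coupling.

(** * Law of the coupling, inverse sampling, and comparison of two laws *)

Section CouplingLaw.
Context {R : realType} {A : finType} (a0 : A).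
Implicit Types (q : A -> R) (a b c i : A) (u w : R).
Local Notation N := (#|A|%:R : R).
Local Notation coupling := (coupling a0).

Section Measurability.
Context d (T : measurableType d) (Q : T -> A -> R).
Hypothesis mQ : forall a, measurable_fun setT (fun t => Q t a).

Lemma measurable_cell_lo i b : measurable_fun setT (fun t => cell_lo (Q t) i b).
Proof.
apply: measurable_funM => //; apply: measurable_funD => //.
by apply: measurable_sum.
Qed.

Lemma measurable_cell_hi i b : measurable_fun setT (fun t => cell_hi (Q t) i b).
Proof.
apply: measurable_funM => //; apply: measurable_funD => //.
by apply: measurable_funD => //; apply: measurable_sum.
Qed.

Lemma measurable_in_cell (g : T -> R) i b : measurable_fun setT g ->
  measurable [set t | in_cell (Q t) i b (g t)].
Proof.
move=> mg; rewrite -[X in measurable X]setTI.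
apply: (@measurable_and _ _ _ (fun t => cell_lo (Q t) i b <= g t)
  (fun t => g t < cell_hi (Q t) i b)) => //.
- by apply: measurable_fun_ler => //; exact: measurable_cell_lo.
- by apply: measurable_fun_ltr => //; exact: measurable_cell_hi.
Qed.

Lemma measurable_coupling (g : T -> R) b :
  (forall t, prob_vec (Q t)) -> measurable_fun setT g ->
  measurable [set t | coupling (Q t) (g t) = b].
Proof.
move=> pQ mg.
have mcell c : measurable (\big[setU/set0]_(i : A) [set t | in_cell (Q t) i c (g t)]).
  by apply: bigsetU_measurable => i _; exact: measurable_in_cell.
have mnone : measurable (\big[setI/setT]_(c : A)
    ~` (\big[setU/set0]_(i : A) [set t | in_cell (Q t) i c (g t)])).
  by apply: bigsetI_measurable => c _; exact: measurableC.
(* [D] collects the points where [coupling] takes its default value [a0], namely those where [g t]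
   lies in no cell. *)
pose D : set T := if b == a0 then \big[setI/setT]_(c : A)
  ~` (\big[setU/set0]_(i : A) [set t | in_cell (Q t) i c (g t)]) else set0.
have mD : measurable D by rewrite /D; case: ifP.
rewrite (_ : [set t | _] =
  (\big[setU/set0]_(i : A) [set t | in_cell (Q t) i b (g t)]) `|` D).
  exact: measurableU.
have cellP c t : (\big[setU/set0]_(i : A) [set t | in_cell (Q t) i c (g t)]) t <->
    exists i, in_cell (Q t) i c (g t).
  rewrite -big_enum -bigcup_seq; split=> [[i /= _ H]|[i H]]; exists i => //=.
  by rewrite mem_enum.
have noneP t : (\big[setI/setT]_(c : A)
    ~` (\big[setU/set0]_(i : A) [set t | in_cell (Q t) i c (g t)])) t <->
    forall c i, ~~ in_cell (Q t) i c (g t).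
  rewrite -big_enum -bigcap_seq; split.
    move=> H c i; apply/negP => ic; apply: (H c) => /=; first by rewrite mem_enum.
    by apply/cellP; exists i.
  by move=> H c /= _ /cellP[i]; apply/negP.
apply/seteqP; split=> t /=.
  rewrite /coupling; case: pickP => [c /existsP[i Hc] /= <-|H /= ab].
    by left; apply/cellP; exists i.
  right; rewrite /D -ab eqxx; apply/noneP => c i; apply/negP => Hc.
  by have /existsP[] := H c; exists i.
case=> [/cellP[i]|]; first exact: couplingE.
rewrite /D; case: eqP => [->|//] /noneP H.
rewrite /coupling; case: pickP => [c /existsP[i Hc]|//].
by have := H c i; rewrite Hc.
Qed.

(* The inverse of [coupling q] on the letter [b]: it maps each interval
   [[rank i / N, (rank i + 1) / N[] affinely onto the [(i, b)] cell. *)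
Definition resample q b w : R :=
  \sum_i (rank i <= w * N < rank i + 1)%R%:R * (cell_lo q i b + (w - rank i / N) * q b).

Lemma measurable_resample (g : T -> R) b : measurable_fun setT g ->
  measurable_fun setT (fun t => resample (Q t) b (g t)).
Proof.
move=> mg; apply: measurable_sum => i.
apply: measurable_funM; last first.
  apply: measurable_funD; first exact: measurable_cell_lo.
  by apply: measurable_funM => //; apply: measurable_funB.
rewrite (_ : (fun t => _) = \1_[set t | rank i <= g t * N < rank i + 1]); last first.
  by apply/funext => t; rewrite indicE; congr (_%:R); case: (boolP (_ <= _ < _)) => h;
    [rewrite mem_set|rewrite memNset//; apply/negP].
apply: measurable_indic; rewrite -[X in measurable X]setTI.
apply: (@measurable_and _ _ _ (fun t => rank i <= g t * N)
  (fun t => g t * N < rank i + 1)) => //.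
- by apply: measurable_fun_ler => //; apply: measurable_funM.
- by apply: measurable_fun_ltr => //; apply: measurable_funM.
Qed.
End Measurability.

Lemma resampleE q i b w : rank i <= w * N < rank i + 1 ->
  resample q b w = cell_lo q i b + (w - rank i / N) * q b.
Proof.
move=> wi; rewrite /resample (bigD1 i)//= wi mul1r big1 ?addr0// => j ji.
case: (boolP (_ <= _ < _)) => wj; last by rewrite mul0r.
by rewrite (rank_inj wi wj) eqxx in ji.
Qed.

Lemma resample_in_cell q i b w : 0 < q b -> rank i <= w * N < rank i + 1 ->
  in_cell q i b (resample q b w).
Proof.
move=> qb wi; rewrite (resampleE _ _ wi) /in_cell /cell_lo /cell_hi.
have N0 := cardA_gt0 (R := R) i; have N1 : N != 0 by rewrite gt_eqF.
have -> : w - rank i / N = (w * N - rank i) / N by field.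
have /andP[h1 h2] := wi; apply/andP; split.
  by rewrite lerDl; apply: mulr_ge0; [apply: divr_ge0; [rewrite subr_ge0|exact: ltW]|exact: ltW].
rewrite [ltRHS]mulrDl ltrD2l mulrAC ltr_pM2r ?invr_gt0// gtr_pMl//.
by rewrite ltrBlDl.
Qed.

Lemma coupling_resample q b w : prob_vec q -> 0 < q b -> 0 <= w < 1 ->
  coupling q (resample q b w) = b.
Proof.
move=> pq qb w01; have [i wi] := rank_cover a0 w01.
exact: (couplingE a0 pq (resample_in_cell qb wi)).
Qed.

Lemma rank_ge0 i : 0 <= rank i :> R. Proof. exact: ler0n. Qed.

Lemma rank_lt i : rank i + 1 <= N :> R.
Proof. by rewrite /rank natr1 ler_nat ltn_ord. Qed.

Lemma cell_lo_ge0 q i b : prob_vec q -> 0 <= cell_lo q i b.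
Proof.
by move=> pq; apply: divr_ge0; [rewrite addr_ge0 ?rank_ge0 ?cdf_before_ge0|rewrite ltW ?(cardA_gt0 i)].
Qed.

Lemma cell_hi_le1 q i b : prob_vec q -> cell_hi q i b <= 1.
Proof.
move=> pq; rewrite ler_pdivrMr ?(cardA_gt0 i)// mul1r.
by apply: le_trans (rank_lt i); rewrite -addrA lerD2l cdf_before_le1.
Qed.

Lemma measurable_cell q i b : measurable [set u : R | in_cell q i b u].
Proof. exact: (measurable_in_cell (Q := fun=> q) (fun=> measurable_cst _)). Qed.

Lemma measurable_coupling_set q b : prob_vec q ->
  measurable [set u : R | coupling q u = b].
Proof.
by move=> pq; exact: (measurable_coupling (Q := fun=> q) (fun=> measurable_cst _)).
Qed.

Lemma measurable_resample1 q b : measurable_fun setT (resample q b).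
Proof. exact: (measurable_resample (Q := fun=> q) (fun=> measurable_cst _)). Qed.

Definition slice i : set R := [set w | rank i <= w * N < rank i + 1].

(** On slice [i] the map [resample q b] is affine of slope [q b] onto the cell, so
    [lebesgue_measure_affine] gives the factor. If [q b = 0] the cell is empty and both sides
    vanish. *)
Lemma unif_resample_cell q i b (B : set R) : prob_vec q -> measurable B ->
  ((q b)%:E * unif R ((resample q b @^-1` B) `&` slice i) =
   unif R (B `&` [set u | in_cell q i b u]))%E.
Proof.
move=> pq mB; have N0 := cardA_gt0 (R := R) i; have [q0 _] := pq.
have N1 : N != 0 by rewrite gt_eqF.
have := q0 b; rewrite le_eqVlt => /orP[/eqP qb|qb].
  rewrite -qb mul0e; apply/esym; rewrite (_ : _ `&` _ = set0) ?measure0//.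
  apply/seteqP; split=> u //= -[_]; rewrite /in_cell /cell_lo /cell_hi -qb addr0.
  by move=> /andP[h1 h2]; have := le_lt_trans h1 h2; rewrite ltxx.
have mC : measurable (B `&` [set u | in_cell q i b u]).
  by apply: measurableI => //; exact: measurable_cell.
have -> : unif R (B `&` [set u | in_cell q i b u]) =
    lebesgue_measure (B `&` [set u | in_cell q i b u]).
  rewrite /unif setIidl// => u [_ /andP[/= h1 h2]]; rewrite in_itv /=.
  rewrite (le_trans (cell_lo_ge0 i b pq) h1)/=.
  exact: lt_le_trans h2 (cell_hi_le1 i b pq).
rewrite -(lebesgue_measure_affine (cell_lo q i b - rank i / N * q b) qb mC).
rewrite /unif; congr (_ * lebesgue_measure _)%E; apply/seteqP; split=> w /=.
  move=> [[Bw wi] _]; have := resample_in_cell qb wi; move: Bw.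
  rewrite (resampleE _ _ wi).
  by have -> : cell_lo q i b + (w - rank i / N) * q b =
    q b * w + (cell_lo q i b - rank i / N * q b) by ring.
have -> : q b * w + (cell_lo q i b - rank i / N * q b) =
  cell_lo q i b + (w - rank i / N) * q b by ring.
move=> [Bw /andP[h1 h2]].
have wi : rank i <= w * N < rank i + 1.
  move: h1 h2; rewrite lerDl pmulr_lge0// subr_ge0 ler_pdivrMr// => ->/=.
  rewrite /cell_hi [ltRHS]mulrDl -/(cell_lo q i b) ltrD2l mulrC ltr_pM2l//.
  rewrite ltrBlDl -[X in _ + X]mul1r -mulrDl ltr_pdivlMr //.
split; first by rewrite (resampleE _ _ wi).
have /andP[w0 w1] := wi; rewrite in_itv /=.
have := le_trans (rank_ge0 i) w0; rewrite pmulr_lge0// => ->/=.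
by have := lt_le_trans w1 (rank_lt i); rewrite -ltr_pdivlMr// divff.
Qed.

(** The left side is the law of [resample q b w] when the letter [b] is drawn from [q] and [w] is an
    independent uniform variable. The cells tile the unit interval, so the identities of
    [unif_resample_cell] add up to the uniform law. *)
Lemma unif_resample q (B : set R) : prob_vec q -> measurable B ->
  (\sum_b (q b)%:E * unif R (resample q b @^-1` B) = unif R B)%E.
Proof.
move=> pq mB.
pose B1 := B `&` `[0, 1[%classic.
have -> : unif R B = unif R B1 by rewrite /unif -setIA setIid.
have mB1 : measurable B1 by apply: measurableI.
have mcl (i : A) : measurable (slice i).
  rewrite -[X in measurable X]setTI.
  apply: (@measurable_and _ _ _ (fun t : R => rank i <= t * N)
    (fun t : R => t * N < rank i + 1)) => //.
  - by apply: measurable_fun_ler => //; apply: measurable_funM.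
  - by apply: measurable_fun_ltr => //; apply: measurable_funM.
rewrite (@measure_finite_partition _ _ _ (unif R) (A * A)%type
  (fun j => [set u | in_cell q j.1 j.2 u]) B1)//; first last.
- by move=> u [_]; rewrite /= in_itv /= => /(in_cell_cover a0 pq)[i [b ib]]; exists (i, b).
- by move=> u [i b] [j c] /= h1 h2; have [-> ->] := in_cell_inj pq h1 h2.
- by move=> j; exact: measurable_cell.
rewrite -(pair_bigA _ (fun i b => unif R (B1 `&` [set u | in_cell q i b u]))) /=.
rewrite exchange_big /=; apply: eq_bigr => b _.
have mrB : measurable (resample q b @^-1` B).
  by apply: (measurable_preimage (measurable_resample1 q b)).
pose rB := (resample q b @^-1` B) `&` `[0, 1[%classic.
have -> : unif R (resample q b @^-1` B) = unif R rB by rewrite /unif -setIA setIid.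
rewrite (@measure_finite_partition _ _ _ (unif R) A
  slice rB)//; first last.
- by move=> w [_]; rewrite /= in_itv /= => /(rank_cover a0).
- by move=> w i j; exact: rank_inj.
- by apply: measurableI.
rewrite ge0_sume_distrr//; apply: eq_bigr => i _.
rewrite [RHS](_ : _ = unif R (B `&` [set u | in_cell q i b u])); last first.
  by apply: eq_unif => w w01; rewrite /B1/= in_itv/=; tauto.
rewrite -unif_resample_cell//; congr (_ * _)%E.
by apply: eq_unif => w w01; rewrite /rB/= in_itv/=; tauto.
Qed.

(** Apply [unif_resample] to the event itself: [resample q c] lands in a cell of [c], so only the
    term [c = b] survives, with weight [q b]. *)
Lemma unif_coupling q b : prob_vec q -> unif R [set u | coupling q u = b] = (q b)%:E.
Proof.
move=> pq; have [q0 _] := pq.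
rewrite -(unif_resample pq (measurable_coupling_set b pq)) (bigD1 b)//=.
rewrite [X in (_ + X)%E]big1 ?adde0 => [|c cb].
  have := q0 b; rewrite le_eqVlt => /orP[/eqP <-|qb]; first by rewrite mul0e.
  rewrite (_ : unif R _ = 1%E) ?mule1// -(probability_setT (unif R)).
  by apply: eq_unif => w w01; split => // _ /=; exact: coupling_resample.
have := q0 c; rewrite le_eqVlt => /orP[/eqP <-|qc]; first by rewrite mul0e.
rewrite (_ : unif R _ = 0%E) ?mule0// -(measure0 (unif R)).
by apply: eq_unif => w w01; split => //=; rewrite coupling_resample// => /eqP; rewrite (negbTE cb).
Qed.

(** There are [N ^+ 2] cells with two endpoints each, and an endpoint moves by at most the sum of
    the [|q c - q' c|], which is twice the total variation distance. *)
Definition coupling_const : R := 4 * N ^+ 2.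

Lemma cdf_before_dist q q' i b :
  `|cdf_before q i b - cdf_before q' i b| <= \sum_c `|q c - q' c|.
Proof.
rewrite /cdf_before -sumrB; apply: le_trans (ler_norm_sum _ _ _) _.
rewrite -(sum_letters i (fun c => `|q c - q' c|)) -{3}(take_size (letters i)).
by apply: (@sum_take_le R A (fun c => `|q c - q' c|)) => //; rewrite ltnW// index_mem mem_letters.
Qed.

Lemma cell_dist q q' i b :
  `|cell_lo q i b - cell_lo q' i b| <= \sum_c `|q c - q' c| /\
  `|cell_hi q i b - cell_hi q' i b| <= \sum_c `|q c - q' c|.
Proof.
have N0 := cardA_gt0 (R := R) i.
have N1 : 1 <= N by rewrite ler1n -(ltr_nat R).
have D0 : 0 <= \sum_c `|q c - q' c| by rewrite sumr_ge0.
have scale x : `|x| <= \sum_c `|q c - q' c| -> `|x / N| <= \sum_c `|q c - q' c|.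
  move=> h; rewrite normrM normfV (gtr0_norm N0) ler_pdivrMr//.
  by apply: (le_trans h); rewrite ler_peMr.
split; rewrite /cell_lo /cell_hi -mulrBl; apply: scale.
  by rewrite opprD addrACA subrr add0r; exact: cdf_before_dist.
rewrite [_ - _](_ : _ = cdf_before q i b + q b - (cdf_before q' i b + q' b)); last by ring.
rewrite !cdf_beforeD -sumrB.
apply: le_trans (ler_norm_sum _ _ _) _.
rewrite -(sum_letters i (fun c => `|q c - q' c|)) -{3}(take_size (letters i)).
by apply: (@sum_take_le R A (fun c => `|q c - q' c|)) => //; rewrite index_mem mem_letters.
Qed.

(** If the letters differ, [u] lies in the cell of [coupling q u] for [q] but not in the
    corresponding cell for [q']; hence it lies between two corresponding left endpoints or two
    corresponding right endpoints. *)
Lemma unif_coupling_neq q q' : prob_vec q -> prob_vec q' ->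
  (unif R [set u | coupling q u != coupling q' u] <= (coupling_const * tv q q')%:E)%E.
Proof.
move=> pq pq'; set D := \sum_c `|q c - q' c|.
have D0 : 0 <= D by rewrite sumr_ge0.
pose E (j : A * A) (e : bool) : set R := if e then `[cell_lo q j.1 j.2, cell_lo q' j.1 j.2[%classic
  else `[cell_hi q' j.1 j.2, cell_hi q j.1 j.2[%classic.
have mE j e : measurable (E j e) by case: e; exact: measurable_itv.
have uE j e : (unif R (E j e) <= D%:E)%E.
  have itv (x y : R) : `|x - y| <= D -> (unif R `[x, y[%classic <= D%:E)%E.
    move=> xy; have [yx|xy'] := leP y x.
      by rewrite set_itv_ge ?measure0 ?lee_fin// bnd_simp -leNgt.
    apply: le_trans (@unif_le_itv R _ x y _ (ltW xy') _) _ => //.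
    by rewrite lee_fin; apply: le_trans xy; rewrite distrC ler_norm.
  have [h1 h2] := cell_dist q q' j.1 j.2.
  by case: e => /=; apply: itv => //; rewrite distrC.
have mS : measurable [set u | coupling q u != coupling q' u].
  rewrite (_ : [set u | _] = ~` \big[setU/set0]_(b : A)
    ([set u | coupling q u = b] `&` [set u | coupling q' u = b])).
    apply: measurableC; apply: bigsetU_measurable => b _.
    by apply: measurableI; exact: measurable_coupling_set.
  apply/seteqP; split=> u /=; rewrite -big_enum -bigcup_seq.
    by move=> /eqP uu [b _ [/= h1 h2]]; apply: uu; rewrite h1 h2.
  move=> h; apply/eqP => e; apply: h; exists (coupling q u) => //=.
  by rewrite mem_enum.
pose S1 := [set u | coupling q u != coupling q' u] `&` `[0, 1[%classic.
have -> : unif R [set u | coupling q u != coupling q' u] = unif R S1.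
  by rewrite /unif -setIA setIid.
apply: le_trans (@measure_le_cover _ _ _ (unif R) _ (fun j => E j.1 j.2) S1 _ _ _) _.
- by apply: measurableI.
- by move=> j; exact: mE.
- move=> u [/= neq]; rewrite in_itv /= => u01.
  have [i Hi] := coupling_cell a0 pq u01.
  have /negbT : in_cell q' i (coupling q u) u = false.
    by apply: contraNF neq => /(couplingE a0 pq') ->.
  move: Hi; rewrite /in_cell => /andP[h1 h2]; rewrite negb_and -ltNge -leNgt => /orP[h|h].
    by exists ((i, coupling q u), true); rewrite /= in_itv /= h1 h.
  by exists ((i, coupling q u), false); rewrite /= in_itv /= h2 h.
apply: le_trans (lee_sum _ (fun j _ => uE j.1 j.2)) _.
rewrite sumEFin lee_fin sumr_const !card_prod card_bool -[leLHS]mulr_natr.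
rewrite !natrM /coupling_const /tv -/D le_eqVlt; apply/orP; left; apply/eqP.
by field.
Qed.

(** In slice [a] the cell of the letter [a] starts at [rank a / N] for every law, so the two cells
    share an interval of length the smaller of [q a] and [q' a], divided by [N]. The product is a
    lower bound for this minimum that multiplies well along words. *)
Lemma unif_coupling_agree q q' a : prob_vec q -> prob_vec q' ->
  ((q a * q' a / N)%:E <= unif R [set u | coupling q u = a /\ coupling q' u = a])%E.
Proof.
move=> pq pq'; have N0 := cardA_gt0 (R := R) a.
have [q0 q1] := pq; have [q0' q1'] := pq'.
have le1 p : prob_vec p -> p a <= 1.
  by move=> pp; have := cdf_before_le1 a a pp; rewrite cdf_before_self add0r.
have ri : rank a / N + q a * q' a / N = (rank a + q a * q' a) / N by rewrite mulrDl.
have sub p : prob_vec p -> q a * q' a <= p a ->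
    `[rank a / N, rank a / N + q a * q' a / N[%classic `<=` [set u | coupling p u = a].
  move=> pp le u /=; rewrite in_itv /= => /andP[h1 h2]; apply: (@couplingE R A a0 p a) => //.
  rewrite /in_cell /cell_lo /cell_hi cdf_before_self addr0 h1 /=.
  by apply: (lt_le_trans h2); rewrite ri ler_pM2r ?invr_gt0// lerD2l.
have qq0 : 0 <= q a * q' a / N by apply: divr_ge0; [rewrite mulr_ge0|exact: ltW].
have -> : (q a * q' a / N)%:E = unif R `[rank a / N, rank a / N + q a * q' a / N[%classic.
  rewrite unif_itv ?lerDl//; first by congr EFin; ring.
    by apply: divr_ge0; [exact: rank_ge0|exact: ltW].
  rewrite ri ler_pdivrMr// mul1r; apply: le_trans (rank_lt a); rewrite lerD2l.
  by rewrite -[leRHS]mulr1 ler_pM// le1.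
apply: le_measure_sub.
- exact: measurable_itv.
- by apply: measurableI; exact: measurable_coupling_set.
- move=> u uI; split; apply: sub uI => //.
    by rewrite ler_piMr// le1.
  by rewrite ler_piMl// le1.
Qed.
End CouplingLaw.

(** * Chains of pairs of pasts *)

Section PastSpace.
Context {A : finType}.

(** The parameter [a0] makes the type pointed. Its measurable sets are [cyl_sigma] itself, so that
    the measurability clause of [regular_version] applies as it stands. *)
Definition past_space (a0 : A) : Type := nat -> A.

Section Instances.
Variable a0 : A.
HB.instance Definition _ := gen_eqMixin (past_space a0).
HB.instance Definition _ := gen_choiceMixin (past_space a0).
HB.instance Definition _ := isPointed.Build (past_space a0) (fun=> a0).

Let cyl0 : @cyl_sigma A set0. Proof. exact: sigma_algebra0. Qed.
Let cylC C : @cyl_sigma A C -> @cyl_sigma A (~` C).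
Proof. by rewrite -setTD; exact: sigma_algebraCD. Qed.
Let cylU (F : (set (nat -> A))^nat) :
  (forall i, @cyl_sigma A (F i)) -> @cyl_sigma A (\bigcup_i F i).
Proof. exact: sigma_algebra_bigcup. Qed.

HB.instance Definition _ := @isMeasurable.Build default_measure_display
  (past_space a0) (@cyl_sigma A) cyl0 cylC cylU.
End Instances.

Lemma measurable_coord (a0 : A) k a : measurable [set x : past_space a0 | x k = a].
Proof.
suff: @cyl_sigma A [set x : nat -> A | x k = a] by [].
by rewrite /cyl_sigma; apply: sub_sigma_algebra; exists k, a.
Qed.

Lemma measurable_fun_past (a0 : A) d (T : measurableType d) (f : T -> past_space a0) :
  (forall k a, measurable [set t | f t k = a]) -> measurable_fun setT f.
Proof.
move=> H; apply: (@measurability _ _ _ _ setT f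
  [set C | exists k a, C = [set x : nat -> A | x k = a]]) => //.
by move=> _ [_ [k [a ->]] <-]; rewrite setTI; exact: H.
Qed.

Definition pcons (a : A) (x : nat -> A) : nat -> A :=
  fun k => if k is k'.+1 then x k' else a.

Definition ptail (x : nat -> A) : nat -> A := fun k => x k.+1.

(** The word is read in chronological order: its last letter ends up at index 0. *)
Definition pcat (x : nat -> A) (z : seq A) : nat -> A :=
  foldl (fun y b => pcons b y) x z.

Lemma pcat_rcons x z a : pcat x (rcons z a) = pcons a (pcat x z).
Proof. by rewrite /pcat -cats1 foldl_cat. Qed.

Lemma pcatE x n (z : n.-tuple A) : cat_past x z = pcat x z.
Proof.
apply/funext => k; rewrite /cat_past; case: z => /= z /eqP <-.
elim/last_ind: z k => [|z a IH] k; first by rewrite subn0.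
rewrite pcat_rcons size_rcons; case: k => [|k] /=.
  by rewrite subSS subn0 nth_rcons ltnn eqxx.
rewrite ltnS -IH; case: ltnP => kz; last by rewrite subSS.
by rewrite subSS nth_rcons ltn_subrL /= (leq_ltn_trans (leq0n k) kz).
Qed.

Lemma measurable_pcons (a0 : A) a :
  measurable_fun setT (pcons a : past_space a0 -> past_space a0).
Proof.
apply: measurable_fun_past => -[|k] b /=; last exact: measurable_coord.
by have [->|ab] := eqVneq a b; [rewrite (_ : [set _ | _] = setT)//; apply/seteqP|
  rewrite (_ : [set _ | _] = set0)//; apply/seteqP; split=> x //= /eqP; rewrite (negbTE ab)].
Qed.

Lemma measurable_ptail (a0 : A) :
  measurable_fun setT (ptail : past_space a0 -> past_space a0).
Proof. by apply: measurable_fun_past => k b; exact: measurable_coord. Qed.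

Lemma measurable_pcat (a0 : A) z :
  measurable_fun setT (fun x : past_space a0 => pcat x z : past_space a0).
Proof.
elim/last_ind: z => [|z a IH]; first exact: measurable_id.
rewrite (_ : (fun x => _) = (pcons a : past_space a0 -> past_space a0) \o
  (fun x => pcat x z : past_space a0)).
  exact: measurableT_comp (@measurable_pcons a0 a) IH.
by apply/funext => x /=; rewrite pcat_rcons.
Qed.
End PastSpace.

(** * Transition operators on pairs of pasts *)

Section PairOperators.
Context {R : realType} {A : finType} (a0 : A).
Local Notation S := (past_space a0).
Variable p : (nat -> A) -> A -> R.
Hypothesis pp : forall x, prob_vec (p x).
Hypothesis mp : forall a, measurable_fun setT (fun x : S => p x a).
Implicit Types (W : S * S -> A -> A -> R) (g h : S * S -> R) (z : S * S).
Local Notation N := (#|A|%:R : R).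

(** A kernel acting on functions; [W z] may have total mass below 1, which is how paths with a
    disagreement are discarded in [agreeK]. *)
Definition pair_op W g z : R :=
  \sum_a \sum_b W z a b * g (pcons a z.1 : S, pcons b z.2 : S).

Lemma pair_opD W g h z : pair_op W (fun z => g z + h z) z = pair_op W g z + pair_op W h z.
Proof.
rewrite /pair_op -big_split; apply: eq_bigr => a _; rewrite -big_split.
by apply: eq_bigr => b _; rewrite mulrDr.
Qed.

Lemma pair_opZ W c g z : pair_op W (fun z => c * g z) z = c * pair_op W g z.
Proof.
rewrite /pair_op mulr_sumr; apply: eq_bigr => a _; rewrite mulr_sumr.
by apply: eq_bigr => b _; rewrite mulrCA.
Qed.

Lemma iter_pair_opD W n g h : iter n (pair_op W) (fun z => g z + h z) =
  (fun z => iter n (pair_op W) g z + iter n (pair_op W) h z).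
Proof.
elim: n => [//|n IH]; rewrite iterS IH; apply/funext => z; exact: pair_opD.
Qed.

Lemma iter_pair_opZ W n c g : iter n (pair_op W) (fun z => c * g z) =
  (fun z => c * iter n (pair_op W) g z).
Proof.
elim: n => [//|n IH]; rewrite iterS IH; apply/funext => z; exact: pair_opZ.
Qed.

Section Positive.
Variable W : S * S -> A -> A -> R.
Hypothesis W0 : forall z a b, 0 <= W z a b.

Lemma pair_op_ge0 g : (forall z, 0 <= g z) -> forall z, 0 <= pair_op W g z.
Proof.
by move=> g0 z; apply: sumr_ge0 => a _; apply: sumr_ge0 => b _; rewrite mulr_ge0.
Qed.

Lemma pair_op_le g h : (forall z, g z <= h z) ->
  forall z, pair_op W g z <= pair_op W h z.
Proof.
by move=> gh z; apply: ler_sum => a _; apply: ler_sum => b _; rewrite ler_wpM2l.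
Qed.

Lemma iter_pair_op_ge0 n g : (forall z, 0 <= g z) ->
  forall z, 0 <= iter n (pair_op W) g z.
Proof. by move=> g0; elim: n => [//|n IH] z; rewrite iterS; exact: pair_op_ge0. Qed.

Lemma iter_pair_op_le n g h : (forall z, g z <= h z) ->
  forall z, iter n (pair_op W) g z <= iter n (pair_op W) h z.
Proof. by move=> gh; elim: n => [//|n IH] z; rewrite !iterS; exact: pair_op_le. Qed.

Hypothesis mW : forall a b, measurable_fun setT (fun z => W z a b).

Lemma measurable_pair_op g : measurable_fun setT g -> measurable_fun setT (pair_op W g).
Proof.
move=> mg; apply: measurable_sum => a; apply: measurable_sum => b.
apply: measurable_funM => //; apply: (measurableT_comp mg).
apply/measurable_fun_pairP; split.
  exact: (measurableT_comp (@measurable_pcons A a0 a) measurable_fst).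
exact: (measurableT_comp (@measurable_pcons A a0 b) measurable_snd).
Qed.

Lemma measurable_iter_pair_op n g : measurable_fun setT g ->
  measurable_fun setT (iter n (pair_op W) g).
Proof. by move=> mg; elim: n => [//|n IH]; rewrite iterS; exact: measurable_pair_op. Qed.
End Positive.

Lemma iter_pair_op_leW W W' n g : (forall z a b, 0 <= W z a b) ->
  (forall z a b, W z a b <= W' z a b) -> (forall z, 0 <= g z) ->
  forall z, iter n (pair_op W) g z <= iter n (pair_op W') g z.
Proof.
move=> W0 WW' g0; elim: n => [//|n IH] z; rewrite !iterS.
apply: ler_sum => a _; apply: ler_sum => b _; apply: ler_pM => //.
exact: iter_pair_op_ge0.
Qed.

Definition joint_law z a b : R :=
  fine (unif R [set u | coupling a0 (p z.1) u = a /\ coupling a0 (p z.2) u = b]).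

Definition agree_law z a b : R := if a == b then joint_law z a b else 0.

(* [moveK g z] is the expectation of [g] after one step of both pasts, and
   [agreeK g z] its restriction to the event that both take the same letter;
   thus [iter m agreeK (fun=> 1)] is the probability of [m] agreements. *)
Definition moveK := pair_op joint_law.
Definition agreeK := pair_op agree_law.

Lemma measurable_joint_set (x y : nat -> A) a b :
  measurable [set u | coupling a0 (p x) u = a /\ coupling a0 (p y) u = b].
Proof. by apply: measurableI; exact: measurable_coupling_set. Qed.

Lemma joint_lawE z a b : (joint_law z a b)%:E =
  unif R [set u | coupling a0 (p z.1) u = a /\ coupling a0 (p z.2) u = b].
Proof. by rewrite fineK// fin_num_measure//; exact: measurable_joint_set. Qed.

Lemma joint_law_ge0 z a b : 0 <= joint_law z a b.
Proof. by rewrite fine_ge0. Qed.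

Lemma agree_law_ge0 z a b : 0 <= agree_law z a b.
Proof. by rewrite /agree_law; case: ifP => // _; exact: joint_law_ge0. Qed.

Lemma agree_law_le z a b : agree_law z a b <= joint_law z a b.
Proof. by rewrite /agree_law; case: ifP => // _; exact: joint_law_ge0. Qed.

Lemma measurable_joint_law a b : measurable_fun setT (fun z => joint_law z a b).
Proof.
pose C : set ((S * S) * R) := [set t | coupling a0 (p t.1.1) t.2 = a] `&`
  [set t | coupling a0 (p t.1.2) t.2 = b].
have mC : measurable C.
  apply: measurableI.
    apply: (@measurable_coupling R A a0 _ _ (fun t : (S * S) * R => p t.1.1)) => // c.
    by apply: (measurableT_comp (mp c)); exact: measurableT_comp.
  apply: (@measurable_coupling R A a0 _ _ (fun t : (S * S) * R => p t.1.2)) => // c.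
  by apply: (measurableT_comp (mp c)); exact: measurableT_comp.
rewrite (_ : (fun z => _) = fine \o (unif R \o xsection C)).
  by apply: measurableT_comp => //; exact: measurable_fun_xsection.
apply/funext => z; rewrite /joint_law /=; congr (fine (unif R _)).
by apply/seteqP; split=> u; rewrite /xsection /= inE.
Qed.

Lemma measurable_agree_law a b : measurable_fun setT (fun z => agree_law z a b).
Proof.
rewrite /agree_law; case: eqP => _; last exact: measurable_cst.
exact: measurable_joint_law.
Qed.

Lemma joint_law_suml z b : \sum_a joint_law z a b = p z.2 b.
Proof.
apply: EFin_inj; rewrite -sumEFin -(unif_coupling a0 b (pp z.2)).
rewrite (@measure_finite_partition _ _ _ (unif R) A
  (fun a => [set u | coupling a0 (p z.1) u = a])).
- apply: eq_bigr => a _; rewrite joint_lawE; congr (unif R _).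
  by apply/seteqP; split=> u [].
- exact: measurable_coupling_set.
- by move=> a; exact: measurable_coupling_set.
- by move=> u a c /= <- <-.
- by move=> u _; eexists.
Qed.

Lemma joint_law_sumr z a : \sum_b joint_law z a b = p z.1 a.
Proof.
apply: EFin_inj; rewrite -sumEFin -(unif_coupling a0 a (pp z.1)).
rewrite (@measure_finite_partition _ _ _ (unif R) A
  (fun b => [set u | coupling a0 (p z.2) u = b])).
- by apply: eq_bigr => b _; rewrite joint_lawE.
- exact: measurable_coupling_set.
- by move=> b; exact: measurable_coupling_set.
- by move=> u b c /= <- <-.
- by move=> u _; eexists.
Qed.

Lemma joint_law_agree z a : p z.1 a * p z.2 a / N <= joint_law z a a.
Proof. by rewrite -lee_fin joint_lawE; exact: unif_coupling_agree. Qed.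

Lemma moveK1 z : moveK (fun=> 1) z = 1.
Proof.
rewrite /moveK /pair_op; under eq_bigr do under eq_bigr do rewrite mulr1.
by under eq_bigr do rewrite joint_law_sumr; exact: (pp z.1).2.
Qed.

Lemma iter_moveK1 n : iter n moveK (fun=> 1) = fun=> 1.
Proof. by elim: n => [//|n IH]; rewrite iterS IH; apply/funext => z; exact: moveK1. Qed.

Definition stepK (f : S -> R) (x : S) : R := \sum_a p x a * f (pcons a x : S).

(** The marginals of [joint_law] are the laws given by [p], so a function of one coordinate only
    sees the chain of single pasts. *)
Lemma iter_moveK_fst n (f : S -> R) :
  iter n moveK (fun z => f z.1) = fun z => iter n stepK f z.1.
Proof.
elim: n f => [//|n IH] f; rewrite iterS IH; apply/funext => z.
rewrite /moveK /pair_op iterS /stepK /=; apply: eq_bigr => a _.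
by rewrite -mulr_suml joint_law_sumr.
Qed.

Lemma iter_moveK_snd n (f : S -> R) :
  iter n moveK (fun z => f z.2) = fun z => iter n stepK f z.2.
Proof.
elim: n f => [//|n IH] f; rewrite iterS IH; apply/funext => z.
rewrite /moveK /pair_op iterS /stepK exchange_big /=; apply: eq_bigr => b _.
by rewrite -mulr_suml joint_law_suml.
Qed.

(* Compare the two iterates on [g - delta * (1 - bad) >= 0]: their difference
   is the contribution of the paths that have disagreed at least once. *)
Lemma agree_move_gap m g bad delta : 0 <= delta ->
  (forall z, 0 <= bad z) -> (forall z, delta <= g z + delta * bad z) ->
  forall z, iter m agreeK g z + delta <=
    iter m moveK g z + (delta * iter m agreeK (fun=> 1) z + delta * iter m moveK bad z).
Proof.
move=> d0 b0 gd z.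
have := @iter_pair_op_leW _ _ m (fun z => g z + (- delta * 1 + delta * bad z))
  agree_law_ge0 agree_law_le _ z.
rewrite !iter_pair_opD !iter_pair_opZ -/agreeK -/moveK iter_moveK1 /=.
have h : 0 <= delta * iter m agreeK bad z.
  by rewrite mulr_ge0//; apply: iter_pair_op_ge0 => //; exact: agree_law_ge0.
have H z' : 0 <= g z' + (- delta * 1 + delta * bad z') by have := gd z'; lra.
by move=> /(_ H); lra.
Qed.
End PairOperators.

(** * Agreement after a common word *)

Lemma sum_tuple_rcons (A : finType) (V : nmodType) (F : seq A -> V) n :
  \sum_(z : n.+1.-tuple A) F z = \sum_(z : n.-tuple A) \sum_a F (rcons z a).
Proof.
rewrite pair_bigA /=.
pose h (t : n.-tuple A * A) : n.+1.-tuple A := [tuple of rcons t.1 t.2].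
have hb : bijective h.
  apply: inj_card_bij; last by rewrite card_prod !card_tuple expnSr.
  move=> [t a] [t' a'] /(congr1 val) /= /rcons_inj[e ->]; congr pair; exact: val_inj.
by rewrite (reindex h); [|exact: onW_bij].
Qed.

Section Coalescence.
Context {R : realType} {A : finType} (a0 : A).
Local Notation S := (past_space a0).
Variable p : (nat -> A) -> A -> R.
Hypothesis pp : forall x, prob_vec (p x).
Hypothesis mp : forall a, measurable_fun setT (fun x : S => p x a).
Local Notation C := (@coupling_const R A).
Local Notation agreeK := (@agreeK R A a0 p).

(** [k a] is the probability that the three letters read from the same [u] are all [a]. Otherwise
    the first letter differs from the second or from the third, and [unif_coupling_neq] bounds both
    events. *)
Lemma unif_three_agree (q0 q1 q2 : A -> R) :
  prob_vec q0 -> prob_vec q1 -> prob_vec q2 ->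
  exists k : A -> R, [/\ forall a, 0 <= k a <= q0 a,
    forall a, ((k a)%:E <= unif R [set u | coupling a0 q1 u = a /\ coupling a0 q2 u = a])%E &
    1 <= \sum_a k a + C * tv q0 q1 + C * tv q0 q2].
Proof.
move=> pq0 pq1 pq2.
pose E a : set R := [set u | coupling a0 q0 u = a] `&`
  ([set u | coupling a0 q1 u = a] `&` [set u | coupling a0 q2 u = a]).
have mS q' a : prob_vec q' -> measurable [set u | coupling a0 q' u = a].
  exact: measurable_coupling_set.
have mE a : measurable (E a) by apply: measurableI; [|apply: measurableI]; exact: mS.
have EE a : (fine (unif R (E a)))%:E = unif R (E a).
  by rewrite fineK// fin_num_measure.
exists (fun a => fine (unif R (E a))); split.
- move=> a; rewrite fine_ge0//= -lee_fin EE -(unif_coupling a0 a pq0).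
  by apply: le_measure_sub => //; [exact: mS|move=> u []].
- move=> a; rewrite EE; apply: le_measure_sub => //; last by move=> u [].
  by apply: measurableI; exact: mS.
pose D q' : set R := [set u | coupling a0 q0 u != coupling a0 q' u].
have mD q' : prob_vec q' -> measurable (D q').
  move=> pq'; rewrite (_ : D q' = ~` \big[setU/set0]_(b : A)
    ([set u | coupling a0 q0 u = b] `&` [set u | coupling a0 q' u = b])).
    apply: measurableC; apply: bigsetU_measurable => b _.
    by apply: measurableI; exact: mS.
  apply/seteqP; split=> u /=; rewrite -big_enum -bigcup_seq.
    by move=> /eqP uu [b _ [/= h1 h2]]; apply: uu; rewrite h1 h2.
  by move=> h; apply/eqP => e; apply: h; exists (coupling a0 q0 u) => //=; rewrite mem_enum.
pose U : set R := \big[setU/set0]_a E a.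
have mU : measurable U by apply: bigsetU_measurable.
have UE u a : E a u -> U u by move=> Ea; rewrite /U -big_enum -bigcup_seq; exists a => //=; rewrite mem_enum.
have hU : (unif R U <= \sum_a unif R (E a))%E.
  apply: (@measure_le_cover _ _ _ (unif R) A E) => // u.
  by rewrite /U -big_enum -bigcup_seq => -[a _ Ea]; exists a.
have H : (1 <= \sum_a unif R (E a) + unif R (D q1) + unif R (D q2))%E.
  rewrite -(probability_setT (unif R)).
  apply: (@le_trans _ _ (unif R ((U `|` D q1) `|` D q2))).
    apply: le_measure_sub => //.
      by apply: measurableU; [apply: measurableU|]; rewrite //; exact: mD.
    move=> u _; have [e1|n1] := eqVneq (coupling a0 q0 u) (coupling a0 q1 u); last by left; right.
    have [e2|n2] := eqVneq (coupling a0 q0 u) (coupling a0 q2 u); last by right.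
    by left; left; apply: (UE u (coupling a0 q0 u)); split.
  apply: (le_trans (measureU2 _ _ _)) => //; [by apply: measurableU => //; exact: mD|exact: mD|].
  by apply: leeD => //; apply: (le_trans (measureU2 _ _ _)) => //; [exact: mD|exact: leeD].
have h1 := unif_coupling_neq a0 pq0 pq1; have h2 := unif_coupling_neq a0 pq0 pq2.
rewrite -lee_fin; apply: (le_trans H); rewrite !EFinD -sumEFin.
apply: leeD => //; apply: leeD => //.
by under [X in (_ <= X)%E]eq_bigr do rewrite EE.
Qed.

Variable q : seq A -> A -> R.
Hypothesis pq : forall z, prob_vec (q z).

(** A union bound for the separation, within [m] steps, of the fresh chain at [z] and the chain
    started from [pcat x z]. The cost of each step is evaluated along the fresh word, hence the
    weights [q z a]. *)
Fixpoint gap m (z : seq A) (x : S) : R :=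
  if m is m'.+1 then
    C * tv (q z) (p (pcat x z)) + \sum_a q z a * gap m' (rcons z a) x
  else 0.

Lemma C_ge0 : 0 <= C. Proof. by rewrite mulr_ge0// exprn_ge0. Qed.

Lemma tv_ge0 (q1 q2 : A -> R) : 0 <= tv q1 q2.
Proof. by rewrite mulr_ge0// sumr_ge0. Qed.

Lemma gap_ge0 m z x : 0 <= gap m z x.
Proof.
elim: m z => [//|m IH] z /=; rewrite addr_ge0//.
  by rewrite mulr_ge0 ?C_ge0 ?tv_ge0.
by rewrite sumr_ge0// => a _; rewrite mulr_ge0//; case: (pq z).
Qed.

Lemma measurable_tv z : measurable_fun setT (fun x : S => tv (q z) (p (pcat x z))).
Proof.
apply: measurable_funM => //; apply: measurable_sum => a.
apply: measurableT_comp => //; apply: measurable_funB => //.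
exact: (measurableT_comp (mp a) (@measurable_pcat A a0 z)).
Qed.

Lemma measurable_gap m z : measurable_fun setT (gap m z).
Proof.
elim: m z => [|m IH] z /=; first exact: measurable_cst.
apply: measurable_funD; first by apply: measurable_funM => //; exact: measurable_tv.
by apply: measurable_sum => a; apply: measurable_funM.
Qed.

(* A third process started afresh from the word [z], with transitions [q], is
   compared with both [x] and [y]: the gap then depends on [x] and [y]
   separately. *)
Lemma agree_gap m z (x y : S) :
  1 <= iter m agreeK (fun=> 1) (pcat x z : S, pcat y z : S) + gap m z x + gap m z y.
Proof.
elim: m z => [|m IH] z; first by rewrite /= !addr0.
have [k [k0 k1 k2]] := unif_three_agree (pq z) (pp (pcat x z)) (pp (pcat y z)).
apply: (le_trans k2); rewrite iterS [gap m.+1 z x]/= [gap m.+1 z y]/=.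
suff H : \sum_a k a <= agreeK (iter m agreeK (fun=> 1)) (pcat x z : S, pcat y z : S) +
    \sum_a q z a * gap m (rcons z a) x + \sum_a q z a * gap m (rcons z a) y.
  by move: H; move: (\sum_a k a) (agreeK _ _) (\sum_a _) (\sum_a _) => *; lra.
rewrite /agreeK /pair_op -!big_split /=; apply: ler_sum => a _.
rewrite (bigD1 a)//= big1 ?addr0; last first.
  by move=> b ba; rewrite /agree_law eq_sym (negbTE ba) mul0r.
rewrite /agree_law eqxx -!pcat_rcons.
have := IH (rcons z a); set g := iter m _ _ _ => h.
have g0 : 0 <= g by apply: iter_pair_op_ge0 => //; exact: agree_law_ge0.
have /andP[ka0 kaq] := k0 a.
have kJ : k a <= joint_law p (pcat x z : S, pcat y z : S) a a.
  by rewrite -lee_fin joint_lawE.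
have g1 := gap_ge0 m (rcons z a) x; have g2 := gap_ge0 m (rcons z a) y.
move: kJ kaq; move: (joint_law _ _ _ _) (q z a) => j qa kJ kaq.
(* The induction hypothesis says that the bracket is at least 1. Then [k a] is replaced by the joint
   law in the first term and by [q z a] in the other two. *)
apply: (@le_trans _ _ (k a * (g + gap m (rcons z a) x + gap m (rcons z a) y))).
  by rewrite ler_peMr.
rewrite !mulrDr; apply: lerD; [apply: lerD|]; exact: ler_wpM2r.
Qed.

Variable mu : probability S R.
Variable pb : seq A -> R.
Hypothesis pb0 : forall z, 0 <= pb z.
Hypothesis pbS : forall z a, pb (rcons z a) = pb z * q z a.

(** The abstract form of [eta_n], identified with it in [eta_nE]. *)
Definition mean_gap n : \bar R := (\sum_(z : n.-tuple A)
  (pb z)%:E * \int[mu]_x (tv (q z) (p (pcat x z)))%:E)%E.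

(** When the initial word has weights [pb], the relation [pbS] makes the fresh word after [k] steps
    have the weights [pb] on length [l + k]. The cost of step [k] is then [C] times the term of
    index [l + k]. *)
Lemma integral_gap m l :
  (\sum_(z : l.-tuple A) (pb z)%:E * \int[mu]_x (gap m z x)%:E =
   C%:E * \sum_(k < m) mean_gap (l + k))%E.
Proof.
elim: m l => [|m IH] l.
  rewrite big_ord0 mule0 big1// => z _; rewrite [X in (_ * X)%E](_ : _ = 0%E) ?mule0//=.
  by rewrite integral0.
have mtv z : measurable_fun setT (fun x : S => (tv (q z) (p (pcat x z)))%:E).
  by apply/measurable_EFinP; exact: measurable_tv.
have mg z : measurable_fun setT (fun x : S => (gap m z x)%:E).
  by apply/measurable_EFinP; exact: measurable_gap.
have q0 z a : 0 <= q z a by case: (pq z).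
have E (z : l.-tuple A) : (\int[mu]_x (gap m.+1 z x)%:E =
    C%:E * \int[mu]_x (tv (q z) (p (pcat x z)))%:E +
    \sum_a (q z a)%:E * \int[mu]_x (gap m (rcons z a) x)%:E)%E.
  under eq_integral => x _ do rewrite /= EFinD EFinM -sumEFin.
  rewrite ge0_integralD//=; first last.
  - apply: emeasurable_sum => a; apply/measurable_EFinP; apply: measurable_funM => //.
    exact: measurable_gap.
  - by move=> x _; rewrite sume_ge0// => a _; rewrite lee_fin mulr_ge0// gap_ge0.
  - exact: measurable_funeM.
  - by move=> x _; rewrite mule_ge0// lee_fin ?C_ge0// tv_ge0.
  congr (_ + _)%E.
    by rewrite ge0_integralZl// => [x _|]; rewrite lee_fin ?tv_ge0 ?C_ge0.
  rewrite ge0_integral_sum//; first last.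
  - by move=> a x _; rewrite lee_fin mulr_ge0// gap_ge0.
  - by move=> a; apply/measurable_EFinP; apply: measurable_funM => //; exact: measurable_gap.
  apply: eq_bigr => a _; under eq_integral do rewrite EFinM.
  by rewrite ge0_integralZl// => [x _|]; rewrite lee_fin ?gap_ge0.
have tv0 z : (0 <= \int[mu]_x (tv (q z) (p (pcat x z)))%:E)%E.
  by apply: integral_ge0 => x _; rewrite lee_fin tv_ge0.
have gp0 z : (0 <= \int[mu]_x (gap m z x)%:E)%E.
  by apply: integral_ge0 => x _; rewrite lee_fin gap_ge0.
have mean0 n : (0 <= mean_gap n)%E.
  by apply: sume_ge0 => z _; rewrite ?mule_ge0 ?lee_fin.
pose I z := (\int[mu]_x (tv (q z) (p (pcat x z)))%:E)%E.
pose G z := (\int[mu]_x (gap m z x)%:E)%E.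
rewrite [LHS](_ : _ = (\sum_(z : l.-tuple A) (C%:E * ((pb z)%:E * I z) +
    \sum_a (pb (rcons z a))%:E * G (rcons z a)))%E); last first.
  apply: eq_bigr => z _; rewrite E ge0_muleDr.
  - rewrite muleCA; congr (_ + _)%E; rewrite ge0_sume_distrr.
      by apply: eq_bigr => a _; rewrite pbS EFinM muleA.
    by move=> a _; rewrite mule_ge0// lee_fin.
  - by rewrite mule_ge0// lee_fin C_ge0.
  - by rewrite sume_ge0// => a _; rewrite mule_ge0// lee_fin.
rewrite big_split /= -(sum_tuple_rcons (fun z => (pb z)%:E * G z)%E) IH.
rewrite -ge0_sume_distrr => [|z _]; last by apply: mule_ge0; [rewrite lee_fin|exact: tv0].
rewrite -ge0_muleDr; first last.
- by apply: sume_ge0 => k _; exact: mean0.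
- by apply: sume_ge0 => z _; apply: mule_ge0; [rewrite lee_fin|exact: tv0].
congr (_ * _)%E; rewrite big_ord_recl /= addn0; congr (_ + _)%E.
by apply: eq_bigr => k _; rewrite addSnnS.
Qed.
End Coalescence.

(* If the increments vanish only when [a j m] is close to 1, then the sequence
   [a j] cannot stay away from 1, because it is bounded. *)
Lemma bounded_gain (R : realType) (a : nat -> nat -> R) :
  (forall j m, 0 <= a j m <= 1) ->
  (forall e, 0 < e -> exists2 delta, 0 < delta & forall j m n,
     a j (m + n)%N + delta <= a (j + m)%N n + delta * a j m + delta * e) ->
  forall e, 0 < e -> exists j, forall m, 1 - e <= a j m.
Proof.
move=> a01 gain e e0; apply: contrapT => H.
have {}H j : exists m, a j m < 1 - e.
  apply: contrapT => H'; apply: H; exists j => m; rewrite leNgt; apply/negP => h.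
  by apply: H'; exists m.
have e2 : 0 < e / 2 by rewrite divr_gt0.
(* With tolerance [e / 2], each time [a j m < 1 - e] the sequence gains at least
   [delta * (e - e / 2)], the constant [c] below. *)
have [delta d0 Hd] := gain _ e2.
pose c := delta * (e / 2); have c0 : 0 < c by rewrite mulr_gt0.
(* The bound has to hold for all [n] with the same [j]: the next gain uses it at [m + n], where [m]
   is found only after [j]. *)
have climb k : exists j, forall n, k%:R * c <= a j n.
  elim: k => [|k [j Hj]].
    by exists 0%N => n; rewrite mul0r; case/andP: (a01 0%N n).
  have [m Hm] := H j; exists (j + m)%N => n.
  have h1 := Hj (m + n)%N; have h2 := Hd j m n.
  have h3 : delta * a j m <= delta * (1 - e) by rewrite ler_pM2l// ltW.
  rewrite -natr1 mulrDl mul1r /c.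
  have h4 : delta * (e / 2) = delta * e - delta * (e / 2) by field.
  by move: h1; rewrite /c; lra.
have [j Hj] := climb (Num.truncn c^-1).+1.
have /andP[_ h] := a01 j 0%N; have := le_trans (Hj 0%N) h.
apply/negP; rewrite -ltNge -ltr_pdivrMr// div1r.
have : 0 <= c^-1 by rewrite invr_ge0 ltW.
by move=> /truncn_itv /andP[].
Qed.

Lemma ge0_integral0_null d (T : measurableType d) (R : realType)
    (mu : {measure set T -> \bar R}) (f : T -> \bar R) :
  measurable_fun setT f -> (forall x, 0 <= f x)%E ->
  (\int[mu]_x f x = 0)%E -> mu [set x | 0 < f x]%E = 0%E.
Proof.
move=> mf f0 If; have mF : measurable [set x | 0 < f x]%E.
  rewrite -[X in measurable X]setTI; exact: emeasurable_fun_o_infty.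
apply: measure_negligible => //.
have /ae_eq_integral_abs : (\int[mu]_x `|f x| = 0)%E.
  by under eq_integral do rewrite gee0_abs//.
move=> /(_ measurableT mf); apply: negligibleS => x /= fx /(_ I) f0x.
by move: fx; rewrite f0x ltxx.
Qed.

(** * Producing a prescribed word from almost every past *)

Section Priming.
Context {R : realType} {A : finType} (a0 : A).
Local Notation S := (past_space a0).
Variable p : (nat -> A) -> A -> R.
Hypothesis pp : forall x, prob_vec (p x).
Hypothesis mp : forall a, measurable_fun setT (fun x : S => p x a).
Local Notation N := (#|A|%:R : R).
Local Notation moveK := (@moveK R A a0 p).
Local Notation agreeK := (@agreeK R A a0 p).
Variable mu : probability S R.
Hypothesis stat : forall g : S -> \bar R, measurable_fun setT g ->
  (forall x, 0 <= g x)%E ->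
  (\int[mu]_x g x = \sum_a \int[mu]_x ((p x a)%:E * g (pcons a x : S)))%E.
Hypothesis pos : forall a, {ae mu, forall x : S, 0 < p x a}.

Let p0 x a : 0 <= p x a. Proof. by case: (pp x). Qed.
Let p1 x a : p x a <= 1.
Proof.
have [q0 <-] := pp x; rewrite (bigD1 a)//= lerDl.
by apply: sumr_ge0.
Qed.

Fixpoint word_prob (x : S) (z : seq A) : R :=
  if z is a :: z' then p x a * word_prob (pcons a x : S) z' else 1.

Lemma word_prob_ge0 x z : 0 <= word_prob x z.
Proof. by elim: z x => [//|a z IH] x /=; rewrite mulr_ge0. Qed.

Lemma word_prob_le1 x z : word_prob x z <= 1.
Proof.
by elim: z x => [//|a z IH] x /=; rewrite mulr_ile1// word_prob_ge0.
Qed.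

Lemma measurable_word_prob z : measurable_fun setT (word_prob ^~ z).
Proof.
elim: z => [|a z IH] /=; first exact: measurable_cst.
apply: measurable_funM; first exact: mp.
exact: (measurableT_comp IH (@measurable_pcons A a0 a)).
Qed.

Lemma measurable_le0 (f : S -> R) : measurable_fun setT f -> measurable [set x | f x <= 0].
Proof.
move=> mf; rewrite -[X in measurable X]setTI.
by apply: (@measurable_fun_ler _ _ _ setT f (fun=> 0)).
Qed.

(** By stationarity, moving into the null set attached to [z] has total weight 0. If
    [word_prob x (a :: z)] vanishes, then either [p x a = 0], excluded almost surely by priming, or
    [pcons a x] lies in that null set with positive weight. *)
Lemma word_prob_pos z : mu [set x | word_prob x z <= 0] = 0%E.
Proof.
have mB z' := measurable_le0 (measurable_word_prob z').
elim: z => [|a z IH].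
  rewrite (_ : [set _ | _] = set0) ?measure0//.
  by apply/seteqP; split=> x //=; rewrite leNgt ltr01.
set B := [set x | word_prob x z <= 0] in IH.
have mB1 : measurable B by exact: mB.
have mIB : measurable_fun setT (fun x : S => (\1_B x)%:E : \bar R).
  by apply/measurable_EFinP; exact: measurable_indic.
pose f b (x : S) : \bar R := ((p x b)%:E * (\1_B (pcons b x : S))%:E)%E.
have f0 b x : (0 <= f b x)%E by rewrite mule_ge0// lee_fin.
have mf b : measurable_fun setT (f b).
  apply: emeasurable_funM; first by apply/measurable_EFinP; exact: mp.
  exact: (measurableT_comp mIB (@measurable_pcons A a0 b)).
have fE : (\int[mu]_x f a x = 0)%E.
  have := stat mIB (fun x => (ltac:(rewrite lee_fin; exact: ler0n) : (0 <= (\1_B x : R)%:E)%E)).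
  have -> : (\int[mu]_x (\1_B x)%:E = 0)%E by rewrite integral_indic// setIT; exact: IH.
  move=> /esym; rewrite (bigD1 a)//= => E; apply/eqP; rewrite eq_le integral_ge0// andbT -E leeDl//.
  by apply: sume_ge0 => b _; apply: integral_ge0 => x _; exact: f0.
have f_null := ge0_integral0_null (mf a) (f0 a) fE.
have a_null : mu [set x | p x a <= 0] = 0%E.
  apply: measure_negligible; first by apply: measurable_le0; exact: mp.
  by have := pos a; apply: negligibleS => x /= h1 h2; move: h1; rewrite leNgt h2.
have mfp : measurable [set x | 0 < f a x]%E.
  rewrite -[X in measurable X]setTI; exact: emeasurable_fun_o_infty.
have mpa : measurable [set x : S | p x a <= 0] by apply: measurable_le0; exact: mp.
apply/eqP; rewrite eq_le measure_ge0 andbT -[leRHS]adde0 -{1}a_null -f_null.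
apply: (@le_trans _ _ (mu ([set x : S | p x a <= 0] `|` [set x | 0 < f a x]%E))); last exact: (measureU2 mu mpa mfp).
apply: le_measure_sub; [exact: (mB (a :: z))|exact: measurableU|].
move=> x /=; have [px|px] := ltP 0 (p x a); last by left.
move=> h; right; rewrite /f indicE mem_set ?mule1 ?lte_fin//.
by move: h; rewrite pmulr_rle0.
Qed.

(** Among all ways of agreeing, keep the one where both chains spell [z]; each letter [a] costs the
    factor of [joint_law_agree], and the other terms are nonnegative. *)
Lemma agree_word m z (x y : S) :
  word_prob x z * word_prob y z / N ^+ size z *
    iter m agreeK (fun=> 1) (pcat x z : S, pcat y z : S) <=
  iter (size z + m) agreeK (fun=> 1) (x, y).
Proof.
have N0 := cardA_gt0 (R := R) a0.
have J0 k t : 0 <= iter k agreeK (fun=> 1) t.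
  by apply: iter_pair_op_ge0 => //; exact: agree_law_ge0.
elim: z x y => [|a z IH] x y /=; first by rewrite expr0 divr1 !mul1r.
rewrite /agreeK /pair_op (bigD1 a)//= (bigD1 a)//= -/(pair_op _).
have T0 : 0 <= \sum_(i | i != a) agree_law p (x, y) a i *
    iter (size z + m) agreeK (fun=> 1) (pcons a x : S, pcons i y : S).
  by apply: sumr_ge0 => i _; rewrite mulr_ge0// agree_law_ge0.
have T1 : 0 <= \sum_(i | i != a) \sum_b agree_law p (x, y) i b *
    iter (size z + m) agreeK (fun=> 1) (pcons i x : S, pcons b y : S).
  by apply: sumr_ge0 => i _; apply: sumr_ge0 => b _; rewrite mulr_ge0// agree_law_ge0.
rewrite -addrA; apply: ler_wpDr; first exact: addr_ge0.
rewrite /agree_law eqxx.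
have h := IH (pcons a x : S) (pcons a y : S).
have hj := joint_law_agree pp ((x, y) : S * S) a.
set J := iter m _ _ _ in h *.
have -> : p x a * word_prob (pcons a x : S) z * (p y a * word_prob (pcons a y : S) z) /
   N ^+ (size z).+1 * J = (p x a * p y a / N) *
   (word_prob (pcons a x : S) z * word_prob (pcons a y : S) z / N ^+ size z * J).
  by rewrite exprS invfM; ring.
apply: ler_pM => //.
- by apply: divr_ge0; [rewrite mulr_ge0|exact: ltW].
- apply: mulr_ge0; last exact: J0.
  by apply: divr_ge0; [rewrite mulr_ge0 ?word_prob_ge0|rewrite exprn_ge0 ?ltW].
Qed.

Lemma iter_agree_le1 m t : 0 <= iter m agreeK (fun=> 1) t <= 1.
Proof.
apply/andP; split; first by apply: iter_pair_op_ge0 => //; exact: agree_law_ge0.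
have := @iter_pair_op_leW R A a0 _ _ m (fun=> 1) (@agree_law_ge0 R A a0 p) (@agree_law_le R A a0 p)
  (fun=> ler01) t.
by rewrite -/moveK (@iter_moveK1 R A a0 p pp).
Qed.

Lemma iter_agree_nonincr m k t :
  iter (k + m) agreeK (fun=> 1) t <= iter m agreeK (fun=> 1) t.
Proof.
rewrite addnC iterD; apply: iter_pair_op_le => [z a b|z].
  exact: agree_law_ge0.
by case/andP: (iter_agree_le1 k z).
Qed.

(** A product in place of a minimum: the factors are at most 1, so it lies below each of them, and
    it is positive as soon as they all are. *)
Definition min_word_prob l (x : S) : R := \prod_(z : l.-tuple A) word_prob x z.

Lemma min_word_prob_le l x (z : l.-tuple A) : min_word_prob l x <= word_prob x z.
Proof.
rewrite /min_word_prob (bigD1 z)//= ler_piMr ?word_prob_ge0//.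
by apply: prodr_ile1 => z' _; rewrite word_prob_ge0 word_prob_le1.
Qed.

Lemma measurable_min_word_prob l : measurable_fun setT (min_word_prob l).
Proof. by apply: measurable_prod => z _; exact: measurable_word_prob. Qed.

(** The sets where the product is below [1 / k.+1] decrease to a set covered by finitely many null
    sets, one for each word; continuity from above concludes. *)
Lemma min_word_prob_small l (e : R) : 0 < e -> exists2 delta, 0 < delta &
  (mu [set x | (min_word_prob l x < delta)%R] <= e%:E)%E.
Proof.
move=> e0; pose F k : set S := [set x | min_word_prob l x < k.+1%:R^-1].
have mF k : measurable (F k).
  rewrite -[X in measurable X]setTI.
  by apply: (@measurable_fun_ltr _ _ _ setT _ (fun=> k.+1%:R^-1)) => //; exact: measurable_min_word_prob.
have FI : mu (\bigcap_k F k) = 0%E.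
  apply/eqP; rewrite eq_le measure_ge0 andbT.
  apply: le_trans (@measure_le_cover _ _ _ mu (l.-tuple A)
    (fun z => [set x | word_prob x z <= 0]) _ _ _ _) _.
  - exact: bigcapT_measurable.
  - by move=> z; apply: measurable_le0; exact: measurable_word_prob.
  - move=> x Fx; apply: contrapT => H.
    have : 0 < min_word_prob l x.
      by apply: prodr_gt0 => z _; rewrite ltNge; apply/negP => h; apply: H; exists z.
    move=> m0; have /(_ (Num.truncn (min_word_prob l x)^-1) I) := Fx; rewrite /F /=.
    apply/negP; rewrite -leNgt invf_ple ?posrE//.
    have : 0 <= (min_word_prob l x)^-1 by rewrite invr_ge0 ltW.
    by move=> /truncn_itv /andP[_ /ltW].
  - by rewrite big1// => z _; exact: word_prob_pos.
have ni : nonincreasing_seq F.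
  apply/nonincreasing_seqP => n; apply/subsetPset => x; rewrite /F /= => h.
  by apply: lt_le_trans h _; rewrite lef_pV2 ?posrE// ler_nat.
have F0 : (mu (F 0%N) < +oo)%E by rewrite ltey_eq fin_num_measure.
have cv : (mu \o F) @ \oo --> 0%E.
  by rewrite -FI; exact: (nonincreasing_cvg_mu F0 mF (bigcapT_measurable mF) ni).
move: cv => /fine_cvgP[_ /cvgrPdist_le/(_ e e0)] [k _ /(_ k (leqnn k))].
rewrite /= sub0r normrN ger0_norm ?fine_ge0// => h.
exists k.+1%:R^-1; first by rewrite invr_gt0.
by rewrite -(fineK (fin_num_measure mu _ (mF k))) lee_fin.
Qed.
End Priming.

(** * Coalescence *)

Section CoalescenceTheorem.
Context {R : realType} {A : finType} (a0 : A).
Local Notation S := (past_space a0).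
Variable p : (nat -> A) -> A -> R.
Hypothesis pp : forall x, prob_vec (p x).
Hypothesis mp : forall a, measurable_fun setT (fun x : S => p x a).
Local Notation N := (#|A|%:R : R).
Local Notation C := (@coupling_const R A).
Local Notation moveK := (@moveK R A a0 p).
Local Notation agreeK := (@agreeK R A a0 p).
Variable mu : probability S R.
Hypothesis stat : forall g : S -> \bar R, measurable_fun setT g ->
  (forall x, 0 <= g x)%E ->
  (\int[mu]_x g x = \sum_a \int[mu]_x ((p x a)%:E * g (pcons a x : S)))%E.
Hypothesis pos : forall a, {ae mu, forall x : S, 0 < p x a}.
Variable q : seq A -> A -> R.
Hypothesis pq : forall z, prob_vec (q z).
Variable pb : seq A -> R.
Hypothesis pb0 : forall z, 0 <= pb z.
Hypothesis pb1 : forall n, \sum_(z : n.-tuple A) pb z = 1.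
Hypothesis pbS : forall z a, pb (rcons z a) = pb z * q z a.
Hypothesis small_tail : forall e : R, 0 < e ->
  exists l, forall m, (\sum_(k < m) mean_gap p q mu pb (l + k) <= e%:E)%E.

(** [delta] is fixed before [n]; only [B] depends on [n]. Outside [B] some word [z] of length [l]
    has a small gap for both pasts: both spell it with a probability bounded below, and after it
    they agree for [n] steps with probability at least 1/2. *)
Lemma good_set (e : R) : 0 < e -> exists2 delta, 0 < delta & forall n,
  exists B : set S, [/\ measurable B, (mu B <= e%:E)%E &
    forall x y, ~ B x -> ~ B y -> delta <= iter n agreeK (fun=> 1) (x, y)].
Proof.
move=> e0; have N0 := cardA_gt0 (R := R) a0.
have C0 : 0 < C by rewrite mulr_gt0// exprn_gt0.
(* The factor [C] of [integral_gap] turns this tail into a mean of at most [e / 8] for [V]; Markov's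
   inequality at level 1/4 then gives a set of measure at most [e / 2]. *)
have e8 : 0 < e / (8 * C) by rewrite divr_gt0// mulr_gt0.
have [l Hl] := small_tail e8.
have e2 : 0 < e / 2 by rewrite divr_gt0.
have [d d0 Hd] := min_word_prob_small pp mp stat pos l e2.
(* [d] for each past and [1 / N] for each letter pay for spelling the common word; the last factor
   1/2 is the chance to agree afterwards. *)
exists (d * d / N ^+ l / 2); first by rewrite !divr_gt0// ?mulr_gt0// exprn_gt0.
move=> n; pose V (x : S) := \sum_(z : l.-tuple A) pb z * gap p q n z x.
have mV : measurable_fun setT V.
  by apply: measurable_sum => z; apply: measurable_funM => //; exact: measurable_gap.
have V0 x : 0 <= V x by apply: sumr_ge0 => z _; rewrite mulr_ge0// gap_ge0.
have IV : (\int[mu]_x (V x)%:E <= (e / 8)%:E)%E.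
  under eq_integral do rewrite -sumEFin.
  rewrite ge0_integral_sum//; first last.
  - by move=> z x _; rewrite lee_fin mulr_ge0// gap_ge0.
  - by move=> z; apply/measurable_EFinP; apply: measurable_funM => //; exact: measurable_gap.
  have -> : (e / 8)%:E = (C%:E * (e / (8 * C))%:E)%E.
    by rewrite -EFinM; congr EFin; field; rewrite gt_eqF.
  apply: le_trans (lee_wpmul2l _ (Hl n)); last by rewrite lee_fin ltW.
  rewrite -(integral_gap mp pq mu pb0 pbS n l); apply: lee_sum => z _.
  under eq_integral do rewrite EFinM.
  rewrite ge0_integralZl//.
  - by apply/measurable_EFinP; exact: measurable_gap.
  - by move=> x _; rewrite lee_fin gap_ge0.
  - by rewrite lee_fin.
pose B1 : set S := [set x | 4^-1 <= V x].
pose B2 : set S := [set x | min_word_prob p l x < d].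
have mB1 : measurable B1.
  rewrite -[X in measurable X]setTI.
  by apply: (@measurable_fun_ler _ _ _ setT (fun=> 4^-1) V).
have mB2 : measurable B2.
  rewrite -[X in measurable X]setTI.
  by apply: (@measurable_fun_ltr _ _ _ setT _ (fun=> d)) => //; exact: measurable_min_word_prob.
have muB1 : (mu B1 <= (e / 2)%:E)%E.
  have h : ((4^-1)%:E * mu B1 <= \int[mu]_x (V x)%:E)%E.
    rewrite -[X in mu X]setIT -integral_indic// -ge0_integralZl//; last first.
    - by apply/measurable_EFinP; exact: measurable_indic.
    apply: ge0_le_integral => //.
    - by apply: measurable_funeM; apply/measurable_EFinP; exact: measurable_indic.
    - by apply/measurable_EFinP.
    move=> x _; rewrite indicE -EFinM lee_fin.
    by case: (boolP (x \in B1)) => [|_]; [rewrite inE /B1 /= mulr1|rewrite mulr0].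
  have := le_trans h IV; rewrite -(fineK (fin_num_measure mu _ mB1)) -EFinM !lee_fin.
  by move=> ?; lra.
exists (B1 `|` B2); split; first exact: measurableU.
  apply: (le_trans (measureU2 _ _ _)) => //.
  have -> : e%:E = ((e / 2)%:E + (e / 2)%:E)%E by rewrite -EFinD; congr EFin; field.
  exact: leeD.
move=> x y nx ny.
have Vx : V x < 4^-1 by rewrite ltNge; apply/negP => h; apply: nx; left.
have Vy : V y < 4^-1 by rewrite ltNge; apply/negP => h; apply: ny; left.
have wx : d <= min_word_prob p l x by rewrite leNgt; apply/negP => h; apply: nx; right.
have wy : d <= min_word_prob p l y by rewrite leNgt; apply/negP => h; apply: ny; right.
(* [V x + V y < 1 / 2] is an average of the sums of two gaps with the weights [pb], so some word
   does at least as well as the average. *)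
have [z hz] : exists z : l.-tuple A, gap p q n z x + gap p q n z y < 2^-1.
  apply: contrapT => H.
  have : V x + V y >= 2^-1.
    have -> : 2^-1 = \sum_(z : l.-tuple A) pb z * 2^-1 :> R by rewrite -mulr_suml pb1 mul1r.
    rewrite /V -big_split /=; apply: ler_sum => z _; rewrite -mulrDr; apply: ler_wpM2l => //.
    by rewrite leNgt; apply/negP => h; apply: H; exists z.
  by move: Vx Vy; lra.
apply: le_trans (iter_agree_nonincr pp n l (x, y)).
have sz : size z = l by rewrite size_tuple.
have := @agree_word R A a0 p pp n z x y; rewrite sz; apply: le_trans.
have h2 := @agree_gap R A a0 p pp q pq n z x y.
have h3 : 2^-1 <= iter n agreeK (fun=> 1) (pcat x z : S, pcat y z : S) by lra.
have Nl : 0 < N ^+ l by rewrite exprn_gt0.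
apply: ler_pM => //.
- by rewrite divr_ge0 ?mulr_ge0 ?(ltW d0) ?(ltW Nl).
- rewrite ler_pM2r ?invr_gt0//; apply: ler_pM; rewrite ?(ltW d0)//.
    by apply: (le_trans wx); exact: min_word_prob_le.
  by apply: (le_trans wy); exact: min_word_prob_le.
Qed.

Local Notation Ex g := (\int[mu \x mu]_z (g z)%:E)%E.

Lemma integral_prod_fst (f : S -> R) : measurable_fun setT f -> (forall x, 0 <= f x) ->
  (Ex (fun z : S * S => f z.1) = \int[mu]_x (f x)%:E)%E.
Proof.
move=> mf f0; rewrite fubini_tonelli1//=.
- apply: eq_integral => x _; rewrite /fubini_F /=.
  by rewrite integral_cst//= -[X in (_ * X)%E](_ : 1%E = _) ?mule1// probability_setT.
- by apply/measurable_EFinP; exact: measurableT_comp.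
- by move=> z; rewrite lee_fin.
Qed.

Lemma integral_prod_snd (f : S -> R) : measurable_fun setT f -> (forall x, 0 <= f x) ->
  (Ex (fun z : S * S => f z.2) = \int[mu]_x (f x)%:E)%E.
Proof.
move=> mf f0; rewrite fubini_tonelli2//=.
- apply: eq_integral => x _; rewrite /fubini_G /=.
  by rewrite integral_cst//= -[X in (_ * X)%E](_ : 1%E = _) ?mule1// probability_setT.
- by apply/measurable_EFinP; exact: measurableT_comp.
- by move=> z; rewrite lee_fin.
Qed.

Lemma stepK_ge0 n (f : S -> R) : (forall x, 0 <= f x) -> forall x, 0 <= iter n (stepK p) f x.
Proof.
move=> f0; elim: n => [//|n IH] x; rewrite iterS; apply: sumr_ge0 => a _.
by rewrite mulr_ge0//; case: (pp x).
Qed.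

Lemma measurable_stepK n (f : S -> R) : measurable_fun setT f ->
  measurable_fun setT (iter n (stepK p) f).
Proof.
move=> mf; elim: n => [//|n IH]; rewrite iterS; apply: measurable_sum => a.
apply: measurable_funM; first exact: mp.
exact: (measurableT_comp IH (@measurable_pcons A a0 a)).
Qed.

Lemma integral_stepK n (f : S -> R) : measurable_fun setT f -> (forall x, 0 <= f x) ->
  (\int[mu]_x (iter n (stepK p) f x)%:E = \int[mu]_x (f x)%:E)%E.
Proof.
move=> mf f0; elim: n => [//|n IH]; rewrite -IH iterS.
rewrite [RHS]stat; first last.
- by move=> x; rewrite lee_fin stepK_ge0.
- by apply/measurable_EFinP; exact: measurable_stepK.
rewrite -ge0_integral_sum//; first last.
- by move=> a x _; rewrite lee_fin mulr_ge0 ?stepK_ge0//; case: (pp x).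
- move=> a; apply/measurable_EFinP; apply: measurable_funM; first exact: mp.
  exact: (measurableT_comp (measurable_stepK n mf) (@measurable_pcons A a0 a)).
by apply: eq_integral => x _; rewrite /stepK -sumEFin.
Qed.

Lemma measurable_iter_move n g : measurable_fun setT g ->
  measurable_fun setT (iter n moveK g).
Proof. by apply: measurable_iter_pair_op => a b; exact: measurable_joint_law. Qed.

Lemma measurable_iter_agree n g : measurable_fun setT g ->
  measurable_fun setT (iter n agreeK g).
Proof. by apply: measurable_iter_pair_op => a b; exact: measurable_agree_law. Qed.

Lemma iter_move_unit n g : (forall z, 0 <= g z <= 1) -> forall z, 0 <= iter n moveK g z <= 1.
Proof.
move=> g01 z; apply/andP; split.
  apply: iter_pair_op_ge0 => [z' a b|z']; first exact: joint_law_ge0.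
  by case/andP: (g01 z').
rewrite -[leRHS](_ : iter n moveK (fun=> 1) z = 1); last by rewrite iter_moveK1.
apply: iter_pair_op_le => [z' a b|z']; first exact: joint_law_ge0.
by case/andP: (g01 z').
Qed.

Lemma unit_integral (g : S * S -> R) : measurable_fun setT g -> (forall z, 0 <= g z <= 1) ->
  exists2 r : R, Ex g = r%:E & 0 <= r <= 1.
Proof.
move=> mg g01.
have h0 : (0 <= Ex g)%E by apply: integral_ge0 => z _; rewrite lee_fin; case/andP: (g01 z).
have h1 : (Ex g <= 1)%E.
  rewrite -(probability_setT (mu \x mu)%E) -[leRHS]mul1e -integral_cst//.
  apply: ge0_le_integral => //.
  - by move=> z _; rewrite lee_fin; case/andP: (g01 z).
  - exact/measurable_EFinP.
  - by move=> z _; rewrite /= lee_fin; case/andP: (g01 z).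
exists (fine (Ex g)); first by rewrite fineK// fin_numElt (lt_le_trans _ h0)// (le_lt_trans h1) ?ltry.
have fE : Ex g = (fine (Ex g))%:E.
  by rewrite fineK// fin_numElt (lt_le_trans _ h0)// (le_lt_trans h1) ?ltry.
by rewrite fine_ge0//= -lee_fin -fE.
Qed.

Lemma prod_integralD (f h : S * S -> R) : measurable_fun setT f -> measurable_fun setT h ->
  (forall z, 0 <= f z) -> (forall z, 0 <= h z) ->
  (Ex (fun z => (f z + h z)%R) = Ex f + Ex h)%E.
Proof.
move=> mf mh f0 h0; under eq_integral do rewrite EFinD.
rewrite ge0_integralD//.
- by move=> z _; rewrite lee_fin.
- exact/measurable_EFinP.
- by move=> z _; rewrite lee_fin.
- exact/measurable_EFinP.
Qed.

Lemma prod_integralZ (c : R) (f : S * S -> R) : 0 <= c -> measurable_fun setT f ->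
  (forall z, 0 <= f z) -> (Ex (fun z => (c * f z)%R) = c%:E * Ex f)%E.
Proof.
move=> c0 mf f0; under eq_integral do rewrite EFinM.
rewrite ge0_integralZl//.
- exact/measurable_EFinP.
- by move=> z _; rewrite lee_fin.
Qed.

Lemma iter_agree_move_gap j m f bad delta : 0 <= delta -> (forall z, 0 <= bad z) ->
  (forall z, delta <= f z + delta * bad z) ->
  forall z, iter j moveK (iter m agreeK f) z + delta <= iter j moveK (iter m moveK f) z +
    (delta * iter j moveK (iter m agreeK (fun=> 1)) z + delta * iter j moveK (iter m moveK bad) z).
Proof.
move=> d0 b0 dgap z.
have := @iter_pair_op_le R A a0 _ (@joint_law_ge0 R A a0 p) j _ _
    (fun z' => @agree_move_gap R A a0 p pp m f bad delta d0 b0 dgap z') z.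
rewrite !iter_pair_opD !iter_pair_opZ -/moveK.
suff -> : iter j moveK (fun=> delta) z = delta by [].
have -> : (fun=> delta) = (fun z' : S * S => delta * (fun=> 1) z').
  by apply/funext => z'; rewrite mulr1.
by rewrite iter_pair_opZ -/moveK iter_moveK1// mulr1.
Qed.

(** Here [a j m] is the probability that two independent stationary pasts, after [j] free steps,
    agree for [m] more. The difference between [a (j + m) n] and [a j (m + n)] counts the paths that
    fail during the [m] steps and agree during the next [n]; outside [B] such a recovery has
    probability at least [delta], which is the gain asked by [bounded_gain]. *)
Lemma agree_eventually (e : R) : 0 < e -> exists j, forall m,
  ((1 - e)%:E <= Ex (iter j moveK (iter m agreeK (fun=> 1))))%E.
Proof.
move=> e0.
pose g j m := iter j moveK (iter m agreeK (fun=> 1)).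
have mg j m : measurable_fun setT (g j m).
  by apply: measurable_iter_move; apply: measurable_iter_agree; exact: measurable_cst.
have g01 j m z : 0 <= g j m z <= 1.
  by apply: iter_move_unit => z'; exact: iter_agree_le1.
pose a j m := fine (Ex (g j m)).
have aE j m : Ex (g j m) = (a j m)%:E.
  by have [r rE _] := unit_integral (mg j m) (g01 j m); rewrite /a rE.
have a01 j m : 0 <= a j m <= 1.
  by have [r rE r01] := unit_integral (mg j m) (g01 j m); rewrite /a rE.
suff gain : forall e, 0 < e -> exists2 delta, 0 < delta & forall j m n,
     a j (m + n)%N + delta <= a (j + m)%N n + delta * a j m + delta * e.
  have [j Hj] := bounded_gain a01 gain e0.
  by exists j => m; rewrite -/(g j m) aE lee_fin.
move=> {e0}{}e e0; have e2 : 0 < e / 2 by rewrite divr_gt0.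
have [delta d0 Hd] := good_set e2; exists delta => // j m n.
have [B [mB muB HB]] := Hd n.
pose b1 (x : S) : R := \1_B x.
have mb1 : measurable_fun setT b1 by exact: measurable_indic.
have b10 x : 0 <= b1 x by exact: ler0n.
pose bad (z : S * S) : R := b1 z.1 + b1 z.2.
have dgap z : delta <= iter n agreeK (fun=> 1) z + delta * bad z.
  have /andP[i0 _] := @iter_agree_le1 R A a0 p pp n z.
  have [zB|zB] := pselect (B z.1 \/ B z.2).
    apply: ler_wpDl => //; rewrite ler_peMr ?(ltW d0)//.
    rewrite /bad /b1 !indicE; case: zB => zB; rewrite (mem_set zB) ?lerDl ?lerDr ler0n//.
  apply: ler_wpDr; first by rewrite mulr_ge0 ?(ltW d0)// addr_ge0.
  by case: z zB {i0} => x y zB /=; apply: HB => h; apply: zB; [left|right].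
have b0 z : 0 <= bad z by rewrite addr_ge0.
have key z := iter_agree_move_gap j m (ltW d0) b0 dgap z.
have mbad k : measurable_fun setT (iter k moveK bad).
  apply: measurable_iter_move; apply: measurable_funD; exact: measurableT_comp.
have bad0 k z : 0 <= iter k moveK bad z.
  by apply: iter_pair_op_ge0 => [z' c c'|z']; [exact: joint_law_ge0|rewrite addr_ge0].
(* Each coordinate taken alone remains stationary, so [bad] has the same mean at every time, at most
   twice [e / 2]. *)
have Ebad k : (Ex (iter k moveK bad) <= e%:E)%E.
  rewrite /bad iter_pair_opD -/moveK (@iter_moveK_fst R A a0 p pp) (@iter_moveK_snd R A a0 p pp).
  under eq_integral do rewrite EFinD.
  have ms := measurable_stepK k mb1.
  rewrite ge0_integralD//; first last.
  - by apply/measurable_EFinP; exact: measurableT_comp.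
  - by move=> z _; rewrite lee_fin stepK_ge0.
  - by apply/measurable_EFinP; exact: measurableT_comp.
  - by move=> z _; rewrite lee_fin stepK_ge0.
  rewrite integral_prod_fst// ?integral_prod_snd//; try by move=> x; exact: stepK_ge0.
  rewrite integral_stepK// integral_indic// setIT.
  have -> : e%:E = ((e / 2)%:E + (e / 2)%:E)%E by rewrite -EFinD; congr EFin; field.
  exact: leeD.
have g0 j' m' z : 0 <= g j' m' z by case/andP: (g01 j' m' z).
have mgE j' m' : measurable_fun setT (EFin \o g j' m') by exact/measurable_EFinP.
have d0' : (0 <= delta%:E)%E by rewrite lee_fin ltW.
have : (Ex (fun z => g j (m + n)%N z + delta) <=
    Ex (fun z => g (j + m)%N n z + (delta * g j m z + delta * iter (j + m) moveK bad z)))%E.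
  apply: ge0_le_integral => //.
  - by move=> z _; rewrite lee_fin addr_ge0// ltW.
  - by apply/measurable_EFinP; apply: measurable_funD.
  - apply/measurable_EFinP; apply: measurable_funD => //.
    by apply: measurable_funD; apply: measurable_funM.
  - by move=> z _; rewrite lee_fin /g !iterD; exact: key.
rewrite !prod_integralD//; first last.
- by move=> z; rewrite addr_ge0// mulr_ge0// ltW.
- by apply: measurable_funD; exact: measurable_funM.
- by move=> z; rewrite mulr_ge0// ltW.
- by move=> z; rewrite mulr_ge0// ltW.
- exact: measurable_funM.
- exact: measurable_funM.
rewrite !prod_integralZ ?(ltW d0)// !aE.
have -> : Ex (fun=> delta) = delta%:E.
  rewrite integral_cst//= -[X in (_ * X)%E](_ : 1%E = _) ?mule1//.
  by rewrite probability_setT.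
move=> h; rewrite -lee_fin !EFinD !EFinM; apply: (le_trans h).
rewrite -!addeA; apply: leeD => //; apply: leeD => //; exact: lee_wpmul2l.
Qed.

Definition neq_head (z : S * S) : R := (z.1 0%N != z.2 0%N)%:R.

Lemma measurable_neq_head : measurable_fun setT neq_head.
Proof.
pose D := ~` \big[setU/set0]_(a : A) ([set z : S * S | z.1 0%N = a] `&` [set z | z.2 0%N = a]).
have mD : measurable D.
  apply: measurableC; apply: bigsetU_measurable => a _; apply: measurableI.
    exact: (measurable_preimage measurable_fst (@measurable_coord A a0 0%N a)).
  exact: (measurable_preimage measurable_snd (@measurable_coord A a0 0%N a)).
rewrite (_ : neq_head = \1_D); first exact: measurable_indic.
apply/funext => z; rewrite indicE /neq_head; congr (_%:R); congr nat_of_bool.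
apply/idP/idP => [h|].
  rewrite inE /D -big_enum -bigcup_seq => -[a _ [/= h1 h2]].
  by rewrite h1 h2 eqxx in h.
rewrite inE /D -big_enum -bigcup_seq => h; apply/eqP => e; apply: h.
by exists (z.1 0%N) => //=; rewrite mem_enum.
Qed.

Lemma move_neq_head z : moveK neq_head z + agreeK (fun=> 1) z = 1.
Proof.
rewrite -[RHS](moveK1 pp z) /moveK /agreeK /pair_op -big_split; apply: eq_bigr => a _.
rewrite -big_split; apply: eq_bigr => b _ /=.
by rewrite /agree_law /neq_head /=; case: eqP => _ /=; rewrite ?mulr0 ?mulr1 ?add0r ?addr0.
Qed.

Theorem coalescence (e : R) : 0 < e -> exists n, (Ex (iter n moveK neq_head) <= e%:E)%E.
Proof.
move=> e0; have [j Hj] := agree_eventually e0.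
(* One agreement after [j] free steps is enough: by [move_neq_head] it is complementary to a
   disagreement at step [j + 1]. *)
exists j.+1; have := Hj 1%N.
have mJ : measurable_fun setT (iter j moveK (iter 1 agreeK (fun=> 1))).
  by apply: measurable_iter_move; apply: measurable_iter_agree; exact: measurable_cst.
have J01 : forall z, 0 <= iter j moveK (iter 1 agreeK (fun=> 1)) z <= 1.
  by apply: iter_move_unit => z'; exact: iter_agree_le1.
have mK : measurable_fun setT (iter j.+1 moveK neq_head).
  by apply: measurable_iter_move; exact: measurable_neq_head.
have K01 : forall z, 0 <= iter j.+1 moveK neq_head z <= 1.
  by apply: iter_move_unit => z'; rewrite /neq_head ler0n lern1 leq_b1.
have : (Ex (fun z => (iter j.+1 moveK neq_head z + iter j moveK (iter 1 agreeK (fun=> 1)) z)%R) = 1)%E.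
  rewrite -[RHS](probability_setT (mu \x mu)%E) -[RHS]mul1e -integral_cst//.
  apply: eq_integral => z _ /=; congr EFin.
  have := @iter_pair_opD R A a0 (joint_law p) j (moveK neq_head) (iter 1 agreeK (fun=> 1)).
  move=> /(congr1 (fun f => f z)); rewrite -/moveK -iterSr => <-.
  rewrite (_ : (fun z0 => _) = (fun=> 1)) ?iter_moveK1//.
  by apply/funext => z'; exact: move_neq_head.
rewrite prod_integralD//; first last.
- by move=> z; case/andP: (J01 z).
- by move=> z; case/andP: (K01 z).
have [r -> _] := unit_integral mJ J01; have [s -> _] := unit_integral mK K01.
by rewrite !lee_fin -EFinD => -[]; lra.
Qed.
End CoalescenceTheorem.

(** * The stationary process as a chain of pasts *)

Section Process.
Context {R : realType} {d : measure_display} {T : measurableType d}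
  (P : probability T R) {A : finType} (a0 : A).
Variable X : int -> T -> A.
Hypothesis mX : forall n a, measurable (X n @^-1` [set a]).
Hypothesis stX : stationary P X.
Local Notation S := (past_space a0).
Local Notation pst i := (past X i : T -> S).

Lemma measurable_past i : measurable_fun setT (pst i).
Proof. by apply: measurable_fun_past => k a; exact: mX. Qed.

(** [z] lists letters backwards in time, starting from index 0; a block in chronological order
    enters as its reversal. *)
Definition cylinder (z : seq A) : set S :=
  [set x | forall k, (k < size z)%N -> x k = nth a0 z k].

Lemma cylinder_cons a z : cylinder (a :: z) = [set x | x 0%N = a] `&` (ptail @^-1` cylinder z).
Proof.
apply/seteqP; split=> x /=.
  by move=> H; split; [exact: (H 0%N)|move=> k kz; exact: (H k.+1)].
by move=> [h0 H] [|k] kz //=; exact: H.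
Qed.

Lemma measurable_cylinder z : measurable (cylinder z).
Proof.
elim: z => [|a z IH]; first by rewrite (_ : cylinder _ = setT)//; apply/seteqP.
rewrite cylinder_cons; apply: measurableI; first exact: measurable_coord.
exact: (measurable_preimage (@measurable_ptail A a0) IH).
Qed.

Let G : set (set S) := [set C | C = set0 \/ exists z, C = cylinder z].

(** Two cylinders are nested when one word is a prefix of the other, and disjoint otherwise; the
    second case is the reason for [set0] in [G]. *)
Lemma cylinder_setI : setI_closed G.
Proof.
move=> _ _ [->|[z1 ->]] [->|[z2 ->]]; try by left; rewrite ?set0I ?setI0.
wlog le12 : z1 z2 / (size z1 <= size z2)%N.
  by move=> W; case: (leqP (size z1) (size z2)) => [/W//|/ltnW/W]; rewrite setIC.
have [E|E] := eqVneq z1 (take (size z1) z2).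
  right; exists z2; rewrite setIidr// => x Hx k kz.
  by rewrite Hx ?(leq_trans kz)// [in RHS]E nth_take.
left; apply/seteqP; split=> x //= [H1 H2]; move/eqP: E; apply.
apply: (@eq_from_nth _ a0); first by rewrite size_takel.
by move=> k kz; rewrite -H1// H2 ?(leq_trans kz)// nth_take.
Qed.

Lemma sigma_cylinder : @measurable _ S = <<s G >>.
Proof.
apply/seteqP; split; last first.
  apply: smallest_sub; first exact: sigma_algebra_measurable.
  by move=> _ [->|[z ->]]; [exact: measurable0|exact: measurable_cylinder].
apply: smallest_sub; first exact: smallest_sigma_algebra.
move=> _ [k [a ->]].
(* Words are countable: [F] enumerates the cylinders of length [k + 1] whose entry at index [k] is
   [a], and they cover the coordinate event. *)
pose F n : set S := if unpickle n is Some z then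
  if (size (z : seq A) == k.+1) && (nth a0 z k == a) then cylinder z else set0 else set0.
have GF n : G (F n).
  rewrite /F; case: unpickle => [z|]; last by left.
  by case: ifP => _; [right; exists z|left].
rewrite (_ : [set x : nat -> A | x k = a] = \bigcup_n F n).
  by apply: sigma_algebra_bigcup => n; exact: sub_sigma_algebra.
apply/seteqP; split=> x /=.
  move=> xk; exists (pickle (mkseq x k.+1)) => //; rewrite /F pickleK.
  rewrite size_mkseq eqxx nth_mkseq// xk eqxx => j; rewrite size_mkseq => jk.
  by rewrite nth_mkseq.
move=> [n _]; rewrite /F; case: unpickle => [z|//]; case: ifP => // /andP[/eqP sz /eqP za] Hx.
by rewrite Hx ?sz.
Qed.

Lemma eq_measure_cylinder (m1 m2 : {finite_measure set S -> \bar R}) :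
  (forall z, m1 (cylinder z) = m2 (cylinder z)) ->
  forall C, measurable C -> m1 C = m2 C.
Proof.
move=> H C mC; apply: (measure_unique G (fun=> setT)) => //.
- exact: sigma_cylinder.
- exact: cylinder_setI.
- by move=> _; right; exists [::]; apply/seteqP.
- by rewrite bigcup_const//; exists 0%N.
- by move=> _ [->|[z ->]]; [rewrite !measure0|exact: H].
- by move=> _; rewrite ltey_eq fin_num_measure.
Qed.

(** Turns a cylinder read backwards from time [i] into a block read forwards from time
    [i - size z + 1], the shape in which [stationary] is stated. *)
Lemma past_cylinderE i (z : seq A) : pst i @^-1` cylinder z =
  [set w | forall k : 'I_(size z),
     X (i - (size z)%:Z + 1 + (k : nat)%:Z) w = tnth [tuple of rev (in_tuple z)] k].
Proof.
have rank_rev (k : nat) : (k < size z)%N ->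
    i - (size z)%:Z + 1 + (size z - k.+1)%N%:Z = i - k%:Z.
  by move=> kz; rewrite -subzn// -[k.+1]addn1 PoszD; ring.
apply/seteqP; split=> w /= H.
  move=> [k kz] /=; have kz' : (size z - k.+1 < size z)%N.
    by rewrite ltn_subrL /= (leq_ltn_trans _ kz).
  rewrite (tnth_nth a0) /= nth_rev// -H// /past.
  have := rank_rev _ kz'; rewrite -[(_ - (_ - _).+1)%N]/(size z - (size z - k.+1).+1)%N.
  by rewrite subnSK// subKn 1?ltnW// => ->.
move=> k kz; have kz' : (size z - k.+1 < size z)%N.
  by rewrite ltn_subrL /= (leq_ltn_trans _ kz).
have := H (Ordinal kz'); rewrite (tnth_nth a0) /= nth_rev//.
by rewrite subnSK// subKn 1?ltnW// rank_rev.
Qed.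

Lemma past_cylinder_stat i j z : P (pst i @^-1` cylinder z) = P (pst j @^-1` cylinder z).
Proof. by rewrite !past_cylinderE !stX. Qed.

Definition past_law : set S -> \bar R := image_measure P (measurable_past (-1)).
HB.instance Definition _ := Probability.on past_law.

Lemma past_lawE i C : measurable C -> P (pst i @^-1` C) = past_law C.
Proof.
move=> mC; rewrite -[LHS]/(image_measure P (measurable_past i) C).
by apply: eq_measure_cylinder => // z; exact: past_cylinder_stat.
Qed.

Lemma integral_past i (g : S -> \bar R) : measurable_fun setT g -> (forall x, 0 <= g x)%E ->
  (\int[P]_w g (pst i w) = \int[past_law]_x g x)%E.
Proof.
move=> mg g0; rewrite -(ge0_integral_image (measurable_past i) P mg g0).
apply: eq_measure_integral => C mC _; exact: past_lawE.
Qed.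
End Process.

(** * Stationarity as invariance under the transitions *)

Lemma integral_coupling (R : realType) (A : finType) (a0 : A) (q : A -> R) (h : A -> \bar R) :
  prob_vec q -> (forall a, 0 <= h a)%E ->
  (\int[unif R]_u h (coupling a0 q u) = \sum_a (q a)%:E * h a)%E.
Proof.
move=> pq h0.
have mI a : measurable_fun setT (fun u : R => (\1_[set u | coupling a0 q u = a] u)%:E : \bar R).
  by apply/measurable_EFinP; apply: measurable_indic; exact: measurable_coupling_set.
have E u : h (coupling a0 q u) = (\sum_a h a * (\1_[set u | coupling a0 q u = a] u)%:E)%E.
  rewrite (bigD1 (coupling a0 q u))//= big1 ?adde0 => [|a ab].
    by rewrite indicE mem_set// mule1.
  by rewrite indicE memNset ?mule0//= => e; rewrite e eqxx in ab.
under eq_integral do rewrite E.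
rewrite ge0_integral_sum//; first last.
- by move=> a u _; rewrite mule_ge0// lee_fin.
- by move=> a; exact: measurable_funeM.
apply: eq_bigr => a _; rewrite ge0_integralZl//.
rewrite integral_indic//; last exact: measurable_coupling_set.
by rewrite setIT muleC; congr (_ * _)%E; exact: unif_coupling.
Qed.

Section ProcessChain.
Context {R : realType} {d : measure_display} {T : measurableType d}
  (P : probability T R) {A : finType} (a0 : A).
Variable X : int -> T -> A.
Hypothesis mX : forall n a, measurable (X n @^-1` [set a]).
Hypothesis stX : stationary P X.
Variable p : (nat -> A) -> A -> R.
Hypothesis regX : regular_version P X p.
Local Notation S := (past_space a0).
Local Notation pst i := (past X i : T -> S).
Local Notation mu := (@past_law R d T P A a0 X mX).

Lemma regular_prob_vec x : prob_vec (p x).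
Proof. by case: regX => h0 [h1 _]; split. Qed.
Local Notation pp := regular_prob_vec.

Lemma measurable_transition a : measurable_fun setT (fun x : S => p x a).
Proof. by move=> _ B mB; rewrite setTI; case: regX => _ [_ [h _]]; exact: h. Qed.

Definition next (t : S * R) : S := pcons (coupling a0 (p t.1) t.2) t.1.

Lemma measurable_next : measurable_fun setT next.
Proof.
apply: measurable_fun_past => -[|k] a; rewrite /next /=.
  apply: (@measurable_coupling R A a0 _ _ (fun t : S * R => p t.1)) => //.
  - by move=> b; exact: (measurableT_comp (measurable_transition b) measurable_fst).
  - by move=> t; exact: pp.
exact: (measurable_preimage measurable_fst (@measurable_coord A a0 k a)).
Qed.

Lemma pastS i w : past X i w = pcons (X i w) (past X (i - 1) w).
Proof.
apply/funext => -[|k]; rewrite /past /= ?subr0//.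
by rewrite -[k.+1]add1n PoszD opprD addrA.
Qed.

(** By stationarity [mu] is also the law of the past at time 0. Splitting according to [X 0] and
    applying the regular version expresses it as one step from the past at time -1, and [coupling]
    realises this step with an independent uniform variable. *)
Lemma past_law_next (C : set S) : measurable C -> mu C = (mu \x unif R)%E (next @^-1` C).
Proof.
move=> mC; rewrite -(past_lawE mX stX 0 mC).
have mpC a : measurable ((pcons a : S -> S) @^-1` C).
  exact: (measurable_preimage (@measurable_pcons A a0 a) mC).
have mpast i D : measurable D -> measurable (pst i @^-1` D).
  exact: (measurable_preimage (measurable_past mX i)).
rewrite (@measure_finite_partition _ _ _ P A (fun a => X 0 @^-1` [set a])); first last.
- by move=> w _; exists (X 0 w).
- by move=> w a b /= <- <-.
- by move=> a; exact: mX.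
- exact: mpast.
rewrite [RHS]/(product_measure1 _ _ _) /= /product_measure1.
have mpE a : measurable_fun setT (fun x : S => (p x a)%:E).
  by apply/measurable_EFinP; exact: measurable_transition.
have m1 a : measurable_fun setT (fun x : S => (\1_C (pcons a x : S))%:E : \bar R).
  have mC1 : measurable_fun setT (\1_C : S -> R) by exact: measurable_indic.
  by apply/measurable_EFinP; exact: (measurableT_comp mC1 (@measurable_pcons A a0 a)).
have mpm a : measurable_fun setT (fun x : S => (p x a)%:E * (\1_C (pcons a x : S))%:E)%E.
  exact: emeasurable_funM.
have p0 x a : 0 <= p x a by case: (pp x).
transitivity (\int[mu]_x (\sum_a (p x a)%:E * (\1_C (pcons a x : S))%:E))%E; last first.
  apply: eq_integral => x _.
  rewrite -(integral_coupling a0 (h := fun a => (\1_C (pcons a x : S))%:E) (pp x)); last first.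
    by move=> a; rewrite lee_fin.
  transitivity (\int[unif R]_u (\1_(xsection (next @^-1` C) x) u)%:E)%E.
    apply: eq_integral => u _; rewrite !indicE.
    suff -> : (pcons (coupling a0 (p x) u) x \in C) =
      (u \in xsection (next @^-1` C) x) by [].
    by rewrite mem_xsection; apply/idP/idP; rewrite !inE.
  rewrite integral_indic ?setIT//.
  by apply: measurable_xsection; exact: (measurable_preimage measurable_next mC).
rewrite ge0_integral_sum//; last by move=> a x _; rewrite mule_ge0// lee_fin.
apply: eq_bigr => a _.
transitivity (P (X 0 @^-1` [set a] `&` past X (-1) @^-1` ((pcons a : S -> S) @^-1` C))).
  congr (P _); apply/seteqP; split=> w /= [h1 h2]; split=> //.
    by rewrite -h2 -(pastS 0).
  by rewrite (pastS 0) h1.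
case: regX => _ [_ [_ ->]]; last exact: mpC.
rewrite -(integral_past mX stX (-1) (mpm a)); last first.
  by move=> x; rewrite mule_ge0// lee_fin.
rewrite integral_mkcond; apply: eq_integral => w _; rewrite patchE indicE.
have -> : (w \in past X (-1) @^-1` ((pcons a : S -> S) @^-1` C)) =
    (pcons a (past X (-1) w) \in C) by apply/idP/idP; rewrite !inE.
by case: (_ \in C); rewrite ?mule1 ?mule0.
Qed.

Lemma stationary_law (g : S -> \bar R) : measurable_fun setT g -> (forall x, 0 <= g x)%E ->
  (\int[mu]_x g x = \sum_a \int[mu]_x ((p x a)%:E * g (pcons a x : S)))%E.
Proof.
move=> mg g0.
have p0 x a : 0 <= p x a by case: (pp x).
transitivity (\int[image_measure (mu \x unif R) measurable_next]_x g x)%E.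
  by apply: eq_measure_integral => C mC _; exact: past_law_next.
rewrite ge0_integral_image// fubini_tonelli1//; last first.
  exact: (measurableT_comp mg measurable_next).
transitivity (\int[mu]_x \sum_a (p x a)%:E * g (pcons a x : S))%E.
  apply: eq_integral => x _; rewrite /fubini_F /next /=.
  by rewrite (integral_coupling a0 (h := fun a => g (pcons a x : S)) (pp x)).
rewrite ge0_integral_sum//; last by move=> a x _; rewrite mule_ge0// lee_fin.
move=> a; apply: emeasurable_funM.
  by apply/measurable_EFinP; exact: measurable_transition.
exact: (measurableT_comp mg (@measurable_pcons A a0 a)).
Qed.

Hypothesis posX : forall a : A, {ae P, forall w, 0 < p (past X (-1) w) a}.

Lemma transition_pos a : {ae mu, forall x : S, 0 < p x a}.
Proof.
have mB : measurable [set x : S | p x a <= 0].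
  by apply: measurable_le0; exact: measurable_transition.
exists [set x : S | p x a <= 0]; split=> //; last first.
  by move=> x /= h; rewrite leNgt; apply/negP => ?; exact: h.
rewrite -[LHS]/(P (past X (-1) @^-1` [set x : S | p x a <= 0])).
apply: measure_negligible; first exact: (measurable_preimage (measurable_past mX (-1)) mB).
by have := posX a; apply: negligibleS => w /= h1 h2; move: h1; rewrite leNgt h2.
Qed.
End ProcessChain.

(** * Finite blocks and the tail of the series of [eta_n] *)

Section Blocks.
Context {R : realType} {d : measure_display} {T : measurableType d}
  (P : probability T R) {A : finType} (a0 : A).
Variable X : int -> T -> A.
Hypothesis mX : forall n a, measurable (X n @^-1` [set a]).
Hypothesis stX : stationary P X.
Variable p : (nat -> A) -> A -> R.
Hypothesis regX : regular_version P X p.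
Local Notation S := (past_space a0).
Local Notation pst i := (past X i : T -> S).
Local Notation mu := (@past_law R d T P A a0 X mX).

(** [block_event] for words without a length in their type, so that they can be extended by
    [rcons]. *)
Definition block (z : seq A) : set T := pst (-1) @^-1` @cylinder A a0 (rev z).

Lemma block_eventE n (z : n.-tuple A) : block_event X z = block z.
Proof.
have sz : size (rev z) = n by rewrite size_rev size_tuple.
apply/seteqP; split=> w /= H.
  move=> k; rewrite sz => kn; have kn' : (n - k.+1 < n)%N.
    by rewrite ltn_subrL /= (leq_ltn_trans _ kn).
  have := H (Ordinal kn'); rewrite (tnth_nth a0) /= nth_rev ?size_tuple// => <-.
  rewrite /past; congr (X _ w); rewrite -subzn// -[k.+1]addn1 PoszD; ring.
move=> [k kn] /=; have kn' : (n - k.+1 < size (rev z))%N.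
  by rewrite sz ltn_subrL /= (leq_ltn_trans _ kn).
have kz : (n - k.+1 < size z)%N by rewrite size_tuple -{2}sz.
have := H _ kn'; rewrite nth_rev// size_tuple subnSK// subKn 1?ltnW//.
rewrite (tnth_nth a0) /= => <-; rewrite /past; congr (X _ w).
by rewrite -subzn// -[k.+1]addn1 PoszD; ring.
Qed.

Definition block_prob (z : seq A) : R := fine (P (block z)).

Definition block_trans (z : seq A) (a : A) : R :=
  if P (block z) == 0%E then fine (P (X 0 @^-1` [set a]))
  else fine (P (X 0 @^-1` [set a] `&` block z)) / block_prob z.

Lemma pfinE n (z : n.-tuple A) : pfin P X z = block_trans z.
Proof. by apply/funext => a; rewrite /pfin block_eventE. Qed.

Lemma measurable_block z : measurable (block z).
Proof. exact: (measurable_preimage (measurable_past mX (-1)) (@measurable_cylinder A a0 _)). Qed.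

Lemma block_probE z : P (block z) = (block_prob z)%:E.
Proof. by rewrite fineK// fin_num_measure//; exact: measurable_block. Qed.

Lemma block_prob_ge0 z : 0 <= block_prob z. Proof. exact: fine_ge0. Qed.

(** The extended block ends at time 0; stationarity moves it back to time -1. *)
Lemma block_rcons z a : P (X 0 @^-1` [set a] `&` block z) = (block_prob (rcons z a))%:E.
Proof.
rewrite -block_probE /block rev_rcons (past_cylinder_stat a0 stX (-1) 0) cylinder_cons.
have E w : past X 0 w 0%N = X 0 w /\ ptail (past X 0 w) = past X (-1) w by rewrite pastS.
congr (P _); apply/seteqP; split=> w [h1 h2]; have [e1 e2] := E w; split.
- exact: etrans e1 h1.
- exact: (eq_ind_r (@cylinder A a0 (rev z)) h2 e2).
- exact: etrans (esym e1) h1.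
- exact: (eq_ind _ (@cylinder A a0 (rev z)) h2 _ e2).
Qed.

Lemma sum_letter_prob (B : set T) : measurable B ->
  (\sum_a P (X 0 @^-1` [set a] `&` B) = P B)%E.
Proof.
move=> mB; rewrite [RHS](@measure_finite_partition _ _ _ P A (fun a => X 0 @^-1` [set a]))//.
- by apply: eq_bigr => a _; rewrite setIC.
- by move=> w a b /= <- <-.
- by move=> w _; exists (X 0 w).
Qed.

(** The convention on null blocks makes [block_trans z] a probability for every word, as the fresh
    chain requires. *)
Lemma block_trans_prob_vec z : prob_vec (block_trans z).
Proof.
have fE (B : set T) : measurable B -> P B = (fine (P B))%:E.
  by move=> mB; rewrite fineK// fin_num_measure.
split=> [a|].
  by rewrite /block_trans; case: ifP => _; rewrite ?divr_ge0 ?fine_ge0.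
rewrite /block_trans; case: eqP => [_|z0].
  apply: EFin_inj; rewrite -sumEFin -(probability_setT P) -(sum_letter_prob measurableT).
  by apply: eq_bigr => a _; rewrite setIT -fE.
rewrite -mulr_suml; apply/eqP; rewrite -(inj_eq (@EFin_inj R)); apply/eqP.
have b0 : block_prob z != 0.
  by apply/eqP => h; apply: z0; rewrite block_probE h.
rewrite (_ : \sum_a _ = block_prob z) ?divff//.
apply: EFin_inj; rewrite -sumEFin -block_probE -(sum_letter_prob (measurable_block z)).
by apply: eq_bigr => a _; rewrite block_rcons.
Qed.

(** The product rule for conditional probabilities; on a null block both sides vanish, whatever the
    value of [block_trans]. *)
Lemma block_prob_rcons z a : block_prob (rcons z a) = block_prob z * block_trans z a.
Proof.
rewrite /block_trans; case: eqP => [z0|z0].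
  have bz : block_prob z = 0 by rewrite /block_prob z0.
  have : (P (X 0 @^-1` [set a] `&` block z) <= P (block z))%E.
    apply: le_measure_sub; last by move=> w [].
      by apply: measurableI => //; exact: measurable_block.
    exact: measurable_block.
  rewrite z0 block_rcons lee_fin => le0.
  by rewrite bz mul0r; apply/eqP; rewrite eq_le le0 block_prob_ge0.
have b0 : block_prob z != 0.
  by apply/eqP => h; apply: z0; rewrite block_probE h.
by rewrite block_rcons /= mulrCA divff// mulr1.
Qed.

Lemma block_prob_sum n : \sum_(z : n.-tuple A) block_prob z = 1.
Proof.
elim: n => [|n IH].
  rewrite (big_pred1 [tuple]) => [|z]; last by apply/esym/eqP; exact: tuple0.
  apply: EFin_inj; rewrite -block_probE -(probability_setT P).
  by congr (P _); apply/seteqP.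
rewrite sum_tuple_rcons -[RHS]IH; apply: eq_bigr => z _.
under eq_bigr do rewrite block_prob_rcons.
by rewrite -mulr_sumr (block_trans_prob_vec z).2 mulr1.
Qed.

(** In [eta_n] the past is integrated separately from the block, so only its law matters, and this
    law is [mu] at every time. *)
Lemma eta_nE n : eta_n P X p n = mean_gap p block_trans mu block_prob n.
Proof.
apply: eq_bigr => z _; rewrite muleC block_eventE block_probE; congr (_ * _)%E.
have mtv : measurable_fun setT (fun x : S => (tv (block_trans z) (p (pcat x z)))%:E).
  apply/measurable_EFinP; apply: measurable_tv => a; exact: measurable_transition regX a.
rewrite -(integral_past mX stX (- (n%:Z + 1)) mtv); last by move=> x; rewrite lee_fin tv_ge0.
by apply: eq_integral => w _; rewrite pfinE pcatE.
Qed.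

Hypothesis posX : forall a : A, {ae P, forall w, 0 < p (past X (-1) w) a}.
Hypothesis sum_eta : (\sum_(0 <= n <oo) eta_n P X p n < +oo)%E.

Lemma eta_n_ge0 n : (0 <= eta_n P X p n)%E.
Proof.
apply: sume_ge0 => z _; apply: mule_ge0 => //.
by apply: integral_ge0 => w _; rewrite lee_fin tv_ge0.
Qed.

Lemma small_tail (e : R) : 0 < e -> exists l, forall m,
  (\sum_(k < m) mean_gap p block_trans mu block_prob (l + k) <= e%:E)%E.
Proof.
move=> e0.
have eta0 n : true -> (0 <= eta_n P X p n)%E by move=> _; exact: eta_n_ge0.
have := nneseries_tail_cvg sum_eta eta0.
move=> /fine_cvgP[[k1 _ H1] /cvgrPdist_le/(_ e e0)[k2 _ H2]].
exists (maxn k1 k2) => m; set l := maxn k1 k2.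
have h1 : (\sum_(l <= k <oo) eta_n P X p k)%E \is a fin_num by apply: H1; exact: leq_maxl.
have := H2 l (leq_maxr _ _); rewrite /= sub0r normrN => h2.
apply: le_trans (_ : (\sum_(l <= k <oo) eta_n P X p k <= _)%E).
  apply: le_trans (nneseries_lim_ge (m := l) (l + m) (fun n _ => eta0 n)).
  have -> : (\sum_(l <= k < l + m) eta_n P X p k = \sum_(k < m) eta_n P X p (l + k))%E.
    rewrite -{1}(add0n l) big_addn addKn big_mkord.
    by apply: eq_bigr => k _; rewrite addnC.
  by apply: lee_sum => k _; rewrite eta_nE.
rewrite -(fineK h1) lee_fin; apply: le_trans h2; exact: ler_norm.
Qed.

(** Freezes the second past by Fubini: if every [y] gave more than [e], the mean over [y] would be
    at least [e], against the bound [e / 2] for two independent pasts. *)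
Theorem process_coalescence (e : R) : 0 < e -> exists n y,
  (\int[mu]_x (iter n (@moveK R A a0 p) (@neq_head R A a0) (x, y))%:E <= e%:E)%E.
Proof.
move=> e0; have e2 : 0 < e / 2 by rewrite divr_gt0.
have pp := regular_prob_vec regX; have mp := measurable_transition (a0 := a0) regX.
have [n Hn] := coalescence pp mp (@stationary_law R d T P A a0 X mX stX p regX)
  (@transition_pos R d T P A a0 X mX p regX posX) block_trans_prob_vec block_prob_ge0 block_prob_sum
  block_prob_rcons small_tail e2.
exists n; apply: contrapT => H.
set f := iter n _ _ in Hn H.
have mf : measurable_fun setT f by apply: measurable_iter_move => //; exact: measurable_neq_head.
have f0 z : 0 <= f z.
  by have /andP[] := iter_move_unit pp n (g := @neq_head R A a0)
    ltac:(by move=> z'; rewrite /neq_head ler0n lern1 leq_b1) z.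
have mEf : measurable_fun setT (EFin \o f) by exact/measurable_EFinP.
have f0' z : (0 <= (EFin \o f) z)%E by rewrite lee_fin.
have : (e%:E <= \int[mu \x mu]_z (f z)%:E)%E.
  rewrite fubini_tonelli2//.
  rewrite -[leLHS]mule1 -(probability_setT mu) -integral_cst//.
  apply: ge0_le_integral => //.
  - by move=> y _; rewrite lee_fin ltW.
  - by apply: measurable_fun_fubini_tonelli_G.
  - move=> y _; rewrite leNgt; apply/negP => h; apply: H; exists y; exact: ltW.
move=> /le_trans/(_ Hn); rewrite lee_fin => ?; lra.
Qed.
End Blocks.

Section SigmaAlgebras.
Context {T : Type}.

Lemma sigma_algebra_setT (G : set (set T)) : <<s G >> setT.
Proof. by have := sigma_algebraCD (@sigma_algebra0 T setT G); rewrite setD0. Qed.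

Lemma sigma_algebra_setI (G : set (set T)) (B C : set T) :
  <<s G >> B -> <<s G >> C -> <<s G >> (B `&` C).
Proof.
move=> hB hC; rewrite -[B `&` C]setCK setCI -setTD; apply: sigma_algebraCD.
rewrite -bigcup2E; apply: sigma_algebra_bigcup => -[|[|n]] /=.
- by rewrite -setTD; exact: sigma_algebraCD.
- by rewrite -setTD; exact: sigma_algebraCD.
- exact: sigma_algebra0.
Qed.
End SigmaAlgebras.

(** * Innovations *)

Section Auxiliary.
Context {R : realType}.

Definition aux (k : int) : R -> R := uniforms (pickle k).

Lemma measurable_aux k : measurable_fun setT (aux k).
Proof. exact: measurable_uniforms. Qed.

Lemma unif_aux (s : seq int) (B : int -> set R) : uniq s -> (forall i, measurable (B i)) ->
  unif R (\big[setI/setT]_(i <- s) (aux i @^-1` B i)) = (\prod_(i <- s) unif R (B i))%E.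
Proof.
move=> us mB; pose B' n := if unpickle n is Some i then B i else setT.
have B'E i : B' (pickle i) = B i by rewrite /B' pickleK.
have := @unif_uniforms R (map pickle s) B'.
rewrite !big_map (map_inj_uniq (pcan_inj (@pickleK int))).
under eq_bigr do rewrite B'E; under [in RHS]eq_bigr do rewrite B'E.
apply=> // n; rewrite /B'; case: unpickle => [i|]; [exact: mB|exact: measurableT].
Qed.

Definition aux_past (m : int) : set (set R) :=
  <<s [set E | exists k B, (k <= m)%R /\ measurable B /\ E = aux k @^-1` B] >>.

Lemma aux_past_measurable m F : aux_past m F -> measurable F.
Proof.
apply: smallest_sub; first exact: sigma_algebra_measurable.
by move=> _ [k [B [_ [mB ->]]]]; exact: (measurable_preimage (measurable_aux k) mB).
Qed.

(** In the variable [F] both sides are finite measures. They agree, by [unif_aux], on finite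
    intersections of events on single variables, which are stable under intersection and generate
    [aux_past m]. *)
Lemma aux_past_indep m F B : aux_past m F -> measurable B ->
  unif R (F `&` aux (m + 1) @^-1` B) = (unif R F * unif R B)%E.
Proof.
move=> hF mB.
pose fin_inter : set (set R) := [set E | exists (s : seq int) (D : int -> set R),
  [/\ uniq s, forall i, i \in s -> i <= m, forall i, measurable (D i) &
      E = [set w | forall i, i \in s -> D i (aux i w)]]].
have fin_interE (s : seq int) (D : int -> set R) :
    [set w | forall i, i \in s -> D i (aux i w)] = \big[setI/setT]_(i <- s) (aux i @^-1` D i).
  by rewrite -bigcap_seq; apply/seteqP; split=> w /= H i; exact: H.
have mfin E : fin_inter E -> measurable E.
  move=> [s [D [_ _ mD ->]]]; rewrite fin_interE; apply: bigsetI_measurable => i _.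
  exact: (measurable_preimage (measurable_aux i) (mD i)).
have mauxB : measurable (aux (m + 1) @^-1` B).
  exact: (measurable_preimage (measurable_aux _) mB).
pose uB : {nonneg R} := NngNum (fine_ge0 (measure_ge0 (unif R) B)).
have uBE : (uB%:num)%:E = unif R B by rewrite /= fineK// fin_num_measure.
have hF' : <<s fin_inter >> F.
  move: hF; apply: sub_sigma_algebra2 => _ [k [D [km [mD ->]]]].
  exists [:: k], (fun=> D); split => //; first by move=> i; rewrite inE => /eqP ->.
  by apply/seteqP; split=> w /=; [move=> h i; rewrite inE => /eqP ->|apply; rewrite inE].
rewrite muleC -uBE -[LHS]/(mrestr (unif R) mauxB F) -[RHS]/(mscale uB (unif R) F).
apply: (g_sigma_algebra_measure_unique fin_inter _ (fun=> setT)) => //.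
- by move=> _; exists [::], (fun=> setT); split => //; apply/seteqP.
- by rewrite bigcup_const//; exists 0%N.
- move=> _ _ [s [D [us sm mD ->]]] [s' [D' [us' sm' mD' ->]]].
  exists (undup (s ++ s')), (fun i => (if i \in s then D i else setT) `&`
    (if i \in s' then D' i else setT)); split.
  + exact: undup_uniq.
  + by move=> i; rewrite mem_undup mem_cat => /orP[/sm|/sm'].
  + by move=> i; apply: measurableI; case: ifP => // _; exact: measurableT.
  + apply/seteqP; split=> w /=.
      by move=> [h h'] i _; split; case: ifP => // si; [exact: h|exact: h'].
    move=> h; split=> i si; have := h i; rewrite mem_undup mem_cat si ?orbT => /(_ isT)[].
      by [].
    by move=> _.
- move=> _ [s [D [us sm mD ->]]].
  set E0 := [set w | _]; rewrite -[RHS]/((uB%:num)%:E * unif R E0)%E uBE.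
  rewrite -[LHS]/(unif R (E0 `&` aux (m + 1) @^-1` B)) /E0 fin_interE.
  have nm : m + 1 \notin s.
    by apply/negP => /sm; rewrite gerDl ler10.
  have := @unif_aux (m + 1 :: s) (fun i => if i == m + 1 then B else D i).
  rewrite /= nm us !big_cons eqxx => H.
  have mif i : measurable (if i == m + 1 then B else D i) by case: ifP.
  have {H} := H isT mif.
  have E1 i : i \in s -> (if i == m + 1 then B else D i) = D i.
    by case: eqP => // -> h; rewrite h in nm.
  rewrite (eq_big_seq (fun i => aux i @^-1` D i)); last by move=> i si; rewrite E1.
  rewrite [in RHS](eq_big_seq (fun i => unif R (D i))); last by move=> i si; rewrite E1.
  by rewrite setIC => ->; rewrite -unif_aux.
- by move=> _; rewrite ltey_eq fin_num_measure.
Qed.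

Lemma aux_unit k : unif R [set w | ~~ (0 <= aux k w < 1)] = 0%E.
Proof.
have mI : measurable (~` `[0%R, 1%R[%classic : set R) by apply: measurableC.
have := @unif_aux [:: k] (fun=> ~` `[0%R, 1%R[%classic) isT (fun=> mI).
rewrite !big_seq1 (_ : aux k @^-1` _ = [set w | ~~ (0 <= aux k w < 1)]); last first.
  by apply/seteqP; split=> w /=; rewrite in_itv /= => /negP.
by move=> ->; apply: unif_null; apply/seteqP; split=> w // -[].
Qed.
End Auxiliary.

Section Innovations.
Context {R : realType} {d : measure_display} {T : measurableType d}
  (P : probability T R) {A : finType} (a0 : A).
Variable X : int -> T -> A.
Hypothesis mX : forall n a, measurable (X n @^-1` [set a]).
Hypothesis stX : stationary P X.
Variable p : (nat -> A) -> A -> R.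
Hypothesis regX : regular_version P X p.
Local Notation S := (past_space a0).
Local Notation pst i := (past X i : T -> S).
Local Notation mu := (@past_law R d T P A a0 X mX).
Local Notation T' := (T * R)%type.
Local Notation P' := (P \x unif R)%E.
Local Notation pp := (regular_prob_vec regX).

Definition innovation (k : int) (t : T') : R :=
  resample (p (past X (k - 1) t.1)) (X k t.1) (aux k t.2).

Lemma measurable_resample_at d' (Z : measurableType d') (x : Z -> S) (b : Z -> A) (w : Z -> R) :
  measurable_fun setT x -> (forall a, measurable (b @^-1` [set a])) -> measurable_fun setT w ->
  measurable_fun setT (fun z => resample (p (x z)) (b z) (w z)).
Proof.
move=> mx mb mw.
rewrite (_ : (fun z => _) = (fun z => \sum_a \1_(b @^-1` [set a]) z * resample (p (x z)) a (w z))).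
  apply: measurable_sum => a; apply: measurable_funM; first exact: measurable_indic.
  apply: (@measurable_resample R A _ _ (fun z => p (x z))) => // c.
  exact: (measurableT_comp (measurable_transition (a0 := a0) regX c) mx).
apply/funext => z; rewrite (bigD1 (b z))//= big1 => [|a ab].
  by rewrite indicE mem_set// mul1r addr0.
by rewrite indicE memNset ?mul0r//= => e; rewrite e eqxx in ab.
Qed.

(** Generates the joint history of [X] and [aux] up to time [m], which contains the pasts of both
    [X] and [U]. Rectangles are stable under intersection, so independence can be tested on them. *)
Definition rect (m : int) : set (set T') := [set E | exists (C : set S) (F : set R),
  [/\ measurable C, aux_past m F & E = (pst m @^-1` C) `*` F]].

Lemma rect_measurable m : rect m `<=` measurable.
Proof.
move=> _ [C [F [mC hF ->]]]; apply: measurableX.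
  exact: (measurable_preimage (measurable_past mX m) mC).
exact: (aux_past_measurable hF).
Qed.

(** The space equipped with this smaller sigma-algebra: being adapted at time [m] becomes being a
    measurable function on [history m]. *)
Definition history (m : int) := g_sigma_algebraType (rect m).

Lemma history_sub m : <<s rect m >> `<=` @measurable _ T'.
Proof. apply: smallest_sub; [exact: sigma_algebra_measurable|exact: rect_measurable]. Qed.

Lemma history_X m k a : k <= m -> <<s rect m >> [set t : T' | X k t.1 = a].
Proof.
move=> km; apply: sub_sigma_algebra.
exists [set x : S | x `|m - k|%N = a], setT; split.
- exact: measurable_coord.
- exact: sigma_algebra_setT.
- have E : m - (`|m - k|%N)%:Z = k by rewrite gez0_abs ?subr_ge0//; ring.
  by apply/seteqP; split=> t; rewrite /= /past E; [move=> ?; split|case].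
Qed.

Lemma measurable_history_past m k : k <= m ->
  measurable_fun setT (fun t : history m => past X k t.1 : S).
Proof.
move=> km; apply: measurable_fun_past => j a; apply: history_X.
by apply: le_trans km; rewrite gerBl.
Qed.

Lemma measurable_history_aux m k : k <= m ->
  measurable_fun setT (fun t : history m => aux k t.2 : R).
Proof.
move=> km _ B mB; rewrite setTI; apply: sub_sigma_algebra.
exists setT, (aux k @^-1` B); split => //.
  by apply: sub_sigma_algebra; exists k, B.
by apply/seteqP; split=> t //= [].
Qed.

Lemma measurable_history_innovation m k : k <= m ->
  measurable_fun setT (innovation k : history m -> R).
Proof.
move=> km; apply: measurable_resample_at.
- by apply: measurable_history_past; rewrite (le_trans _ km)// gerBl.
- by move=> a; exact: history_X.
- exact: measurable_history_aux.
Qed.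

Lemma measurable_innovation k : measurable_fun setT (innovation k).
Proof.
apply: measurable_resample_at.
- exact: (measurableT_comp (measurable_past mX (k - 1)) measurable_fst).
- by move=> a; exact: (measurable_preimage measurable_fst (mX k a)).
- exact: (measurableT_comp (measurable_aux k) measurable_snd).
Qed.

Lemma rect_setI m : setI_closed (rect m).
Proof.
move=> _ _ [C [F [mC hF ->]]] [C' [F' [mC' hF' ->]]].
exists (C `&` C'), (F `&` F'); split; first exact: measurableI.
  exact: sigma_algebra_setI.
by apply/seteqP; split=> t /= [[? ?] [? ?]].
Qed.

(** Given the past up to [m], the letter at [m + 1] is drawn from [p]; averaging over it turns the
    resampled variable into a uniform one by [unif_resample], whatever that past is. *)
Lemma integral_resample_past m (C : set S) (B : set R) : measurable C -> measurable B ->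
  (\int[P]_t ((\1_C (pst m t))%:E *
     unif R (resample (p (past X m t)) (X (m + 1) t) @^-1` B)) = mu C * unif R B)%E.
Proof.
move=> mC mB.
pose V b (x : S) := unif R (resample (p x) b @^-1` B).
have mV b : measurable_fun setT (V b).
  pose D : set (S * R) := [set t | B (resample (p t.1) b t.2)].
  have mD : measurable D.
    have mr : measurable_fun setT (fun t : S * R => resample (p t.1) b t.2).
      apply: (@measurable_resample R A _ _ (fun t : S * R => p t.1)) => // c.
      exact: (measurableT_comp (measurable_transition (a0 := a0) regX c) measurable_fst).
    exact: (measurable_preimage mr mB).
  rewrite (_ : V b = unif R \o xsection D); first exact: measurable_fun_xsection.
  by apply/funext => x; rewrite /V /=; congr (unif R _); apply/seteqP; split=> u; rewrite /xsection /= inE.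
have V0 b x : (0 <= V b x)%E by exact: measure_ge0.
have mC1 : measurable_fun setT (fun x : S => (\1_C x)%:E : \bar R).
  by apply/measurable_EFinP; exact: measurable_indic.
(* The integrand as a function of the past at time [m + 1] alone: index 0 is the new letter and
   [ptail] gives the past at time [m]. Stationarity then applies to it. *)
pose H (y : S) : \bar R := (\sum_b (\1_[set x : S | x 0%N = b] y)%:E *
  ((\1_C (ptail y : S))%:E * V b (ptail y : S)))%E.
have mT b : measurable_fun setT (fun y : S => (\1_[set x : S | x 0%N = b] y)%:E *
  ((\1_C (ptail y : S))%:E * V b (ptail y : S)) : \bar R)%E.
  apply: emeasurable_funM.
    by apply/measurable_EFinP; apply: measurable_indic; exact: measurable_coord.
  apply: emeasurable_funM; first exact: (measurableT_comp mC1 (@measurable_ptail A a0)).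
  exact: (measurableT_comp (mV b) (@measurable_ptail A a0)).
have mH : measurable_fun setT H by apply: emeasurable_sum => b; exact: mT.
have H0 y : (0 <= H y)%E.
  by apply: sume_ge0 => b _; rewrite mule_ge0 ?lee_fin ?mule_ge0 ?lee_fin//; exact: V0.
have HE a x : H (pcons a x) = ((\1_C x)%:E * V a x)%E.
  rewrite /H (bigD1 a)//= big1 ?adde0 => [|b ba].
    by rewrite indicE mem_set// mul1e.
  by rewrite indicE memNset ?mul0e//= => e; rewrite e eqxx in ba.
transitivity (\int[P]_t H (pst (m + 1) t))%E.
  by apply: eq_integral => t _; rewrite (pastS X (m + 1)) addrK HE.
rewrite (integral_past mX stX (m + 1) mH H0) (stationary_law mX stX regX mH H0).
have p0 x a : 0 <= p x a by case: (pp x).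
rewrite -ge0_integral_sum//; first last.
- by move=> a x _; rewrite mule_ge0// lee_fin.
- move=> a; apply: emeasurable_funM.
    by apply/measurable_EFinP; exact: measurable_transition regX a.
  exact: (measurableT_comp mH (@measurable_pcons A a0 a)).
transitivity (\int[mu]_x (unif R B * (\1_C x)%:E))%E.
  apply: eq_integral => x _; under eq_bigr do rewrite HE muleCA.
  rewrite -ge0_sume_distrr; last by move=> a _; rewrite mule_ge0 ?lee_fin//; exact: V0.
  by rewrite muleC; congr (_ * _)%E; exact: (unif_resample a0 (pp x) mB).
rewrite ge0_integralZl//.
by rewrite integral_indic// setIT muleC.
Qed.

(** On a rectangle, integrate first over the noise: [aux (m + 1)] is independent of [F], which
    leaves the integral of [integral_resample_past]. Uniqueness of measures extends this to the
    whole history. *)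
Lemma innovation_indep m D B : <<s rect m >> D -> measurable B ->
  P' (D `&` innovation (m + 1) @^-1` B) = (P' D * unif R B)%E.
Proof.
move=> hD mB.
have mUB : measurable (innovation (m + 1) @^-1` B).
  exact: (measurable_preimage (measurable_innovation _) mB).
pose uB : {nonneg R} := NngNum (fine_ge0 (measure_ge0 (unif R) B)).
have uBE : (uB%:num)%:E = unif R B by rewrite /= fineK// fin_num_measure.
rewrite muleC -uBE -[LHS]/(mrestr P' mUB D) -[RHS]/(mscale uB P' D).
apply: (g_sigma_algebra_measure_unique (rect m) _ (fun=> setT)) => //.
- exact: rect_measurable.
- move=> _; exists setT, setT; split => //; first exact: sigma_algebra_setT.
  by apply/seteqP; split.
- by rewrite bigcup_const//; exists 0%N.
- exact: rect_setI.
- move=> _ [C [F [mC hF ->]]]; set E0 := _ `*` _.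
  rewrite -[RHS]/((uB%:num)%:E * P' E0)%E uBE.
  rewrite -[LHS]/(P' (E0 `&` innovation (m + 1) @^-1` B)).
  have mF := aux_past_measurable hF.
  have mpC : measurable (pst m @^-1` C) by exact: (measurable_preimage (measurable_past mX m) mC).
  rewrite [P' E0]product_measure1E//.
  rewrite -[LHS]/(\int[P]_t (unif R \o xsection (E0 `&` innovation (m + 1) @^-1` B)) t)%E.
  transitivity (\int[P]_t (unif R F * ((\1_C (pst m t))%:E *
     unif R (resample (p (past X m t)) (X (m + 1) t) @^-1` B))))%E.
    apply: eq_integral => t _ /=.
    have mr : measurable (resample (p (past X m t)) (X (m + 1) t) @^-1` B).
      exact: (measurable_preimage (measurable_resample1 _ _) mB).
    have [tC|tC] := pselect (C (pst m t)).
      rewrite indicE mem_set// mul1e -(aux_past_indep hF mr); congr (unif R _).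
      apply/seteqP; split=> w; rewrite /xsection /= inE /E0 /= /innovation /= addrK.
        by move=> [[]].
      by move=> [].
    rewrite indicE memNset// mul0e mule0 (_ : xsection _ t = set0) ?measure0//.
    by apply/seteqP; split=> w //; rewrite /xsection /= inE => -[[]].
  have mI : measurable_fun setT (fun t => ((\1_C (pst m t))%:E *
     unif R (resample (p (past X m t)) (X (m + 1) t) @^-1` B))%E).
    apply: emeasurable_funM.
      apply/measurable_EFinP; rewrite (_ : (fun t => _) = \1_(pst m @^-1` C)).
        exact: measurable_indic.
      by apply/funext => t; rewrite !indicE; congr (_%:R); congr nat_of_bool; apply/idP/idP; rewrite !inE.
    pose D2 : set T' := [set t | B (resample (p (past X m t.1)) (X (m + 1) t.1) t.2)].
    have mD2 : measurable D2.
      have mr : measurable_fun setT (fun t : T' => resample (p (past X m t.1)) (X (m + 1) t.1) t.2).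
        apply: measurable_resample_at => //.
          exact: (measurableT_comp (measurable_past mX m) measurable_fst).
        by move=> a; exact: (measurable_preimage measurable_fst (mX (m + 1) a)).
      exact: (measurable_preimage mr mB).
    rewrite (_ : (fun t => _) = unif R \o xsection D2); first exact: measurable_fun_xsection.
    by apply/funext => t /=; congr (unif R _); apply/seteqP; split=> u; rewrite /xsection /= inE.
  rewrite ge0_integralZl//; last by move=> t _; rewrite mule_ge0// lee_fin.
  rewrite integral_resample_past// -(past_lawE mX stX m mC).
  by rewrite muleA [in LHS](muleC (unif R F)) muleC.
- move=> _; apply: (@le_lt_trans _ _ 1%E); last exact: ltry.
  by apply: (@probability_le1 _ _ _ P'); apply: measurableI.
Qed.
End Innovations.

(** * Integrating out the next innovation *)

Lemma integral_coupling2 (R : realType) (A : finType) (a0 : A) (p : (nat -> A) -> A -> R)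
    (z : past_space a0 * past_space a0) (h : A -> A -> \bar R) :
  (forall x, prob_vec (p x)) -> (forall a b, 0 <= h a b)%E ->
  (\int[unif R]_u h (coupling a0 (p z.1) u) (coupling a0 (p z.2) u) =
   \sum_a \sum_b (joint_law p z a b)%:E * h a b)%E.
Proof.
move=> pp h0; pose D a b : set R :=
  [set u | coupling a0 (p z.1) u = a /\ coupling a0 (p z.2) u = b].
have mD a b : measurable (D a b) by exact: measurable_joint_set.
have mI a b : measurable_fun setT (fun u : R => (\1_(D a b) u)%:E : \bar R).
  by apply/measurable_EFinP; exact: measurable_indic.
have E u : h (coupling a0 (p z.1) u) (coupling a0 (p z.2) u) =
    (\sum_a \sum_b h a b * (\1_(D a b) u)%:E)%E.
  rewrite (bigD1 (coupling a0 (p z.1) u))//= [X in (_ + X)%E]big1 ?adde0 => [|a ab].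
    rewrite (bigD1 (coupling a0 (p z.2) u))//= big1 ?adde0 => [|b bb].
      by rewrite indicE mem_set// mule1.
    by rewrite indicE memNset ?mule0//= => -[_ e]; rewrite e eqxx in bb.
  by rewrite big1// => b _; rewrite indicE memNset ?mule0//= => -[e _]; rewrite e eqxx in ab.
under eq_integral do rewrite E.
rewrite ge0_integral_sum//; first last.
- by move=> a u _; apply: sume_ge0 => b _; rewrite mule_ge0// lee_fin.
- by move=> a; apply: emeasurable_sum => b; exact: measurable_funeM.
apply: eq_bigr => a _; rewrite ge0_integral_sum//; first last.
- by move=> b u _; rewrite mule_ge0// lee_fin.
- by move=> b; exact: measurable_funeM.
apply: eq_bigr => b _; rewrite ge0_integralZl//.
by rewrite integral_indic// setIT muleC; congr (_ * _)%E; rewrite joint_lawE.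
Qed.

Section JointLaw.
Context {R : realType} {d : measure_display} {T : measurableType d}
  (P : probability T R) {A : finType} (a0 : A).
Variable X : int -> T -> A.
Hypothesis mX : forall n a, measurable (X n @^-1` [set a]).
Hypothesis stX : stationary P X.
Variable p : (nat -> A) -> A -> R.
Hypothesis regX : regular_version P X p.
Local Notation S := (past_space a0).
Local Notation pst i := (past X i : T -> S).
Local Notation mu := (@past_law R d T P A a0 X mX).
Local Notation T' := (T * R)%type.
Local Notation P' := (P \x unif R)%E.
Local Notation pp := (regular_prob_vec regX).
Local Notation U := (innovation X p).
Local Notation history := (@history R d T A a0 X).
Local Notation rect := (@rect R d T A a0 X).

Lemma history_measurable_fun m d' (W : measurableType d') (xi : history m -> W) :
  measurable_fun setT xi -> measurable_fun setT (xi : T' -> W).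
Proof.
move=> mxi _ B mB; rewrite setTI.
have hB : <<s rect m >> (xi @^-1` B) by have := mxi measurableT B mB; rewrite setTI.
exact: (history_sub mX hB).
Qed.

(** By [innovation_indep] the joint law of [xi] and [U (m + 1)] gives rectangles their product
    measure, so it is the product law. *)
Lemma integral_history_innovation m d' (W : measurableType d') (xi : history m -> W)
    (Psi : W * R -> \bar R) :
  measurable_fun setT xi -> measurable_fun setT Psi -> (forall z, 0 <= Psi z)%E ->
  (\int[P']_t Psi (xi t, U (m + 1) t) = \int[P']_t \int[unif R]_u Psi (xi t, u))%E.
Proof.
move=> mxi mPsi Psi0.
have mxi' := history_measurable_fun mxi.
have mU := measurable_innovation a0 mX regX (m + 1).
have mf : measurable_fun setT (fun t : T' => (xi t, U (m + 1) t) : W * R).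
  exact/measurable_fun_pairP.
rewrite -(ge0_integral_image mf P' mPsi Psi0).
pose m1 : probability W R := image_measure P' mxi'.
have H B D : measurable B -> measurable D ->
    image_measure P' mf (B `*` D) = (m1 B * unif R D)%E.
  move=> mB mD.
  have hB : <<s rect m >> (xi @^-1` B) by have := mxi measurableT B mB; rewrite setTI.
  rewrite -[m1 B]/(P' (xi @^-1` B)) -(innovation_indep mX stX regX hB mD).
  by rewrite /image_measure.
have E := @product_measure_unique _ _ W R R m1 (unif R) (image_measure P' mf) H.
transitivity (\int[m1 \x unif R]_z Psi z)%E.
  by apply: eq_measure_integral => C mC _; apply: esym; exact: E.
rewrite fubini_tonelli1//.
have mF : measurable_fun setT (fubini_F (unif R) Psi).
  exact: measurable_fun_fubini_tonelli_F.
have F0 w : (0 <= fubini_F (unif R) Psi w)%E by apply: integral_ge0.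
exact: (ge0_integral_image mxi' P' mF F0).
Qed.

Lemma integral_P'_fst (f : T -> \bar R) : measurable_fun setT f -> (forall x, 0 <= f x)%E ->
  (\int[P']_t f t.1 = \int[P]_x f x)%E.
Proof.
move=> mf f0; rewrite fubini_tonelli1//=.
- apply: eq_integral => x _; rewrite /fubini_F /=.
  by rewrite integral_cst//= -[X in (_ * X)%E](_ : 1%E = _) ?mule1// probability_setT.
- exact: (measurableT_comp mf measurable_fst).
Qed.

(** A letter of conditional probability 0 is almost surely not drawn: in the stationarity formula
    the weight [p x a] vanishes wherever the indicator does not. *)
Lemma transition_last_pos m : P [set w | p (past X m w) (X (m + 1) w) <= 0] = 0%E.
Proof.
pose B : set S := [set y | p (ptail y) (y 0%N) <= 0].
have mf : measurable_fun setT (fun y : S => p (ptail y) (y 0%N)).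
  rewrite (_ : (fun y => _) = (fun y => \sum_a \1_[set x : S | x 0%N = a] y * p (ptail y) a)).
    apply: measurable_sum => a; apply: measurable_funM.
      by apply: measurable_indic; exact: measurable_coord.
    exact: (measurableT_comp (measurable_transition (a0 := a0) regX a) (@measurable_ptail A a0)).
  apply/funext => y; rewrite (bigD1 (y 0%N))//= big1 => [|a ab].
    by rewrite indicE mem_set// mul1r addr0.
  by rewrite indicE memNset ?mul0r//= => e; rewrite e eqxx in ab.
have mB : measurable B by exact: measurable_le0.
rewrite (_ : [set w | _] = pst (m + 1) @^-1` B); last first.
  by apply/seteqP; split=> w; rewrite /B /= (pastS X (m + 1)) addrK.
rewrite (past_lawE mX stX (m + 1) mB) -[LHS]/(mu B) -(setIT B) -integral_indic//.
have mIB : measurable_fun setT (fun y : S => (\1_B y)%:E : \bar R).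
  by apply/measurable_EFinP; exact: measurable_indic.
rewrite (stationary_law mX stX regX mIB) => [|y]; last by rewrite lee_fin.
rewrite big1// => a _; rewrite integral0_eq// => x _.
rewrite indicE; case: (boolP (_ \in B)); last by rewrite mule0.
rewrite inE /B /= => h; have [p0 _] := pp x.
have -> : p x a = 0 by apply/eqP; rewrite eq_le h p0.
by rewrite mul0e.
Qed.
End JointLaw.

(** * Chains driven by the innovations *)

Section StrongSolution.
Context {R : realType} {d : measure_display} {T : measurableType d}
  (P : probability T R) {A : finType} (a0 : A).
Variable X : int -> T -> A.
Hypothesis mX : forall n a, measurable (X n @^-1` [set a]).
Hypothesis stX : stationary P X.
Variable p : (nat -> A) -> A -> R.
Hypothesis regX : regular_version P X p.
Local Notation S := (past_space a0).
Local Notation mu := (@past_law R d T P A a0 X mX).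
Local Notation T' := (T * R)%type.
Local Notation P' := (P \x unif R)%E.
Local Notation pp := (regular_prob_vec regX).
Local Notation U := (innovation X p).
Local Notation history := (@history R d T A a0 X).
Local Notation next := (@next R A a0 p).
Local Notation moveK := (@moveK R A a0 p).

Definition coupled (m : int) : set T' :=
  [set t | past X (m + 1) t.1 = next (past X m t.1, U (m + 1) t)].

(** [coupling] inverts [resample] unless the new letter has conditional probability 0 or the
    auxiliary variable leaves [[0, 1[]; both events are null. *)
Lemma ae_coupled m : {ae P', forall t, coupled m t}.
Proof.
have mE1 : measurable [set w | p (past X m w) (X (m + 1) w) <= 0].
  rewrite -[X in measurable X]setTI.
  apply: (@measurable_fun_ler _ _ _ setT (fun w => p (past X m w) (X (m + 1) w)) (fun=> 0)) => //.
  rewrite (_ : (fun w => _) = (fun w => \sum_a \1_(X (m + 1) @^-1` [set a]) w * p (past X m w) a)).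
    apply: measurable_sum => a; apply: measurable_funM; first exact: measurable_indic.
    exact: (measurableT_comp (measurable_transition (a0 := a0) regX a) (measurable_past mX m)).
  apply/funext => w; rewrite (bigD1 (X (m + 1) w))//= big1 => [|a ab].
    by rewrite indicE mem_set// mul1r addr0.
  by rewrite indicE memNset ?mul0r//= => e; rewrite e eqxx in ab.
pose E1 := [set w | p (past X m w) (X (m + 1) w) <= 0].
pose E2 := [set w : R | ~~ (0 <= aux (m + 1) w < 1)].
have mE2 : measurable E2.
  rewrite (_ : E2 = aux (m + 1) @^-1` (~` `[0, 1[%classic)).
    by apply: (measurable_preimage (measurable_aux (m + 1))); exact: measurableC.
  by apply/seteqP; split=> w; rewrite /E2 /= in_itv /= => /negP.
exists ((E1 `*` setT) `|` (setT `*` E2)); split.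
- by apply: measurableU; exact: measurableX.
- apply/eqP; rewrite eq_le measure_ge0 andbT.
  apply: le_trans (measureU2 _ _ _) _; [exact: measurableX|exact: measurableX|].
  have e1 : P E1 = 0%E := transition_last_pos a0 mX stX regX m.
  have e2 : unif R E2 = 0%E := aux_unit (m + 1).
  have z1 : P' (E1 `*` setT) = 0%E.
    by transitivity (P E1 * unif R setT)%E; [exact: product_measure1E|rewrite e1 mul0e].
  have z2 : P' (setT `*` E2) = 0%E.
    by transitivity (P setT * unif R E2)%E; [exact: product_measure1E|rewrite e2 mule0].
  rewrite -[leRHS]adde0 -[X in (_ <= X + _)%E]z1 -[X in (_ <= _ + X)%E]z2; exact: lexx.
move=> t /= H; have [w1|w1] := boolP (0 <= aux (m + 1) t.2 < 1); last by right; split.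
left; split => //=; rewrite /E1 /= leNgt; apply/negP => pos; apply: H.
rewrite /coupled /= (pastS X (m + 1)) addrK /next /=; congr (pcons _ _).
rewrite /innovation addrK; apply/esym; apply: coupling_resample => //; exact: pp.
Qed.

Lemma integral_next2 (g : S * S -> R) (z : S * S) : (forall z, 0 <= g z) ->
  (\int[unif R]_u (g (next (z.1, u), next (z.2, u)))%:E = (moveK g z)%:E)%E.
Proof.
move=> g0; rewrite /next /=.
rewrite (integral_coupling2 z (h := fun a b => (g (pcons a z.1 : S, pcons b z.2 : S))%:E) pp).
  rewrite /moveK /pair_op -sumEFin; apply: eq_bigr => a _.
  by rewrite -sumEFin; apply: eq_bigr => b _; rewrite EFinM.
by move=> a b; rewrite lee_fin.
Qed.

Lemma measurable_next_at d' (Z : measurableType d') (f : Z -> S) (u : Z -> R) :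
  measurable_fun setT f -> measurable_fun setT u ->
  measurable_fun setT (fun z => next (f z, u z)).
Proof.
move=> mf mu; apply: (measurableT_comp (measurable_next (a0 := a0) regX) (g := fun z => (f z, u z))).
exact/measurable_fun_pairP.
Qed.

(** The same [U (m + 1)] moves the true past, by [ae_coupled], and any past [Y] known at time [m];
    integrating it out yields the kernel of the chain on pairs. *)
Lemma integral_step m (Y : history m -> S) (g : S * S -> R) :
  measurable_fun setT Y -> measurable_fun setT g -> (forall z, 0 <= g z) ->
  (\int[P']_t (g (past X (m + 1) t.1 : S, next (Y t, U (m + 1) t)))%:E =
   \int[P']_t (moveK g (past X m t.1 : S, Y t))%:E)%E.
Proof.
move=> mY mg g0.
pose Psi (z : (S * S) * R) : \bar R := (g (next (z.1.1, z.2), next (z.1.2, z.2)))%:E.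
have mPsi : measurable_fun setT Psi.
  apply/measurable_EFinP.
  pose G (z : (S * S) * R) : S * S := (next (z.1.1, z.2), next (z.1.2, z.2)).
  have mG : measurable_fun setT G.
    apply/(@measurable_fun_pairP _ _ _ ((S * S) * R)%type S S); split.
      apply: (@measurable_next_at _ ((S * S) * R)%type) measurable_snd.
      exact: (measurableT_comp measurable_fst measurable_fst).
    apply: (@measurable_next_at _ ((S * S) * R)%type) measurable_snd.
    exact: (measurableT_comp measurable_snd measurable_fst).
  exact: (measurableT_comp mg mG).
pose xi (t : history m) : S * S := (past X m t.1 : S, Y t).
have mxi : measurable_fun setT xi.
  by apply/measurable_fun_pairP; split; [exact: measurable_history_past|].
have mY' := history_measurable_fun mX mY.
have mU := measurable_innovation a0 mX regX (m + 1).
have mp1 : measurable_fun setT (fun t : T' => past X (m + 1) t.1 : S).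
  exact: (measurableT_comp (measurable_past mX (m + 1)) measurable_fst).
transitivity (\int[P']_t Psi (xi t, U (m + 1) t))%E.
  apply: ae_eq_integral => //.
  - apply/measurable_EFinP; apply: (measurableT_comp mg); apply/measurable_fun_pairP; split => //.
    exact: measurable_next_at.
  - apply: (measurableT_comp mPsi); apply/measurable_fun_pairP; split => //.
    exact: (history_measurable_fun mX mxi).
  have := ae_coupled m; apply: filterS => t; rewrite /coupled /= => e _.
  by rewrite /Psi /= e.
rewrite (integral_history_innovation mX stX regX mxi mPsi)//.
  by apply: eq_integral => t _; rewrite /Psi integral_next2.
by move=> z; rewrite lee_fin.
Qed.

Variables (m0 : int) (y : S).

Fixpoint driven (k : nat) (t : T') : S :=
  if k is k'.+1 then next (driven k' t, U (m0 + k%:Z) t) else y.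

Lemma measurable_driven d' (Z : measurableType d') (h : Z -> T') k m :
  (forall j, j <= m -> measurable_fun setT (fun z => U j (h z))) -> m0 + k%:Z <= m ->
  measurable_fun setT (fun z => driven k (h z)).
Proof.
move=> mU; elim: k => [|k IH] km /=; first exact: measurable_cst.
apply: measurable_next_at.
  by apply: IH; rewrite (le_trans _ km)// lerD2l lez_nat.
exact: mU.
Qed.

Lemma measurable_history_driven k m : m0 + k%:Z <= m ->
  measurable_fun setT (driven k : history m -> S).
Proof.
move=> km; apply: (@measurable_driven _ (history m) (fun t => t) k m _ km) => j.
exact: (measurable_history_innovation regX).
Qed.

(** The true past and the driven one form the chain on pairs started from [(x, y)], where [x] has
    law [mu]. The induction removes the last step and replaces [g] by [moveK g]. *)
Lemma integral_driven k (g : S * S -> R) : measurable_fun setT g -> (forall z, 0 <= g z) ->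
  (\int[P']_t (g (past X (m0 + k%:Z) t.1 : S, driven k t))%:E =
   \int[mu]_x (iter k moveK g (x, y))%:E)%E.
Proof.
elim: k g => [|k IH] g mg g0.
  rewrite addr0 /=.
  have mgy : measurable_fun setT (fun x : S => (g (x, y))%:E).
    by apply/measurable_EFinP; exact: (measurableT_comp mg (pair2_measurable y)).
  rewrite -(integral_past mX stX m0 mgy); last by move=> x; rewrite lee_fin.
  rewrite -(integral_P'_fst P (f := fun w => (g (past X m0 w : S, y))%:E))//.
    exact: (measurableT_comp mgy (measurable_past mX m0)).
  by move=> x; rewrite lee_fin.
have mK : measurable_fun setT (moveK g).
  exact: (measurable_iter_move pp (measurable_transition regX) 1 mg).
have K0 z : 0 <= moveK g z by apply: pair_op_ge0 => // *; exact: joint_law_ge0.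
have := integral_step (@measurable_history_driven k (m0 + k%:Z) (lexx _)) mg g0.
rewrite IH// -addrA -PoszD addn1 => H.
by rewrite iterSr -H.
Qed.
End StrongSolution.

(** * Completed sigma-algebras and conditional independence *)

Section Completion.
Context {R : realType} {d : measure_display} {T : measurableType d} (P : probability T R).
Variable H : set (set T).
Hypothesis sH : sigma_algebra setT H.
Hypothesis mH : H `<=` @measurable _ T.
Local Notation sdiff C B := ((C `\` B) `|` (B `\` C)).

Lemma sigma_algebra_memE (B : set T) : @measurable _ (g_sigma_algebraType H) B = H B.
Proof. by rewrite -[LHS]/(<<s H >> B) sigma_algebra_id. Qed.

Lemma measurable_sdiff (B C : set T) : measurable B -> measurable C -> measurable (sdiff B C).
Proof. by move=> mB mC; apply: measurableU; exact: measurableD. Qed.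

Lemma sdiff_triangle (B C D : set T) : measurable B -> measurable C -> measurable D ->
  (P (sdiff B D) <= P (sdiff B C) + P (sdiff C D))%E.
Proof.
move=> mB mC mD.
have m1 := measurable_sdiff mB mC; have m2 := measurable_sdiff mC mD.
apply: le_trans (measureU2 P m1 m2); apply: le_measure_sub.
- exact: measurable_sdiff.
- exact: measurableU.
by move=> w; have [?|?] := pselect (C w); rewrite /=; tauto.
Qed.

Lemma sub_completion : H `<=` completion P H.
Proof.
move=> B hB; split; first exact: mH.
by exists B; split => //; rewrite setDv setU0 measure0.
Qed.

(** Borel-Cantelli: with approximations in [H] of errors at most [2 ^- k.+1], which are summable,
    their upper limit is in [H] and differs from [B] by a null set. *)
Lemma completion_approx (B : set T) : measurable B ->
  (forall e : R, 0 < e -> exists C, H C /\ (P (sdiff C B) <= e%:E)%E) -> completion P H B.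
Proof.
move=> mB approx; split => //.
have e0 k : 0 < 1 / (2 ^ k.+1)%:R :> R by rewrite divr_gt0// ltr0n expn_gt0.
pose C k := sval (cid (approx _ (e0 k))).
have HC k : H (C k) by rewrite /C; case: cid => ? [].
have PC k : (P (sdiff (C k) B) <= (1 / (2 ^ k.+1)%:R)%:E)%E by rewrite /C; case: cid => ? [].
have mC k : measurable (C k) by exact: mH.
exists (lim_sup_set C); split.
  rewrite -sigma_algebra_memE; apply: bigcap_measurable => // n _.
  by apply: bigcup_measurable => j _; rewrite sigma_algebra_memE.
have mD k : measurable (sdiff (C k) B) by exact: measurable_sdiff.
have mL (F : nat -> set T) : (forall k, measurable (F k)) -> measurable (lim_sup_set F).
  by move=> mF; apply: bigcap_measurable => // n _; apply: bigcup_measurable.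
apply/eqP; rewrite eq_le measure_ge0 andbT.
have <- : P (lim_sup_set (fun k => sdiff (C k) B)) = 0%E.
  apply: lim_sup_set_cvg0 => //; apply: (@le_lt_trans _ _ 1%:E); last exact: ltry.
  apply: le_trans (epsilon_trick0 xpredT (ler01 : 0 <= 1 :> R)).
  apply: lee_nneseries => k; [move=> *; exact: measure_ge0|move=> *; exact: PC].
apply: le_measure_sub; [by apply: measurable_sdiff => //; exact: mL|exact: mL|].
move=> w [[h nB] n _|[hB /existsNP[n /not_implyP[_ h]]] m _].
  by have [j nj Cj] := h n I; exists j => //; left.
exists (maxn n m); first exact: leq_maxr.
by right; split => // Cw; apply: h; exists (maxn n m) => //=; exact: leq_maxl.
Qed.

Lemma sigma_algebra_completion : sigma_algebra setT (completion P H).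
Proof.
split.
- by apply: sub_completion; case: sH.
- move=> B [mB [C [hC PC]]]; rewrite setTD; split; first exact: measurableC.
  exists (~` C); split; first by rewrite -setTD; case: sH => _ h _; exact: h.
  rewrite -[RHS]PC; congr (P _); apply/seteqP; split=> w /=.
    by case=> -[? /contrapT ?]; [right|left].
  by case=> -[? ?]; [right|left]; split=> //; apply.
- move=> B hB; have mB k : measurable (B k) by case: (hB k).
  have hC k : exists C, H C /\ P (sdiff C (B k)) = 0%E by case: (hB k).
  pose C k := sval (cid (hC k)).
  have HC k : H (C k) by rewrite /C; case: cid => ? [].
  have PC k : P (sdiff (C k) (B k)) = 0%E by rewrite /C; case: cid => ? [].
  split; first exact: bigcup_measurable.
  exists (\bigcup_k C k); split; first by case: sH => _ _; apply.
  have mC k : measurable (C k) by exact: mH.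
  have mD k : measurable (sdiff (C k) (B k)) by exact: measurable_sdiff.
  apply/eqP; rewrite eq_le measure_ge0 andbT.
  have <- : P (\bigcup_k sdiff (C k) (B k)) = 0%E.
    apply: measure_negligible; first exact: bigcup_measurable.
    by apply: negligible_bigcup => k; apply/negligibleP => //; exact: PC.
  apply: le_measure_sub.
  + by apply: measurable_sdiff; exact: bigcup_measurable.
  + exact: bigcup_measurable.
  move=> w [[[k _ Ck] nB]|[[k _ Bk] nC]]; exists k => //.
    by left; split => // Bk; apply: nB; exists k.
  by right; split => // Ck; apply: nC; exists k.
Qed.

Lemma completion_sub (F : set (set T)) : F `<=` completion P H ->
  completion P F `<=` completion P H.
Proof.
move=> FH B [mB [C [/FH[mC [D [hD PD]]] PC]]]; apply: completion_approx => // e e0.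
exists D; split => //; apply: le_trans (sdiff_triangle (mH hD) mC mB) _.
by rewrite PD PC adde0 lee_fin ltW.
Qed.

Lemma completion_gen (G : set (set T)) : G `<=` completion P H ->
  completion P <<s G >> `<=` completion P H.
Proof.
by move=> GH; apply: completion_sub; apply: smallest_sub => //; exact: sigma_algebra_completion.
Qed.

Lemma completion_measurable : completion P H `<=` @measurable _ T.
Proof. by move=> B []. Qed.
End Completion.

Section ConditionalProbability.
Context {R : realType} {d : measure_display} {T : measurableType d} (P : probability T R).
Variable H : set (set T).
Hypothesis sH : sigma_algebra setT H.
Hypothesis mH : H `<=` @measurable _ T.

Definition adapted (h : T -> R) := forall B : set R, measurable B -> H (h @^-1` B).

Lemma adaptedE (h : T -> R) :
  adapted h <-> measurable_fun setT (h : g_sigma_algebraType H -> R).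
Proof.
split=> hh; first by move=> _ B mB; rewrite setTI (sigma_algebra_memE sH); exact: hh.
by move=> B mB; rewrite -(sigma_algebra_memE sH) -[X in measurable X]setTI; exact: hh.
Qed.

Lemma adapted_measurable h : adapted h -> measurable_fun setT h.
Proof. by move=> hh _ B mB; rewrite setTI; apply: mH; exact: hh. Qed.

Lemma adapted_cst c : adapted (fun=> c).
Proof. by apply/adaptedE; exact: measurable_cst. Qed.

Lemma adapted_lt h h' : adapted h -> adapted h' -> H [set w | h w < h' w].
Proof.
move=> /adaptedE mh /adaptedE mh'; rewrite -(sigma_algebra_memE sH) -[X in measurable X]setTI.
have mY : measurable [set true] by [].
exact: (measurable_fun_ltr mh mh' measurableT mY).
Qed.

(** The set where [h < 0] is itself in [H], so the hypothesis can be tested on it. *)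
Lemma adapted_ae_ge0 h : adapted h -> P.-integrable setT (EFin \o h) ->
  (forall C, H C -> (0 <= \int[P]_(w in C) (h w)%:E)%E) -> {ae P, forall w, 0 <= h w}.
Proof.
move=> ah ih hC; have mh := adapted_measurable ah.
have HN : H [set w | h w < 0].
  exact: (adapted_lt ah (adapted_cst 0)).
have mN := mH HN.
have mg : measurable_fun setT (fun w => (Num.max (- h w) 0)%:E : \bar R).
  by apply/measurable_EFinP; apply: measurable_maxr => //; exact: measurableT_comp.
have : (\int[P]_w (Num.max (- h w) 0)%:E = 0)%E.
  apply/eqP; rewrite eq_le integral_ge0 ?andbT; last by move=> w _; rewrite lee_fin le_max lexx orbT.
  have := hC _ HN; rewrite -[X in (X <= _)%E]oppe0 leeNl; apply: le_trans.
  rewrite -integralN; last by apply: integrable_add_def => //; exact: integrableS ih.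
  rewrite integral_mkcond; under eq_integral => w _.
    rewrite (_ : _ w = (Num.max (- h w) 0)%:E); first over.
    rewrite patchE; case: ifPn; rewrite ?inE ?notin_setE /= => hw.
      by rewrite max_l// oppr_ge0 ltW.
    by rewrite max_r// oppr_le0 leNgt; apply/negP.
  exact: lexx.
move=> /(ge0_integral0_null mg) h0.
exists [set w | 0 < (Num.max (- h w) 0)%:E]%E; split.
- rewrite -[X in measurable X]setTI; exact: emeasurable_fun_o_infty.
- by apply: h0 => w; rewrite lee_fin le_max lexx orbT.
- by move=> w /negP; rewrite -ltNge /= lte_fin lt_max oppr_gt0 => ->.
Qed.

Lemma adapted_ae_eq h h' : adapted h -> adapted h' ->
  P.-integrable setT (EFin \o h) -> P.-integrable setT (EFin \o h') ->
  (forall C, H C -> (\int[P]_(w in C) (h w)%:E = \int[P]_(w in C) (h' w)%:E)%E) ->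
  {ae P, forall w, h w = h' w}.
Proof.
have half (f g : T -> R) : adapted f -> adapted g ->
    P.-integrable setT (EFin \o f) -> P.-integrable setT (EFin \o g) ->
    (forall C, H C -> (\int[P]_(w in C) (f w)%:E = \int[P]_(w in C) (g w)%:E)%E) ->
    {ae P, forall w, 0 <= f w - g w}.
  move=> af ag If Ig E; apply: adapted_ae_ge0.
  - apply/adaptedE; apply: measurable_funB; exact/adaptedE.
  - exact: (integrableB measurableT If Ig).
  move=> C hC; have mC := mH hC.
  have IfC : P.-integrable C (EFin \o f) by exact: integrableS If.
  have IgC : P.-integrable C (EFin \o g) by exact: integrableS Ig.
  under eq_integral do rewrite EFinB.
  rewrite (integralB_EFin mC IfC IgC) E// subee//; exact: integrable_fin_num.
move=> ah ah' Ih Ih' E.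
have := half _ _ ah ah' Ih Ih' E; have /= := half _ _ ah' ah Ih' Ih (fun C hC => esym (E C hC)).
by apply: filterS2 => w; rewrite !subr_ge0 => h1 h2; apply/eqP; rewrite eq_le h1 h2.
Qed.

(* Layer-cake formula; it reduces the pull-out property of conditional
   expectations to the sets [[set w | u < g w]]. *)
Lemma integral_levels (f : T -> \bar R) (g : T -> R) :
  measurable_fun setT f -> (forall w, 0 <= f w)%E ->
  measurable_fun setT g -> (forall w, 0 <= g w <= 1) ->
  (\int[P]_w (f w * (g w)%:E) =
   \int[unif R]_u \int[P]_(w in [set w | (u < g w)%R]) f w)%E.
Proof.
move=> mf f0 mg g01.
pose L : set (T * R) := [set z | z.2 < g z.1].
have mL : measurable L.
  rewrite -[X in measurable X]setTI.
  have mY : measurable [set true] by [].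
  have := @measurable_fun_ltr _ _ R (@setT (T * R)) (fun z => z.2) (fun z => g z.1)
    measurable_snd (measurableT_comp mg measurable_fst) measurableT _ mY.
  exact.
pose F (z : T * R) : \bar R := (f z.1 * (\1_L z)%:E)%E.
have mF : measurable_fun setT F.
  apply: emeasurable_funM; first exact: (measurableT_comp mf measurable_fst).
  by apply/measurable_EFinP; exact: measurable_indic.
have F0 z : (0 <= F z)%E by rewrite mule_ge0// lee_fin.
transitivity (\int[P]_w \int[unif R]_u F (w, u))%E.
  apply: eq_integral => w _; have /andP[g0 g1] := g01 w.
  have mxL : measurable [set u : R | u < g w].
    rewrite (_ : [set u | _] = `]-oo, g w[%classic); first exact: measurable_itv.
    by apply/seteqP; split=> u /=; rewrite in_itv.
  transitivity (f w * \int[unif R]_u (\1_[set u : R | u < g w] u)%:E)%E.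
    congr (_ * _)%E; rewrite integral_indic// setIT.
    transitivity (unif R `[0, g w[%classic); first by rewrite unif_itv// subr0.
    by apply: eq_unif => u /andP[u0 _] /=; rewrite in_itv/= u0.
  rewrite -ge0_integralZl//; last exact/measurable_EFinP/measurable_indic.
rewrite (fubini_tonelli (m1 := P) (m2 := unif R) F mF F0).
apply: eq_integral => u _; rewrite [RHS]integral_mkcond; apply: eq_integral => w _.
rewrite patchE /F indicE; have [uw|uw] := boolP (u < g w).
  by rewrite !mem_set// mule1.
by rewrite !memNset ?mule0//=; exact/negP.
Qed.
End ConditionalProbability.

Section ConditionalIndependence.
Context {R : realType} {d : measure_display} {T : measurableType d} (P : probability T R).
Variable H : set (set T).
Hypothesis sH : sigma_algebra setT H.
Hypothesis mH : H `<=` @measurable _ T.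

Lemma integral_setD_indic (D : set T) (g : T -> R) : measurable D ->
  (\int[P]_(w in D) (g w)%:E = \int[P]_w ((\1_D w)%:E * (g w)%:E))%E.
Proof.
move=> mD; rewrite integral_mkcond; apply: eq_integral => w _.
by rewrite patchE indicE; case: ifPn => wD; rewrite ?mul1e ?mul0e.
Qed.

Lemma adapted_setI (C D : set T) : H C -> H D -> H (C `&` D).
Proof.
by rewrite -!(sigma_algebra_memE sH) => hC hD; exact: measurableI.
Qed.

(* It suffices to disintegrate [F1] given [F2] by an [H]-measurable kernel:
   then [g] is the conditional probability of [E1] given both [H] and [F2]. *)
Lemma cond_indep_kernel (F1 F2 : set (set T)) :
  F2 `<=` @measurable _ T -> H `<=` F2 ->
  (forall D C, F2 D -> H C -> F2 (D `&` C)) ->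
  (forall E, F1 E -> exists g : T -> R, [/\ adapted H g, forall w, 0 <= g w <= 1 &
     forall D, F2 D -> (P (E `&` D) = \int[P]_(w in D) (g w)%:E)%E]) ->
  cond_indep P F1 F2 H.
Proof.
move=> mF2 HF2 F2I ker E1 E2 h1 h2 h12 /ker[g [ag g01 gD]] F2E2.
move=> [a1 [i1 c1]] [a2 [i2 c2]] [a12 [i12 c12]].
have mE2 := mF2 _ F2E2.
have mg := adapted_measurable mH ag; have mh2 := adapted_measurable mH a2.
have ig : P.-integrable setT (EFin \o g).
  apply: (le_integrable measurableT (g := cst 1%E)).
  - exact/measurable_EFinP.
  - move=> w _; have /andP[g0 g1] := g01 w.
    by rewrite /= lee_fin normr1 ger0_norm.
  - by apply: finite_measure_integrable_cst.
have h1g : {ae P, forall w, h1 w = g w}.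
  apply: (adapted_ae_eq sH mH) => // C hC; rewrite c1// gD//; exact: HF2.
have h2pos : {ae P, forall w, 0 <= h2 w}.
  by apply: (adapted_ae_ge0 sH mH) => // C hC; rewrite c2.
(* [integral_levels] asks for functions that are nonnegative everywhere, whereas [h2] is so only
   almost surely. *)
pose k w := Num.max (h2 w) 0.
have k0 w : 0 <= k w by rewrite /k le_max lexx orbT.
have ak : adapted H k.
  apply/(adaptedE sH); apply: measurable_maxr; first exact/(adaptedE sH).
  exact: measurable_cst.
have mk := adapted_measurable mH ak.
have kC C : H C -> (\int[P]_(w in C) (k w)%:E = P (E2 `&` C))%E.
  move=> hC; rewrite -c2//; apply: ae_eq_integral.
  - exact: mH.
  - by apply/measurable_EFinP; exact: measurable_funTS.
  - by apply/measurable_EFinP; exact: measurable_funTS.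
  - by apply: filterS h2pos => w h _; rewrite /k max_l.
have h12gk : {ae P, forall w, h12 w = g w * k w}.
  apply: (adapted_ae_eq sH mH) => //.
  - by apply/(adaptedE sH); apply: measurable_funM; exact/(adaptedE sH).
  - apply: (le_integrable measurableT _ _ i2).
      by apply/measurable_EFinP; exact: measurable_funM.
    move=> w _ /=; have /andP[g0 g1] := g01 w; rewrite lee_fin normrM.
    apply: (@le_trans _ _ (1 * `|k w|)); first by rewrite ler_wpM2r// ger0_norm.
    rewrite mul1r (ger0_norm (k0 w)) /k ge_max ler_norm normr_ge0//.
  move=> C hC; rewrite c12// -setIA gD; last exact: F2I.
  have mC := mH hC; have mEC : measurable (E2 `&` C) by exact: measurableI.
  rewrite (integral_setD_indic g mEC) [RHS](integral_setD_indic _ mC).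
  have f1 w : (0 <= (\1_(E2 `&` C) w)%:E :> \bar R)%E by rewrite lee_fin.
  have mf1 : measurable_fun setT (fun w => (\1_(E2 `&` C) w)%:E : \bar R).
    by apply/measurable_EFinP; exact: measurable_indic.
  have f2 w : (0 <= (\1_C w)%:E * (k w)%:E :> \bar R)%E by rewrite mule_ge0// lee_fin.
  have mf2 : measurable_fun setT (fun w => (\1_C w)%:E * (k w)%:E : \bar R)%E.
    by apply: emeasurable_funM; apply/measurable_EFinP => //; exact: measurable_indic.
  (* Both sides become integrals over the levels [u] of [g]. At each level, the part of [C] where
     [u < g w] is in [H], so [kC] identifies the two integrands. *)
  rewrite (integral_levels P mf1 f1 mg g01).
  under [RHS]eq_integral => w _ do rewrite EFinM [X in (_ * X)%E]muleC muleA.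
  rewrite [RHS](integral_levels P mf2 f2 mg g01).
  apply: eq_integral => u _.
  have hu : H [set w | u < g w].
    exact: (adapted_lt sH (adapted_cst sH u) ag).
  have mu := mH hu.
  transitivity (P (E2 `&` (C `&` [set w | u < g w]))).
    by rewrite integral_indic// setIA.
  rewrite -kC; last exact: adapted_setI.
  rewrite [LHS]integral_mkcond [RHS]integral_mkcond; apply: eq_integral => w _.
  by rewrite !patchE indicE in_setI; case: (w \in C); case: (w \in _); rewrite ?mul1e ?mul0e.
near=> w.
have -> : h12 w = g w * k w by near: w.
have -> : h1 w = g w by near: w.
have h20 : 0 <= h2 w by near: w.
by rewrite /k max_l.
Unshelve. all: by end_near.
Qed.
End ConditionalIndependence.

(** * The innovations are independent and uniform *)

Section IndependentInnovations.
Context {R : realType} {d : measure_display} {T : measurableType d}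
  (P : probability T R) {A : finType} (a0 : A).
Variable X : int -> T -> A.
Hypothesis mX : forall n a, measurable (X n @^-1` [set a]).
Hypothesis stX : stationary P X.
Variable p : (nat -> A) -> A -> R.
Hypothesis regX : regular_version P X p.
Local Notation T' := (T * R)%type.
Local Notation P' := (P \x unif R)%E.
Local Notation U := (innovation X p).
Local Notation rect := (@rect R d T A a0 X).

Lemma innovation_preimage_history m k (B : set R) : k <= m -> measurable B ->
  <<s rect m >> (U k @^-1` B).
Proof.
move=> km mB; have mU := measurable_history_innovation (a0 := a0) regX km.
have := mU measurableT B mB.
by rewrite setTI.
Qed.

Lemma innovation_law k (B : set R) : measurable B -> P' (U k @^-1` B) = unif R B.
Proof.
move=> mB; have h : <<s rect (k - 1) >> setT by exact: sigma_algebra_setT.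
have := innovation_indep mX stX regX h mB; rewrite subrK setTI => ->.
transitivity (1 * unif R B)%E; last by rewrite mul1e.
by congr (_ * _)%E; exact: (probability_setT (P' : probability T' R)).
Qed.

Lemma history_bigI m (s : seq int) (B : int -> set R) : (forall i, measurable (B i)) ->
  all (fun i => i <= m) s -> <<s rect m >> (\big[setI/setT]_(i <- s) (U i @^-1` B i)).
Proof.
move=> mB; elim: s => [_|x s IH /= /andP[xm sm]].
  by rewrite big_nil; exact: sigma_algebra_setT.
rewrite big_cons; apply: sigma_algebra_setI; last exact: IH.
exact: innovation_preimage_history.
Qed.

(** With the times in decreasing order, the head is the latest one, and the other events belong to
    the history just before it; [innovation_indep] removes it. *)
Lemma innovation_prod_sorted (s : seq int) (B : int -> set R) :
  (forall i, measurable (B i)) -> sorted (fun x y => y < x) s ->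
  P' (\big[setI/setT]_(i <- s) (U i @^-1` B i)) = (\prod_(i <- s) P' (U i @^-1` B i))%E.
Proof.
move=> mB; elim: s => [_|x s IH /= xs].
  by rewrite !big_nil; exact: (probability_setT (P' : probability T' R)).
rewrite !big_cons -IH; last exact: path_sorted xs.
have hs : <<s rect (x - 1) >> (\big[setI/setT]_(i <- s) (U i @^-1` B i)).
  apply: history_bigI => //; apply/allP => i si.
  have /allP/(_ i si) : all (fun y => y < x) s.
    by apply: order_path_min xs => u v w uv vw; exact: lt_trans vw uv.
  by rewrite -ltzD1 subrK.
have := innovation_indep mX stX regX hs (mB x); rewrite subrK setIC => ->.
by rewrite muleC innovation_law.
Qed.

Lemma iid_innovation : iid P' U.
Proof.
split; first by move=> n; exact: (measurable_innovation a0 mX regX).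
split=> [s B us mB|n B mB]; last first.
  transitivity (unif R B); first exact: innovation_law.
  by apply/esym; exact: innovation_law.
have ps : perm_eq s (rev (sort <=%O s)) by rewrite perm_sym perm_rev perm_sort.
rewrite (perm_big _ ps) [in RHS](perm_big _ ps); apply: innovation_prod_sorted => //.
by rewrite rev_sorted sort_lt_sorted.
Qed.
End IndependentInnovations.

(** * Immersion *)

Section Immersion.
Context {R : realType} {d : measure_display} {T : measurableType d}
  (P : probability T R) {A : finType} (a0 : A).
Variable X : int -> T -> A.
Hypothesis mX : forall n a, measurable (X n @^-1` [set a]).
Hypothesis stX : stationary P X.
Variable p : (nat -> A) -> A -> R.
Hypothesis regX : regular_version P X p.
Local Notation S := (past_space a0).
Local Notation T' := (T * R)%type.
Local Notation P' := ((P \x unif R)%E : probability T' R).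
Local Notation pp := (regular_prob_vec regX).
Local Notation U := (innovation X p).
Local Notation history := (@history R d T A a0 X).
Local Notation rect := (@rect R d T A a0 X).
Local Notation next := (@next R A a0 p).

Definition past_letters (n : int) : set (set T') :=
  [set E | exists k a, (k <= n)%R /\ E = (X k \o fst) @^-1` [set a]].

Definition past_noises (n : int) : set (set T') :=
  [set E | exists k (B : set R), (k <= n)%R /\ measurable B /\ E = U k @^-1` B].

Lemma sigma_letters_history n : <<s past_letters n >> `<=` <<s rect n >>.
Proof.
apply: smallest_sub; first exact: smallest_sigma_algebra.
by move=> _ [k [a [kn ->]]]; exact: history_X.
Qed.

Lemma sigma_noises_history n : <<s past_noises n >> `<=` <<s rect n >>.
Proof.
apply: smallest_sub; first exact: smallest_sigma_algebra.
by move=> _ [k [B [kn [mB ->]]]]; exact: (innovation_preimage_history (a0 := a0) regX).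
Qed.

Lemma sigma_letters_measurable n : <<s past_letters n >> `<=` @measurable _ T'.
Proof. by move=> E /(@sigma_letters_history n); exact: history_sub. Qed.

Lemma sigma_noises_measurable n : <<s past_noises n >> `<=` @measurable _ T'.
Proof. by move=> E /(@sigma_noises_history n); exact: history_sub. Qed.

Lemma sigma_letters_past n E : <<s past_letters n >> E ->
  exists C : set S, measurable C /\ E = [set t | C (past X n t.1)].
Proof.
pose f (t : T') : S := past X n t.1.
suff h : <<s past_letters n >> `<=` preimage_set_system setT f measurable.
  by move=> /h[C mC <-]; exists C; split => //; rewrite setTI.
apply: smallest_sub.
  by apply: sigma_algebra_preimage; exact: sigma_algebra_measurable.
move=> _ [k [a [kn ->]]]; exists [set x : S | x `|n - k|%N = a]; first exact: measurable_coord.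
rewrite setTI /f; have e : n - (`|n - k|%N)%:Z = k by rewrite gez0_abs ?subr_ge0//; ring.
by apply/seteqP; split=> t; rewrite /= /past e.
Qed.

Lemma letters_past n :
  measurable_fun setT (fun t : g_sigma_algebraType (past_letters n) => past X n t.1 : S).
Proof.
apply: measurable_fun_past => k a; apply: sub_sigma_algebra.
by exists (n - k%:Z), a; split; first by rewrite gerBl.
Qed.

Lemma sdiff0_indic (B C : set T') : measurable B -> measurable C ->
  P' ((B `\` C) `|` (C `\` B)) = 0%E -> {ae P', forall t, \1_B t = \1_C t :> R}.
Proof.
move=> mB mC BC; exists ((B `\` C) `|` (C `\` B)); split => //; first exact: measurable_sdiff.
move=> t /= h; have [tB|tB] := pselect (B t); have [tC|tC] := pselect (C t).
- by exfalso; apply: h; rewrite !indicE !mem_set.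
- by left.
- by right.
- by exfalso; apply: h; rewrite !indicE !memNset.
Qed.

(** The conditional probability that the next past lies in [C] when the current one is [x]; this is
    the kernel given to [cond_indep_kernel]. *)
Definition mean_next (C : set S) (x : S) : R := \sum_a p x a * \1_C (pcons a x).

Lemma mean_next_unit C x : 0 <= mean_next C x <= 1.
Proof.
have [p0 p1] := pp x; apply/andP; split.
  by apply: sumr_ge0 => a _; rewrite mulr_ge0.
rewrite -p1; apply: ler_sum => a _; rewrite ler_piMr// indicE; by case: (_ \in _).
Qed.

Lemma measurable_mean_next C : measurable C -> measurable_fun setT (mean_next C).
Proof.
move=> mC; apply: measurable_sum => a; apply: measurable_funM.
  exact: (measurable_transition (a0 := a0) regX).
have mI : measurable_fun setT (\1_C : S -> R) by exact: measurable_indic.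
exact: (measurableT_comp mI (@measurable_pcons A a0 a)).
Qed.

(** Conditioning on the full history gives the same kernel as conditioning on the past of [X], since
    the next past is almost surely a function of the current one and of an innovation independent of
    that history. *)
Lemma next_history n (C : set S) (D : set T') : measurable C -> <<s rect n >> D ->
  (P' ([set t | C (past X (n + 1) t.1)] `&` D) =
   \int[P']_t ((\1_D t)%:E * (mean_next C (past X n t.1))%:E))%E.
Proof.
move=> mC hD; have mD := history_sub mX hD.
have mnext := measurable_next (a0 := a0) regX.
have mC1 : measurable_fun setT (\1_C : S -> R) by exact: measurable_indic.
pose xi (t : history n) : S * R := (past X n t.1 : S, \1_D t).
have mxi : measurable_fun setT xi.
  apply/measurable_fun_pairP; split; first exact: measurable_history_past.
  exact: (@measurable_indic _ (history n) R setT D hD).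
(* The middle coordinate will be an indicator; the absolute value makes [Psi] nonnegative for all
   real values of it. *)
pose Psi (z : (S * R) * R) : \bar R := (`|z.1.2| * \1_C (next (z.1.1, z.2)))%:E.
have mPsi : measurable_fun setT Psi.
  apply/measurable_EFinP; apply: measurable_funM.
    apply: measurableT_comp => //.
    exact: (measurableT_comp measurable_snd measurable_fst).
  apply: (measurableT_comp mC1).
  apply: (@measurable_next_at _ _ _ P _ a0 _ _ regX _ ((S * R) * R)%type) measurable_snd.
  exact: (measurableT_comp measurable_fst measurable_fst).
have Psi0 z : (0 <= Psi z)%E by rewrite lee_fin mulr_ge0.
have mE : measurable ([set t : T' | C (past X (n + 1) t.1)] `&` D).
  apply: measurableI => //.
  exact: (measurable_preimage (measurableT_comp (measurable_past mX (n + 1)) measurable_fst) mC).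
rewrite -[in LHS](setIT (_ `&` D)) -integral_indic//.
transitivity (\int[P']_t Psi (xi t, U (n + 1) t))%E.
  apply: ae_eq_integral => //.
  - by apply/measurable_EFinP; exact: measurable_indic.
  - apply: (measurableT_comp mPsi); apply/measurable_fun_pairP; split.
      exact: (history_measurable_fun mX mxi).
    exact: (measurable_innovation a0 mX regX (n + 1)).
  have := ae_coupled a0 mX stX regX n; apply: filterS => t; rewrite /coupled /= => e _.
  rewrite /Psi /= -e !indicE in_setI ger0_norm// -natrM mulnb andbC.
  by congr (_%:R%:E); congr (nat_of_bool (_ && _)); apply/idP/idP; rewrite !inE.
rewrite (integral_history_innovation mX stX regX mxi mPsi Psi0).
apply: eq_integral => t _; rewrite /Psi /= ger0_norm//.
under eq_integral do rewrite EFinM.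
rewrite ge0_integralZl//; last first.
  apply/measurable_EFinP.
  exact: (measurableT_comp mC1 (measurableT_comp mnext (pair1_measurable (past X n t.1 : S)))).
congr (_ * _)%E.
rewrite (integral_coupling a0 (h := fun a => (\1_C (pcons a (past X n t.1)))%:E) (pp _)).
  by rewrite /mean_next -sumEFin; apply: eq_bigr => a _; rewrite EFinM.
by move=> a; rewrite lee_fin.
Qed.
End Immersion.

(** * The letters as functionals of the innovations, and standardness *)

Section Standardness.
Context {R : realType} {d : measure_display} {T : measurableType d}
  (P : probability T R) {A : finType} (a0 : A).
Variable X : int -> T -> A.
Hypothesis mX : forall n a, measurable (X n @^-1` [set a]).
Hypothesis stX : stationary P X.
Variable p : (nat -> A) -> A -> R.
Hypothesis regX : regular_version P X p.
Hypothesis posX : forall a : A, {ae P, forall w, 0 < p (past X (-1) w) a}.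
Hypothesis sum_eta : (\sum_(0 <= n <oo) eta_n P X p n < +oo)%E.
Local Notation S := (past_space a0).
Local Notation T' := (T * R)%type.
Local Notation P' := ((P \x unif R)%E : probability T' R).
Local Notation U := (innovation X p).
Local Notation rect := (@rect R d T A a0 X).
Local Notation neq_head := (@neq_head R A a0).
Local Notation past_letters := (@past_letters R d T A X).
Local Notation past_noises := (@past_noises R d T A X p).

Lemma letters_sub_noises n : past_letters n `<=` completion P' <<s past_noises n >>.
Proof.
move=> _ [k [a [kn ->]]].
have sN : sigma_algebra setT <<s past_noises n >> by exact: smallest_sigma_algebra.
have mN := sigma_noises_measurable a0 mX regX (n := n).
have mE : measurable ((X k \o fst : T' -> A) @^-1` [set a]).
  exact: (measurable_preimage measurable_fst (mX k a)).
apply: (completion_approx sN mN mE) => e e0.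
have [N [y small]] := process_coalescence a0 mX stX regX posX sum_eta e0.
pose m0 := k - N%:Z; have m0N : m0 + N%:Z = k by rewrite /m0 subrK.
pose D := driven X p m0 y N.
pose C : set T' := [set t | D t 0%N = a].
have hC : <<s past_noises n >> C.
  have mD : measurable_fun setT (D : g_sigma_algebraType (past_noises n) -> S).
    apply: (@measurable_driven _ _ _ P _ a0 _ _ regX _ _ _ (g_sigma_algebraType (past_noises n)) (fun t => t) N n).
      move=> j jn _ B mB; rewrite setTI; apply: sub_sigma_algebra; by exists j, B.
    by rewrite m0N.
  have := mD measurableT _ (@measurable_coord A a0 0%N a).
  by rewrite setTI.
exists C; split => //.
have mC := mN _ hC.
have mDT : measurable_fun setT (D : T' -> S).
  apply: (@measurable_driven _ _ _ P _ a0 _ _ regX _ _ _ T' (fun t => t) N k).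
    by move=> j _; exact: (measurable_innovation a0 mX regX j).
  by rewrite m0N.
have mp : measurable_fun setT (fun t : T' => past X k t.1 : S).
  exact: (measurableT_comp (measurable_past mX k) measurable_fst).
have mg : measurable_fun setT (fun t : T' => (neq_head (past X k t.1 : S, D t))%:E : \bar R).
  apply/measurable_EFinP; apply: (measurableT_comp (@measurable_neq_head R A a0)).
  exact/measurable_fun_pairP.
have n0 z : 0 <= neq_head z by rewrite ler0n.
apply: le_trans small.
have := integral_driven mX stX regX m0 y N (@measurable_neq_head R A a0) n0.
rewrite m0N => <-.
have mCE := measurable_sdiff mC mE.
(* On the symmetric difference exactly one of the two heads is [a], so the heads differ and
   [neq_head] is 1. *)
set F := _ `|` _; rewrite -(setIT F) -integral_indic//.
have mI : measurable_fun setT (fun t : T' => (\1_F t)%:E : \bar R).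
  by apply/measurable_EFinP; exact: measurable_indic.
apply: ge0_le_integral => //.
move=> t _; rewrite lee_fin indicE; case: (boolP (t \in _)) => [|_]; last exact: n0.
rewrite inE /C /neq_head /= /past subr0.
case=> -[h1 h2]; case: eqP => //= e1; exfalso; apply: h2; first by rewrite /= e1.
by rewrite /C /D /= -e1.
Qed.

Lemma immersed_letters_noises :
  immersed P' (nat_filtrationA P' (fun n => X n \o fst)) (nat_filtration P' U).
Proof.
have sN n : sigma_algebra setT <<s past_noises n >> by exact: smallest_sigma_algebra.
have sL n : sigma_algebra setT <<s past_letters n >> by exact: smallest_sigma_algebra.
have mN n := sigma_noises_measurable a0 mX regX (n := n).
have mL n : <<s past_letters n >> `<=` @measurable _ T' := sigma_letters_measurable a0 mX (n := n).
have sub n : completion P' <<s past_letters n >> `<=` completion P' <<s past_noises n >>.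
  exact: (completion_gen (sN n) (mN n) (@letters_sub_noises n)).
split; first exact: sub.
move=> n; apply: cond_indep_kernel.
- exact: (sigma_algebra_completion P' (sL n) (mL n)).
- exact: completion_measurable.
- exact: completion_measurable.
- exact: sub.
- move=> D C hD hC; apply: adapted_setI => //; last exact: sub.
  exact: (sigma_algebra_completion P' (sN n) (mN n)).
move=> E [mE [E' [hE' EE']]].
have [C [mC E'C]] := sigma_letters_past a0 hE'.
have mk := measurable_mean_next (a0 := a0) regX mC.
pose g (t : T') : R := mean_next p C (past X n t.1 : S).
have g01 t : 0 <= g t <= 1 := mean_next_unit regX C (past X n t.1).
have mp : measurable_fun setT (fun t : T' => past X n t.1 : S).
  exact: (measurableT_comp (measurable_past mX n) measurable_fst).
have mg : measurable_fun setT g by exact: (measurableT_comp mk mp).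
exists g; split => //.
  move=> B mB; have ml := @letters_past R d T A a0 X n.
  have h : <<s past_letters n >> (g @^-1` B).
    by have mgl := measurableT_comp mk ml; have := mgl measurableT B mB; rewrite setTI.
  exact: (sub_completion P' (mL n) h).
move=> D [mD [D' [hD' DD']]].
have mE' := mL _ _ hE'; have mD' := mN _ _ hD'.
rewrite integral_setD_indic//.
(* [next_history] concerns events of the generated sigma-algebras, so [D] and [E] are traded for
   their representatives [D'] and [E'] up to null sets. *)
transitivity (\int[P']_t ((\1_D' t)%:E * (g t)%:E))%E; last first.
  apply: ae_eq_integral => //.
  - by apply/measurable_EFinP; apply: measurable_funM.
  - by apply/measurable_EFinP; apply: measurable_funM.
  have := sdiff0_indic mD' mD DD'; apply: filterS => t e _; by rewrite e.
have hDh : <<s rect n >> D'.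
  exact: (sigma_noises_history (a0 := a0) regX hD').
rewrite -(next_history mX stX regX mC hDh).
rewrite -E'C.
rewrite -[in LHS](setIT (E `&` D)) -[in RHS](setIT (E' `&` D')) -!integral_indic//; first last.
- exact: measurableI.
- exact: measurableI.
apply: ae_eq_integral => //.
- by apply/measurable_EFinP; apply: measurable_indic; exact: measurableI.
- by apply/measurable_EFinP; apply: measurable_indic; exact: measurableI.
have := sdiff0_indic mE' mE EE'; have := sdiff0_indic mD' mD DD'.
by apply: filterS2 => t e1 e2 _; rewrite !indicI /= e1 e2.
Qed.
End Standardness.

Theorem theorem3 (R : realType) (d : measure_display) (T : measurableType d)
  (P : probability T R) (A : finType) (X : int -> T -> A)
  (p : (nat -> A) -> A -> R) :
  (forall n a, measurable (X n @^-1` [set a])) ->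
  stationary P X ->
  regular_version P X p ->
  (forall a : A, {ae P, forall w, 0 < p (past X (-1) w) a}) ->
  (\sum_(0 <= n <oo) eta_n P X p n < +oo)%E ->
  standard P X.
Proof.
(* [A] is inhabited because the sample space is pointed. *)
move=> mX stX regX posX sum_eta; have a0 : A := X 0 point.
exists _, (T * R)%type, ((P \x unif R)%E : probability (T * R)%type R), fst; split=> //.
split=> [B mB|].
  rewrite (_ : fst @^-1` B = B `*` [set: R]); last by apply/seteqP; split=> t //= [].
  transitivity (P B * unif R setT)%E; first exact: product_measure1E.
  by rewrite -[RHS]mule1; congr (_ * _)%E; exact: (probability_setT (unif R)).
exists _, R, (innovation X p); split; first exact: (iid_innovation a0 mX stX regX).
exact: (immersed_letters_noises a0 mX stX regX posX sum_eta).
Qed.
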